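(* Let $\omega$ be a primitive third root of unity, let $V_+\subset\mathbb{C}^6$ be a 3-dimensional complex subspace on which the Hermitian form $H$ is positive definite, let $J=J_{V_+}$ be the associated complex structure on $\mathbb{R}^{12}=\mathbb{C}^6$, and let $X=(\mathbb{R}^{12},J)/(\mathbb{Z}[\omega])^6$ with the form $E'=\frac{2}{\sqrt3}\,\mathrm{Im}\,H$. Then $(X,E')$ is a principally polarized abelian variety of dimension $6$, it is of Weil type with field $\mathbb{K}=\mathbb{Q}(\omega)$, and the following holds. Let $\Theta$ be the automorphism of order three of $X$ given by multiplication by $\omega$, let $\Theta_3^*$ be the induced map on $H^3(X,\mathbb{Q})$, and let $$W=\ker(\Theta_3^*-\mathrm{Id})\subset H^3(X,\mathbb{Q}).$$ Then $W$ is a Hodge substructure of $H^3(X,\mathbb{Q})$ with $\dim_{\mathbb{Q}}W=40$ and Hodge numbers $(h^{3,0},h^{2,1},h^{1,2},h^{0,3})=(2,18,18,2)$, and $W$ decomposes as a direct sum $W=W_+\oplus W_-$ of two Hodge substructures, isomorphic to each other as Hodge structures, each of Calabi-Yau type with Hodge numbers $(1,9,9,1)$. In particular the Hodge structure $W_+$ of type $(1,9,9,1)$ is a polarized substructure of $H^3(X,\mathbb{Q})$.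
   Context: $H(v,w)=\sum_{j=1}^6\epsilon_j\overline{v_j}w_j$ on $\mathbb{C}^6$, with $\epsilon_1=\epsilon_2=\epsilon_3=1$, $\epsilon_4=\epsilon_5=\epsilon_6=-1$. With $V_-=V_+^\perp$ (with respect to $H$), $J=J_{V_+}$ acts as $i$ on $V_+$ and as $-i$ on $V_-$, where $i$ is the standard complex structure of $\mathbb{C}^6$. The lattice is $(\mathbb{Z}[\omega])^6\subset\mathbb{C}^6$. An abelian variety of Weil type of dimension $2g$ is a pair $(X,\mathbb{K})$, where $X$ is a $2g$-dimensional abelian variety and $\mathbb{K}\hookrightarrow\mathrm{End}(X)\otimes\mathbb{Q}$ is an imaginary quadratic field (with a fixed embedding $\mathbb{K}\subset\mathbb{C}$) such that every $k\in\mathbb{K}$ acts on the tangent space $T_0X$ as a diagonalizable map with eigenvalues $k$ and $\overline{k}$, each with multiplicity $g$. Here $\mathbb{K}=\mathbb{Q}(\omega)$ acts through multiplication by $\omega$. ''Polarized substructure'' means that $W_+$ carries the polarization obtained by restricting a polarization of the rational Hodge structure $H^3(X,\mathbb{Q})$ of the polarized abelian variety $X$. *)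

(* Defs.v *)
From HB Require Import structures.
From mathcomp Require Import all_boot all_order all_algebra.
From mathcomp Require Import boolp classical_sets functions reals.
From mathcomp Require Import complex.

Set Implicit Arguments.
Unset Strict Implicit.
Unset Printing Implicit Defensive.

Import Order.TTheory GRing.Theory Num.Theory.
Local Open Scope classical_set_scope.
Local Open Scope ring_scope.

(* Linear algebra over a subring: in all of this block, [e : F -> K] is the    *)
(* embedding through which the scalars of [F] act on the [K]-module [M].       *)
(* It is used with Z -> R (lattices), Q -> C (rational structures), and with   *)
(* the identity.                                                               *)

Section LinearAlgebra.
Variables (F K : pzRingType) (e : {rmorphism F -> K}) (M : lmodType K).

Definition is_subspace (U : set M) : Prop :=
  U 0 /\ forall a u v, U u -> U v -> U (e a *: u + v).

Definition is_basis (U : set M) (d : nat) (b : 'I_d -> M) : Prop :=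
  [/\ is_subspace U,
      forall i, U (b i),
      forall u, U u -> exists c : 'I_d -> F, u = \sum_i e (c i) *: b i &
      forall c : 'I_d -> F, \sum_i e (c i) *: b i = 0 -> forall i, c i = 0].

Definition has_dim (U : set M) (d : nat) : Prop :=
  exists b : 'I_d -> M, is_basis U b.

End LinearAlgebra.

Arguments is_subspace {F K} e {M} U.
Arguments is_basis {F K} e {M} U {d} b.
Arguments has_dim {F K} e {M} U d.

Definition ZtoR (R : realType) : {rmorphism int -> R} := intr.
Definition QtoC (R : realType) : {rmorphism rat -> R[i]} := ratr.
Definition idR (K : pzRingType) : {rmorphism K -> K} := idfun.

(* T is the internal direct sum of the subgroups U i. *)
Definition direct_sum (I : finType) (M : zmodType) (U : I -> set M)
    (T : set M) : Prop :=
  [/\ forall u : I -> M, (forall i, U i (u i)) -> T (\sum_i u i),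
      forall v, T v -> exists2 u : I -> M,
        forall i, U i (u i) & v = \sum_i u i &
      forall u : I -> M, (forall i, U i (u i)) -> \sum_i u i = 0 ->
        forall i, u i = 0].

(* A rational Hodge structure is given inside a complex vector space M: the    *)
(* rational vector space V_Q is a Q-subspace of M whose complexification is    *)
(* its complex span (is_hodge requires Q-bases of V_Q to remain independent    *)
(* over C), and hcomp p q is V^{p,q}.  Only p, q >= 0 are considered.          *)

Section HodgeStructures.
Variable R : realType.
Local Notation C := R[i].

Record hodge_data (M : lmodType C) := HodgeData {
  weight : nat;
  ratsp : set M;
  hcomp : nat -> nat -> set M }.

Definition cspan (M : lmodType C) (U : set M) : set M :=
  [set v | exists n (c : 'I_n -> C) (u : 'I_n -> M),
     (forall i, U (u i)) /\ v = \sum_i c i *: u i].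

(* w is the conjugate of v with respect to the real structure of the span of   *)
(* U; a functional relation as soon as U is a rational form of its span.       *)
Definition conj_rel (M : lmodType C) (U : set M) (v w : M) : Prop :=
  exists n (c : 'I_n -> C) (u : 'I_n -> M),
    [/\ forall i, U (u i), v = \sum_i c i *: u i
      & w = \sum_i (c i)^* *: u i].

Definition is_hodge (M : lmodType C) (X : hodge_data M) : Prop :=
  [/\ exists d (b : 'I_d -> M),
        is_basis (QtoC R) (ratsp X) b
        /\ is_basis (idR C) (cspan (ratsp X)) b,
      forall p q, (p + q = weight X)%N -> is_subspace (idR C) (hcomp X p q),
      direct_sum (fun p : 'I_(weight X).+1 => hcomp X p (weight X - p))
        (cspan (ratsp X)) &
      forall p q v w, (p + q = weight X)%N -> hcomp X p q v ->
        conj_rel (ratsp X) v w -> hcomp X q p w].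

Definition sub_hodge (M : lmodType C) (X : hodge_data M) (U : set M) :=
  HodgeData (weight X) U (fun p q => cspan U `&` hcomp X p q).

Definition is_substructure (M : lmodType C) (X : hodge_data M) (U : set M) :=
  [/\ is_hodge X, U `<=` ratsp X & is_hodge (sub_hodge X U)].

(* s lists h^{k,0}, h^{k-1,1}, ..., h^{0,k}, with k the weight. *)
Definition has_hodge_numbers (M : lmodType C) (X : hodge_data M)
    (s : seq nat) : Prop :=
  size s = (weight X).+1 /\
  forall q, (q <= weight X)%N ->
    has_dim (idR C) (hcomp X (weight X - q) q) (nth 0%N s q).

Definition calabi_yau_type (M : lmodType C) (X : hodge_data M) : Prop :=
  is_hodge X /\ has_dim (idR C) (hcomp X (weight X) 0) 1.

(* phi is (the complexification of) a Q-linear map preserving the Hodge        *)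
(* decompositions; its values outside the complexification are irrelevant.     *)
Definition hodge_morphism (M N : lmodType C) (X : hodge_data M)
    (Y : hodge_data N) (phi : M -> N) : Prop :=
  [/\ weight X = weight Y,
      forall a u v, cspan (ratsp X) u -> cspan (ratsp X) v ->
        phi (a *: u + v) = a *: phi u + phi v,
      forall u, ratsp X u -> ratsp Y (phi u) &
      forall p q u, (p + q = weight X)%N -> hcomp X p q u ->
        hcomp Y p q (phi u)].

Definition hodge_isomorphic (M N : lmodType C) (X : hodge_data M)
    (Y : hodge_data N) : Prop :=
  exists (phi : M -> N) (psi : N -> M),
    [/\ hodge_morphism X Y phi, hodge_morphism Y X psi,
        forall u, ratsp X u -> psi (phi u) = u &
        forall u, ratsp Y u -> phi (psi u) = u].

(* Q is (the C-bilinear extension of) a polarization of X: rational on V_Q,    *)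
(* (-1)^k-symmetric, satisfying both Hodge-Riemann bilinear relations.  The    *)
(* factor in the last one is i^{p-q}.                                          *)
Definition is_hodge_polarization (M : lmodType C) (X : hodge_data M)
    (Q : M -> M -> C) : Prop :=
  let V := cspan (ratsp X) in
  [/\ is_hodge X,
      (forall a u v t, V u -> V v -> V t ->
         Q (a *: u + v) t = a * Q u t + Q v t)
      /\ (forall a u v t, V u -> V v -> V t ->
         Q t (a *: u + v) = a * Q t u + Q t v),
      (forall u v, ratsp X u -> ratsp X v -> exists r : rat, Q u v = ratr r)
      /\ (forall u v, V u -> V v -> Q v u = (-1) ^+ weight X * Q u v),
      forall p q p' q' u v, (p + q = weight X)%N -> (p' + q' = weight X)%N ->
         hcomp X p q u -> hcomp X p' q' v -> p' != q -> Q u v = 0 &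
      forall p q u w, (p + q = weight X)%N -> hcomp X p q u -> u != 0 ->
         conj_rel (ratsp X) u w -> 0 < 'i ^+ p / 'i ^+ q * Q u w].

(* U is a Hodge substructure of X, polarized by the restriction of a           *)
(* polarization of X.                                                          *)
Definition polarized_substructure (M : lmodType C) (X : hodge_data M)
    (U : set M) : Prop :=
  is_substructure X U /\
  exists Q : M -> M -> C,
    is_hodge_polarization X Q /\ is_hodge_polarization (sub_hodge X U) Q.

End HodgeStructures.

(* Complex tori (V, J) / L: a real vector space V with a complex structure J   *)
(* and a lattice L.  Maps of tori are represented by their linear lifts.       *)

Section ComplexTori.
Variable R : realType.
Local Notation C := R[i].

Record torus := Torus {
  tV : lmodType R;
  tJ : tV -> tV;
  tL : set tV }.

Definition is_lattice_basis (V : lmodType R) (L : set V) (d : nat)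
    (b : 'I_d -> V) : Prop :=
  is_basis (ZtoR R) L b /\ is_basis (idR R) setT b.

Definition is_complex_torus (X : torus) (g : nat) : Prop :=
  [/\ linear (@tJ X), forall v, @tJ X (tJ v) = - v &
      exists b : 'I_(g + g) -> tV X, is_lattice_basis (@tL X) b].

(* The sign convention is E(v, Jv) > 0. *)
Definition is_polarization (X : torus) (E : tV X -> tV X -> R) : Prop :=
  [/\ (forall a u v t, E (a *: u + v) t = a * E u t + E v t)
      /\ (forall a u v t, E t (a *: u + v) = a * E t u + E t v),
      forall v, E v v = 0,
      forall u v, tL u -> tL v -> exists m : int, E u v = m%:~R,
      forall u v, E (tJ u) (tJ v) = E u v &
      forall v, v != 0 -> 0 < E v (tJ v)].

(* Principal means of type (1, ..., 1): the lattice has a symplectic basis. *)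
Definition is_ppav (X : torus) (E : tV X -> tV X -> R) (g : nat) : Prop :=
  [/\ is_complex_torus X g, is_polarization E &
      exists2 b : 'I_(g + g) -> tV X, is_lattice_basis (@tL X) b &
        \matrix_(i, j) E (b i) (b j) = block_mx 0 1%:M (- 1%:M) 0].

(* The complex vector space T_0 X = (V, J). *)
Definition cscale (X : torus) (z : C) (v : tV X) : tV X :=
  complex.Re z *: v + complex.Im z *: tJ v.

Definition is_tangent_basis (X : torus) (d : nat) (b : 'I_d -> tV X) : Prop :=
  forall v, exists! c : {ffun 'I_d -> C}, v = \sum_i cscale (c i) (b i).

Definition in_End (X : torus) (phi : tV X -> tV X) : Prop :=
  [/\ linear phi, forall v, phi (tJ v) = tJ (phi v) &
      forall v, tL v -> tL (phi v)].

(* phi represents an element of End(X) (x) Q. *)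
Definition in_EndQ (X : torus) (phi : tV X -> tV X) : Prop :=
  exists2 m : nat, (0 < m)%N & in_End (fun v => phi v *+ m).

Definition is_automorphism (X : torus) (phi : tV X -> tV X) : Prop :=
  exists psi, [/\ in_End phi, in_End psi, cancel phi psi & cancel psi phi].

(* phi has order n as an endomorphism of V / L. *)
Definition has_order (X : torus) (phi : tV X -> tV X) (n : nat) : Prop :=
  (0 < n)%N /\
  forall m : nat, (forall v, tL (iter m phi v - v)) <-> (n %| m)%N.

Definition is_imag_quadratic (K : set C) : Prop :=
  [/\ K 1 /\ (forall x y, K x -> K y -> K (x - y)),
      (forall x y, K x -> K y -> K (x * y)) /\ (forall x, K x -> K x^-1),
      has_dim (QtoC R) K 2 &
      exists2 x, K x & x \isn't Num.real].

(* X has dimension 2g and k in K acts on X as rho k. *)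
Definition is_weil_type (X : torus) (g : nat) (K : set C)
    (rho : C -> tV X -> tV X) : Prop :=
  [/\ is_complex_torus X (g + g) /\ (exists E, @is_polarization X E),
      is_imag_quadratic K,
      forall k, K k -> in_EndQ (rho k),
      [/\ forall v, rho 1 v = v,
          forall x y v, K x -> K y -> rho (x + y) v = rho x v + rho y v,
          forall x y v, K x -> K y -> rho (x * y) v = rho x (rho y v) &
          forall x y, K x -> K y -> rho x =1 rho y -> x = y] &
      forall k, K k -> exists2 b : 'I_(g + g) -> tV X, is_tangent_basis b &
        forall i : 'I_g,
          rho k (b (lshift g i)) = cscale k (b (lshift g i)) /\
          rho k (b (rshift g i)) = cscale k^* (b (rshift g i))].

(* Cohomology: H^k(X, C) is the space of alternating R-multilinear k-forms on  *)
(* V with values in C, H^k(X, Q) consists of the forms with rational values on *)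
(* the lattice, and H^{p,q}(X) is spanned by the products of p forms in        *)
(* H^{1,0} (the J-linear ones) and q forms in H^{0,1} (the J-antilinear ones). *)

Definition is_altform (V : lmodType R) (k : nat) (f : ('I_k -> V) -> C) :=
  (forall (v : 'I_k -> V) i (a : R) x y,
     f [eta v with i |-> a *: x + y] =
       a%:C%C * f [eta v with i |-> x] + f [eta v with i |-> y])
  /\ (forall (v : 'I_k -> V) i j, i != j -> v i = v j -> f v = 0).

Definition wedge (V : lmodType R) (k : nat) (a : 'I_k -> V -> C) :
    ('I_k -> V) -> C :=
  fun v => \det (\matrix_(i, j) a i (v j)).

Definition real_linear (V : lmodType R) (a : V -> C) : Prop :=
  forall (r : R) x y, a (r *: x + y) = r%:C%C * a x + a y.

Definition H10 (X : torus) : set (tV X -> C) :=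
  [set a | real_linear a /\ forall v, a (tJ v) = 'i * a v].

Definition H01 (X : torus) : set (tV X -> C) :=
  [set a | real_linear a /\ forall v, a (tJ v) = - 'i * a v].

Definition cohomology (X : torus) (k : nat) :
    hodge_data (('I_k -> tV X) -> C) :=
  HodgeData k
    [set f | is_altform f /\
       forall v, (forall i, tL (v i)) -> exists r : rat, f v = ratr r]
    (fun p q => cspan [set f | (p + q = k)%N /\
       exists2 a : 'I_k -> tV X -> C,
         forall i : 'I_k, if (i < p)%N then H10 (a i) else H01 (a i) &
         f = wedge a]).

Definition pullback (V : lmodType R) (k : nat) (phi : V -> V)
    (f : ('I_k -> V) -> C) : ('I_k -> V) -> C :=
  fun v => f (phi \o v).

End ComplexTori.

(* Restriction of scalars from C to R. *)
Definition realify (R : realType) (U : lmodType R[i]) : Type := U.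

Section Realify.
Variables (R : realType) (U : lmodType R[i]).

HB.instance Definition _ := GRing.Zmodule.on (realify U).

Definition realify_scale (r : R) (v : realify U) : realify U :=
  r%:C%C *: (v : U).

Fact realify_scaleA a b v :
  realify_scale a (realify_scale b v) = realify_scale (a * b) v.
Proof. by rewrite /realify_scale scalerA -rmorphM. Qed.

Fact realify_scale1 : left_id 1 realify_scale.
Proof. by move=> v; rewrite /realify_scale rmorph1 scale1r. Qed.

Fact realify_scaleDr : right_distributive realify_scale +%R.
Proof. by move=> a u v; rewrite /realify_scale scalerDr. Qed.

Fact realify_scaleDl v : {morph realify_scale^~ v : a b / a + b}.
Proof. by move=> a b; rewrite /realify_scale rmorphD scalerDl. Qed.

HB.instance Definition _ := GRing.Zmodule_isLmodule.Build R (realify U)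
  realify_scaleA realify_scale1 realify_scaleDr realify_scaleDl.

End Realify.

Section EisensteinTorus.
Variable R : realType.
Local Notation C := R[i].
Local Notation C6 := 'rV[R[i]]_6.

Definition sgn6 (j : 'I_6) : C := if (j < 3)%N then 1 else -1.

Definition hform (v w : C6) : C := \sum_j sgn6 j * (v 0 j)^* * w 0 j.

Definition hperp (U : {vspace C6}) : {vspace C6} :=
  (\bigcap_(i < \dim U) lker (linfun (hform (vbasis U)`_i : C6 -> C^o)))%VS.

(* Multiplication by i on Vp and by -i on the orthogonal of Vp. *)
Definition Jop (Vp : {vspace C6}) (v : C6) : C6 :=
  'i *: daddv_pi Vp (hperp Vp) v - 'i *: daddv_pi (hperp Vp) Vp v.

Definition eisenstein_lattice (w : C) : set C6 :=
  [set v | forall j, exists a b : int, v 0 j = a%:~R + b%:~R * w].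

Definition weil_torus (w : C) (Vp : {vspace C6}) : torus R :=
  @Torus R (realify C6) (Jop Vp) (eisenstein_lattice w).

Definition formE (v w : C6) : R := 2 / Num.sqrt 3 * complex.Im (hform v w).

Definition Qadjoin (w : C) : set C :=
  [set z | exists a b : rat, z = ratr a + ratr b * w].

Lemma hform_is_linear (v : C6) : linear (hform v : C6 -> C^o).
Proof.
move=> a x y; rewrite /hform scaler_sumr -big_split /=; apply: eq_bigr => j _.
by rewrite !mxE mulrDr; congr (_ + _); rewrite [a *: _]mulrCA.
Qed.

HB.instance Definition _ (v : C6) :=
  GRing.isLinear.Build C C6 C^o _ (hform v : C6 -> C^o) (hform_is_linear v).

Lemma hform_conj (v w : C6) : hform w v = (hform v w)^*.
Proof.
rewrite /hform rmorph_sum; apply: eq_bigr => j _.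
rewrite !rmorphM /= conjCK -!mulrA [v 0 j * _]mulrC; congr (_ * _).
by rewrite /sgn6; case: ifP => _; rewrite ?rmorphN rmorph1.
Qed.

Lemma hperpP (U : {vspace C6}) (w : C6) :
  reflect (forall v, v \in U -> hform v w = 0) (w \in hperp U).
Proof.
rewrite memvE; apply: (iffP subv_bigcapP) => [h v Uv | h i _].
  apply: (can_inj (@conjCK _)); rewrite rmorph0 -hform_conj.
  rewrite (coord_vbasis Uv) linear_sum big1 // => i _.
  rewrite linearZ /= hform_conj.
  have := h i isT; rewrite -memvE memv_ker lfunE /= => /eqP ->.
  by rewrite rmorph0 scaler0.
rewrite -memvE memv_ker lfunE /=.
by apply/eqP/h/vbasis_mem/mem_nth; rewrite size_tuple.
Qed.

Section PositiveSubspace.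
Variables (Vp : {vspace C6}).
Hypothesis Vp_gt0 : forall v, v \in Vp -> v != 0 -> 0 < hform v v.

Lemma capv_hperp : (Vp :&: hperp Vp = 0)%VS.
Proof.
apply/eqP; rewrite -subv0; apply/subvP => v; rewrite memv_cap memv0.
case/andP => Vv /hperpP/(_ v Vv) v0; apply/negP => /negP /(Vp_gt0 Vv).
by rewrite v0 ltxx.
Qed.

Lemma Jop_Vp v : v \in Vp -> Jop Vp v = 'i *: v.
Proof.
move=> Vv; rewrite /Jop (daddv_pi_id capv_hperp Vv).
have := daddv_pi_add capv_hperp (subvP (addvSl _ (hperp Vp)) v Vv).
rewrite (daddv_pi_id capv_hperp Vv) => /(congr1 (+%R (- v))).
by rewrite addKr addNr => ->; rewrite scaler0 subr0.
Qed.

Lemma Jop_hperp v : v \in hperp Vp -> Jop Vp v = - 'i *: v.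
Proof.
have cap' : (hperp Vp :&: Vp = 0)%VS by rewrite capvC capv_hperp.
move=> Vv; rewrite /Jop (daddv_pi_id cap' Vv).
have := daddv_pi_add cap' (subvP (addvSl _ Vp) v Vv).
rewrite (daddv_pi_id cap' Vv) => /(congr1 (+%R (- v))).
by rewrite addKr addNr => ->; rewrite scaler0 sub0r scaleNr.
Qed.

End PositiveSubspace.

End EisensteinTorus.

(* Main.v *)
(* Theta-invariance splits a form into a C-trilinear and a C-antitrilinear part, so
   W (x) C is the sum of two copies of the third exterior power of a 6-dimensional space.
   Since J has determinant one and preserves the Hermitian form H, the star operator
   F |-> F /\ H(x,-) /\ H(y,-) /\ H(z,-) exchanges the two parts and respects Hodge
   types.  It is defined over Q, and its square is the identity because
   (-1)^9 epsilon_1 ... epsilon_6 = 1; W_+ and W_- are its eigenspaces in W, and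
   multiplication by 2 w + 1, which anticommutes with the star operator, exchanges them.
   Projecting W_+ (x) C to trilinear forms gives the Hodge numbers 'C(3,p)^2. *)

Require Import Defs.
From mathcomp Require Import all_boot all_order all_algebra.
From mathcomp Require Import boolp classical_sets functions reals.
From mathcomp Require Import perm complex ring lra zify.

Set Implicit Arguments.
Unset Strict Implicit.
Unset Printing Implicit Defensive.

Import Order.TTheory GRing.Theory Num.Theory.
Local Open Scope classical_set_scope.
Local Open Scope ring_scope.

(** * Alternating trilinear forms *)

(** The pullback along [J] does not separate the Hodge types: it acts on H^{p,q} by i^(p - q), which
    is the same for H^{3,0} and H^{1,2}. The pullback along 1 + J has four distinct eigenvalues on
    H^3. Hodge types thus become eigenspaces of a single operator, and a rational subspace is a
    Hodge substructure once its complex span is stable under that operator. Work with types is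
    replaced by commutation with 1 + J, which scales H by 2 and has determinant 2^3. The trilinear
    and the antitrilinear part of W (x) C are both stable under 1 + J, but complex conjugation
    exchanges them, so neither comes from a rational subspace. A splitting over Q has to mix them,
    which is why an involution exchanging the two parts is needed. The polarization of H^3 is the
    third tensor power of the inverse of E', restricted to alternating forms. Rationality is visible
    in a lattice basis and positivity in a basis orthonormal for E'(x, J y); independence of the
    basis connects the two. *)

Section Triples.

Definition tri (V : Type) (x y z : V) : 'I_3 -> V :=
  fun i => if val i is k.+1 then if k is 0%N then y else z else x.

Lemma triE (V : Type) (v : 'I_3 -> V) : tri (v 0) (v 1) (v 2) = v.
Proof.
apply/funext => -[[|[|[|//]]] lt_i3]; rewrite /tri /=; congr v; exact: val_inj.
Qed.

Lemma tri_comp (V U : Type) (h : V -> U) (x y z : V) :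
  h \o tri x y z = tri (h x) (h y) (h z).
Proof. by apply/funext => -[[|[|[|//]]] lt_i3]. Qed.

Definition triple (n : nat) :=
  {t : 'I_n * 'I_n * 'I_n | (t.1.1 < t.1.2)%N && (t.1.2 < t.2)%N}.

Definition tr0 n (t : triple n) : 'I_n := (val t).1.1.
Definition tr1 n (t : triple n) : 'I_n := (val t).1.2.
Definition tr2 n (t : triple n) : 'I_n := (val t).2.

Lemma tripleP n (t : triple n) : (tr0 t < tr1 t)%N /\ (tr1 t < tr2 t)%N.
Proof. exact/andP/(valP t). Qed.

Lemma triple_inj n (s t : triple n) :
  tr0 s = tr0 t -> tr1 s = tr1 t -> tr2 s = tr2 t -> s = t.
Proof.
case: s t => -[[a b] c] h [[[a' b'] c'] h']; rewrite /tr0 /tr1 /tr2 /=.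
by move=> e0 e1 e2; apply: val_inj; rewrite /= e0 e1 e2.
Qed.

(** Nested sums over ordinals reduce by computation, unlike a sum over the subtype; the counts of
    triples rest on this. *)
Lemma big_triple (A : Type) (x0 : A) (op : Monoid.com_law x0) n
    (F : 'I_n -> 'I_n -> 'I_n -> A) :
  \big[op/x0]_(t : triple n) F (tr0 t) (tr1 t) (tr2 t) =
  \big[op/x0]_(i < n) \big[op/x0]_(j < n) \big[op/x0]_(k < n | (i < j < k)%N)
     F i j k.
Proof.
rewrite pair_bigA /= (pair_big_dep xpredT) /=.
rewrite [RHS](reindex_omap (val : triple n -> _) insub); last first.
  by move=> t /= h; rewrite insubT.
by apply: eq_big => // t; rewrite valK eqxx (valP t).
Qed.

End Triples.

Section AlternatingForms.
Variable R : realType.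
Local Notation C := R[i].
Variables (K : pzRingType) (e : {rmorphism K -> C}) (V : lmodType K).
Implicit Types F G : V -> V -> V -> C.

Definition elin (a : V -> C) : Prop :=
  forall r x y, a (r *: x + y) = e r * a x + a y.

Lemma elin0 a : elin a -> a 0 = 0.
Proof. by move/(_ 1 0 0); rewrite scaler0 addr0 rmorph1 mul1r => /esym/eqP; rewrite -subr_eq0
  addrK => /eqP. Qed.

Lemma elinD a x y : elin a -> a (x + y) = a x + a y.
Proof. by move/(_ 1 x y); rewrite scale1r rmorph1 mul1r. Qed.

Lemma elinZ a r x : elin a -> a (r *: x) = e r * a x.
Proof. by move=> h; have := h r x 0; rewrite !addr0 (elin0 h) addr0. Qed.

Lemma elin_sum a (I : Type) (s : seq I) (P : pred I) (F : I -> V) : elin a ->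
  a (\sum_(i <- s | P i) F i) = \sum_(i <- s | P i) a (F i).
Proof.
move=> h; elim/big_rec2: _ => [|i y x _ <-]; first exact: elin0.
exact: elinD.
Qed.

(* The embedding [e] makes this cover R-trilinear, C-trilinear (e = id) and
   C-antitrilinear (e = conjugation) forms at once; linearity in the other slots
   and vanishing on repeated arguments follow. *)
Definition alt3 F : Prop :=
  [/\ forall y z, elin (fun x => F x y z),
      forall x y z, F x y z = - F y x z & forall x y z, F x y z = - F x z y].

Lemma alt3_lin2 F x z : alt3 F -> elin (fun y => F x y z).
Proof.
case=> l s1 s2 r y y'; rewrite ![F x _ _]s1 l; ring.
Qed.

Lemma alt3_lin3 F x y : alt3 F -> elin (fun z => F x y z).
Proof.
move=> aF r z z'; have [l s1 s2] := aF.
rewrite ![F x y _]s2 (alt3_lin2 _ _ aF); ring.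
Qed.

Lemma oppr_id0 (x : C) : x = - x -> x = 0.
Proof.
by move/eqP; rewrite -subr_eq0 opprK -mulr2n mulrn_eq0 => /eqP.
Qed.

Lemma alt3_12 F x z : alt3 F -> F x x z = 0.
Proof. by case=> _ s1 _; apply: oppr_id0; apply: s1. Qed.

Lemma alt3_23 F x y : alt3 F -> F x y y = 0.
Proof. by case=> _ _ s1; apply: oppr_id0; apply: s1. Qed.

Lemma alt3_13 F x y : alt3 F -> F x y x = 0.
Proof. by move=> aF; case: (aF) => _ _ ->; rewrite (alt3_12 _ _ aF) oppr0. Qed.

Lemma alt3_D F G a : alt3 F -> alt3 G -> alt3 (fun x y z => a * F x y z + G x y z).
Proof.
move=> [l s t] [l' s' t']; split.
- by move=> y z r x x'; rewrite l l'; ring.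
- by move=> x y z; rewrite s s'; ring.
- by move=> x y z; rewrite t t'; ring.
Qed.

Lemma alt3_0 : alt3 (fun _ _ _ => 0).
Proof. by split=> *; [move=> *|..]; ring. Qed.

Lemma alt3_sum (I : Type) (s : seq I) (P : pred I) (a : I -> C) (F : I -> V -> V -> V -> C) :
  (forall i, alt3 (F i)) ->
  alt3 (fun x y z => \sum_(i <- s | P i) a i * F i x y z).
Proof.
move=> h; elim: s => [|i s IH].
  have -> : (fun x y z => \sum_(i <- [::] | P i) a i * F i x y z) = fun _ _ _ => 0.
    by do 3 apply/funext => ?; rewrite big_nil.
  exact: alt3_0.
have -> : (fun x y z => \sum_(j <- i :: s | P j) a j * F j x y z) =
    if P i then fun x y z => a i * F i x y z + \sum_(j <- s | P j) a j * F j x y z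
    else fun x y z => \sum_(j <- s | P j) a j * F j x y z.
  by case: ifP => Pi; do 3 apply/funext => ?; rewrite big_cons Pi.
by case: ifP => _ //; apply: alt3_D.
Qed.

(** The 3 by 3 determinant of the values a_i(x_j), written out so that [ring] applies. *)
Definition wedge3 (T : Type) (a0 a1 a2 : T -> C) (x y z : T) : C :=
  a0 x * (a1 y * a2 z - a1 z * a2 y) - a0 y * (a1 x * a2 z - a1 z * a2 x)
  + a0 z * (a1 x * a2 y - a1 y * a2 x).

Lemma alt3_wedge3 a0 a1 a2 : elin a0 -> elin a1 -> elin a2 ->
  alt3 (wedge3 a0 a1 a2).
Proof.
move=> l0 l1 l2; split; rewrite /wedge3.
- move=> y z r x x'; rewrite l0 l1 l2; ring.
- move=> x y z; ring.
- move=> x y z; ring.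
Qed.

Section Basis.
Variables (n : nat) (b : 'I_n -> V) (c : 'I_n -> V -> K).
Hypothesis bc : forall x, x = \sum_i c i x *: b i.

(** Multilinear expansion reduces to values on [b], and transpositions sort the indices. The family
    [b] comes with arbitrary coefficient functions, so the lemma also applies to the vectors
    [tJ (e i)] in the proof of positivity. *)
Lemma alt3_eq0_basis F : alt3 F ->
  (forall t : triple n, F (b (tr0 t)) (b (tr1 t)) (b (tr2 t)) = 0) ->
  forall x y z, F x y z = 0.
Proof.
move=> aF F0 x y z; have [l s1 s2] := aF.
have F0' (i j k : 'I_n) : (i < j)%N -> (j < k)%N -> F (b i) (b j) (b k) = 0.
  move=> ij jk; have lt : (i < j)%N && (j < k)%N by rewrite ij jk.
  exact: (F0 (exist (fun t : 'I_n * 'I_n * 'I_n => _) (i, j, k) lt)).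
rewrite (bc x) (elin_sum _ _ _ (l _ _)) big1 // => i _.
rewrite (elinZ _ _ (l _ _)) (bc y) (elin_sum _ _ _ (alt3_lin2 _ _ aF)) big1 ?mulr0 // => j _.
rewrite (elinZ _ _ (alt3_lin2 _ _ aF)) (bc z) (elin_sum _ _ _ (alt3_lin3 _ _ aF)) big1 ?mulr0
  // => k _.
rewrite (elinZ _ _ (alt3_lin3 _ _ aF)).
suff -> : F (b i) (b j) (b k) = 0 by rewrite mulr0.
have [ij|ij|/val_inj ->] := ltngtP i j; last by rewrite (alt3_12 _ _ aF).
- have [jk|jk|/val_inj ->] := ltngtP j k; last by rewrite (alt3_23 _ _ aF).
    exact: F0'.
  have [ik|ik|/val_inj ->] := ltngtP i k; last by rewrite (alt3_13 _ _ aF).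
    by rewrite s2 F0' ?oppr0.
  by rewrite s2 s1 F0' ?oppr0.
- have [ik|ik|/val_inj ->] := ltngtP i k; last by rewrite (alt3_13 _ _ aF).
    by rewrite s1 F0' ?oppr0.
  have [jk|jk|/val_inj ->] := ltngtP j k; last by rewrite (alt3_23 _ _ aF).
    by rewrite s1 s2 F0' ?oppr0.
  by rewrite s1 s2 s1 F0' ?oppr0.
Qed.

Hypothesis c_lin : forall i, elin (e \o c i).
Hypothesis cb : forall i j, c i (b j) = (i == j)%:R.

Definition cowedge (t : triple n) : V -> V -> V -> C :=
  wedge3 (e \o c (tr0 t)) (e \o c (tr1 t)) (e \o c (tr2 t)).

Lemma alt3_cowedge t : alt3 (cowedge t).
Proof. exact: alt3_wedge3. Qed.

Lemma cowedge_basis s t :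
  cowedge t (b (tr0 s)) (b (tr1 s)) (b (tr2 s)) = (t == s)%:R.
Proof.
rewrite /cowedge /wedge3 /= !cb !rmorph_nat.
have [st|/eqP st] := eqVneq t s.
  have [] := tripleP s; rewrite st => h h'.
  rewrite !eqxx -!val_eqE /= (gtn_eqF h) (gtn_eqF h') (gtn_eqF (ltn_trans h h')).
  rewrite (ltn_eqF h) (ltn_eqF h') (ltn_eqF (ltn_trans h h')) /=; ring.
have [lt1 lt2] := tripleP s; have [lt3 lt4] := tripleP t.
rewrite -!val_eqE /=.
(* Each pattern of equalities between the two increasing triples either makes every term vanish,
   contradicts the order, or forces the triples to agree. *)
case: eqP => [e0|]; case: eqP => [e1|]; case: eqP => [e2|];
case: eqP => [f0|]; case: eqP => [f1|]; case: eqP => [f2|];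
case: eqP => [g0|]; case: eqP => [g1|]; case: eqP => [g2|] => *;
rewrite /=; try ring; exfalso; try lia;
apply: st; apply: triple_inj; exact: val_inj.
Qed.

Lemma alt3_basis F : alt3 F -> forall x y z,
  F x y z = \sum_(t : triple n) F (b (tr0 t)) (b (tr1 t)) (b (tr2 t)) * cowedge t x y z.
Proof.
move=> aF x y z; apply/eqP; rewrite -subr_eq0 -opprB oppr_eq0 addrC; apply/eqP.
pose G x y z := (-1) * F x y z +
  \sum_(t : triple n) F (b (tr0 t)) (b (tr1 t)) (b (tr2 t)) * cowedge t x y z.
have aG : alt3 G by apply: alt3_D => //; apply: alt3_sum; apply: alt3_cowedge.
rewrite -[- F x y z]mulN1r; apply: (alt3_eq0_basis aG) => s; rewrite /G.
rewrite (bigD1 s) //= cowedge_basis eqxx mulr1 mulN1r big1 ?addr0 ?addNr //.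
by move=> t /negPf ts; rewrite cowedge_basis ts mulr0.
Qed.

End Basis.

End AlternatingForms.

(** * Subspaces and complex spans *)

Section Spans.
Variable R : realType.
Local Notation C := R[i].

Lemma subspace_sum (F K : pzRingType) (e : {rmorphism F -> K}) (M : lmodType K)
    (U : set M) (I : Type) (s : seq I) (P : pred I) (c : I -> F) (u : I -> M) :
  is_subspace e U -> (forall i, P i -> U (u i)) ->
  U (\sum_(i <- s | P i) e (c i) *: u i).
Proof.
move=> [U0 Ulin] Uu; elim: s => [|i s IH]; first by rewrite big_nil.
by rewrite big_cons; case: ifP => // Pi; apply: Ulin => //; apply: Uu.
Qed.

Variable M : lmodType C.
Implicit Types U S : set M.

Lemma subspaceD (F K : pzRingType) (e : {rmorphism F -> K}) (N : lmodType K)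
  (U : set N) u v : is_subspace e U -> U u -> U v -> U (u + v).
Proof. by case=> _ h Uu Uv; have := h 1 u v Uu Uv; rewrite rmorph1 scale1r. Qed.

Lemma subspaceZ (F K : pzRingType) (e : {rmorphism F -> K}) (N : lmodType K)
  (U : set N) a u : is_subspace e U -> U u -> U (e a *: u).
Proof. by case=> U0 h Uu; have := h a u 0 Uu U0; rewrite addr0. Qed.

Lemma sub_cspan U : U `<=` cspan U.
Proof.
move=> u Uu; exists 1%N, (fun=> 1), (fun=> u); split => //.
by rewrite big_ord1 scale1r.
Qed.

Lemma cspan_subspace U : is_subspace (idR C) (cspan U).
Proof.
split; first by exists 0%N, (fun=> 0), (fun=> 0); split; [case|rewrite big_ord0].
move=> a _ _ [n [c [u [Uu ->]]]] [m [d [v [Uv ->]]]].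
exists (n + m)%N, (fun i => match fintype.split i with inl j => a * c j | inr j => d j end),
  (fun i => match fintype.split i with inl j => u j | inr j => v j end); split.
  by move=> i; case: (fintype.split i).
rewrite big_split_ord /= scaler_sumr; congr (_ + _); apply: eq_bigr => i _.
  by have /= -> := unsplitK (inl i : 'I_n + 'I_m); rewrite scalerA.
by have /= -> := unsplitK (inr i : 'I_n + 'I_m).
Qed.

Lemma csubspace_sum U (I : Type) (s : seq I) (P : pred I) (c : I -> C) (u : I -> M) :
  is_subspace (idR C) U -> (forall i, P i -> U (u i)) ->
  U (\sum_(i <- s | P i) c i *: u i).
Proof. by move=> hU; apply: (@subspace_sum _ _ (idR C) _ U I s P c u hU). Qed.

Lemma cspan_min U S : is_subspace (idR C) S -> U `<=` S -> cspan U `<=` S.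
Proof.
by move=> hS US _ [n [c [u [Uu ->]]]]; apply: csubspace_sum => // i _; apply: US.
Qed.

Lemma subspaceI U S : is_subspace (idR C) U -> is_subspace (idR C) S ->
  is_subspace (idR C) (U `&` S).
Proof.
move=> [U0 hU] [S0 hS]; split => // a u v [Uu Su] [Uv Sv]; split; [exact: hU|exact: hS].
Qed.

End Spans.

(** * Alternating 3-forms as ternary functions *)

Section Forms.
Variables (R : realType) (V : lmodType R).
Local Notation C := R[i].
Local Notation eR := (real_complex R).
Implicit Types f g : ('I_3 -> V) -> C.

Definition tern (T : Type) (f : ('I_3 -> T) -> C) : T -> T -> T -> C :=
  fun x y z => f (tri x y z).
Definition unt (T : Type) (F : T -> T -> T -> C) : ('I_3 -> T) -> C :=
  fun v => F (v 0) (v 1) (v 2).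

Lemma ternK (T : Type) (f : ('I_3 -> T) -> C) : unt (tern f) = f.
Proof. by apply/funext => v; rewrite /unt /tern triE. Qed.

Lemma ord3P (i : 'I_3) : [\/ i = 0, i = 1 | i = 2].
Proof.
by case: i => [[|[|[|//]]] h]; [constructor 1|constructor 2|constructor 3]; apply: val_inj.
Qed.

Lemma tri_upd0 (u x y z : V) : ([eta tri u y z with (0 : 'I_3) |-> x] : 'I_3 -> V) = tri x y z.
Proof. by apply/funext => i; have [->|->|->] := ord3P i. Qed.
Lemma tri_upd1 (u x y z : V) : ([eta tri x u z with (1 : 'I_3) |-> y] : 'I_3 -> V) = tri x y z.
Proof. by apply/funext => i; have [->|->|->] := ord3P i. Qed.
Lemma tri_upd2 (u x y z : V) : ([eta tri x y u with (2 : 'I_3) |-> z] : 'I_3 -> V) = tri x y z.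
Proof. by apply/funext => i; have [->|->|->] := ord3P i. Qed.

Lemma altformP f : is_altform f <-> alt3 eR (tern f).
Proof.
split=> [[ml al]|af].
  have l0 y z : elin eR (fun x => tern f x y z).
    by move=> r x x'; have := ml (tri 0 y z) 0 r x x'; rewrite !tri_upd0.
  have l1 x z : elin eR (fun y => tern f x y z).
    by move=> r y y'; have := ml (tri x 0 z) 1 r y y'; rewrite !tri_upd1.
  have l2 x y : elin eR (fun z => tern f x y z).
    by move=> r z z'; have := ml (tri x y 0) 2 r z z'; rewrite !tri_upd2.
  have a0 x z : tern f x x z = 0 by apply: (al _ 0 1).
  have a1 x y : tern f x y y = 0 by apply: (al _ 1 2).
  split => // x y z.
    have := a0 (x + y) z; rewrite (elinD _ _ (l0 _ _)) !(elinD _ _ (l1 _ _)) !a0 add0r addr0.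
    by move/eqP; rewrite addr_eq0 => /eqP.
  have := a1 x (y + z); rewrite (elinD _ _ (l1 _ _)) !(elinD _ _ (l2 _ _)) !a1 add0r addr0.
  by move/eqP; rewrite addr_eq0 => /eqP.
have [l s1 s2] := af.
split=> [v i a x y|v i j].
  rewrite -(triE v); have [->|->|->] := ord3P i; rewrite ?tri_upd0 ?tri_upd1 ?tri_upd2.
  - exact: l.
  - exact: (alt3_lin2 _ _ af).
  - exact: (alt3_lin3 _ _ af).
rewrite -(triE v).
have [->|->|->] := ord3P i; have [->|->|->] := ord3P j => //= _; rewrite /tri /= => h;
  rewrite -/(tri _ _ _) -/(tern f _ _ _) ?h.
- exact: (alt3_12 _ _ af).
- exact: (alt3_13 _ _ af).
- exact: (alt3_12 _ _ af).
- exact: (alt3_23 _ _ af).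
- exact: (alt3_13 _ _ af).
- exact: (alt3_23 _ _ af).
Qed.

Lemma altform_subspace : is_subspace (idR C) (@is_altform R V 3).
Proof.
split; first by apply/altformP; apply: alt3_0.
by move=> a f g /altformP af /altformP ag; apply/altformP; apply: alt3_D.
Qed.

Lemma det_mx22 (A : 'M[C]_2) : \det A =
  A ord0 ord0 * A (lift ord0 ord0) (lift ord0 ord0)
  - A ord0 (lift ord0 ord0) * A (lift ord0 ord0) ord0.
Proof.
(* Entries are read through natural numbers, so that different expressions for one ordinal become
   the same atom for [ring]. *)
pose F (i j : nat) := A (inord i) (inord j).
have AE i j : A i j = F i j by rewrite /F !inord_val.
rewrite (expand_det_row _ ord0) !big_ord_recl big_ord0 /cofactor !det_mx11 !mxE !AE /=.
have b00 : bump 0 0 = 1%N by []; have b10 : bump 1 0 = 0%N by [].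
rewrite ?(b00, b10) addn0 addn1 expr0 expr1; ring.
Qed.

Lemma det_mx33 (A : 'M[C]_3) : \det A =
  A 0 0 * (A 1 1 * A 2 2 - A 1 2 * A 2 1)
  - A 0 1 * (A 1 0 * A 2 2 - A 1 2 * A 2 0)
  + A 0 2 * (A 1 0 * A 2 1 - A 1 1 * A 2 0).
Proof.
pose F (i j : nat) := A (inord i) (inord j).
have AE i j : A i j = F i j by rewrite /F !inord_val.
rewrite (expand_det_row _ 0) !big_ord_recl big_ord0 /cofactor.
rewrite !det_mx22 !mxE !AE /=.
have b00 : bump 0 0 = 1%N by []; have b10 : bump 1 0 = 0%N by [].
have b01 : bump 0 1 = 2%N by []; have b11 : bump 1 1 = 2%N by [].
have b20 : bump 2 0 = 0%N by []; have b21 : bump 2 1 = 1%N by [].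
have m1 : (1 %% 3)%N = 1%N by []; have m2 : ((1 + 1) %% 3)%N = 2%N by [].
rewrite ?(b00, b01, b10, b11, b20, b21, m1, m2) !add0n expr0 expr1 sqrrN expr1n.
ring.
Qed.

Lemma wedgeE (a : 'I_3 -> V -> C) : wedge a = unt (wedge3 (a 0) (a 1) (a 2)).
Proof. by apply/funext => v; rewrite /wedge det_mx33 !mxE. Qed.

Lemma wedge_tri (a b c : V -> C) : wedge (tri a b c) = unt (wedge3 a b c).
Proof. by rewrite wedgeE. Qed.

End Forms.

(** * The Hodge decomposition of H^3 as an eigenspace decomposition *)

Section WeilOperator.
Variables (R : realType) (X : torus R).
Local Notation C := R[i].
Local Notation V := (tV X).
Local Notation eR := (real_complex R).
Local Notation Form := (('I_3 -> V) -> C).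
Implicit Types f g : Form.

(* The eigenvalue of (1 + J)^* on H^{p,3-p}.  As (1 + J)^4 = -4, these are the
   four distinct fourth roots of (-4)^3 = -64. *)
Definition lam (p : nat) : C := (1 + 'i) ^+ p * (1 - 'i) ^+ (3 - p).

Let i2 : 'i ^+ 2 = -1 :> C := sqrCi _.

Lemma lam0 : lam 0 = -2 - 2 * 'i.
Proof. rewrite /lam; ring: i2. Qed.
Lemma lam1 : lam 1 = 2 - 2 * 'i.
Proof. rewrite /lam; ring: i2. Qed.
Lemma lam2 : lam 2 = 2 + 2 * 'i.
Proof. rewrite /lam; ring: i2. Qed.
Lemma lam3 : lam 3 = -2 + 2 * 'i.
Proof. rewrite /lam; ring: i2. Qed.
Definition lamE := (lam0, lam1, lam2, lam3).

Lemma lam_conj p : (p <= 3)%N -> (lam p)^* = lam (3 - p).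
Proof.
move=> p3; rewrite /lam rmorphM !rmorphXn /= rmorphD rmorphB /= rmorph1 conjCi opprK.
by rewrite subKn // mulrC.
Qed.

(** As (1 + i) / (1 - i) = i, the product is 8 i^(p + q + 1), and p + q = 3 is the only value up to
    6 for which the power of i is 1. *)
Lemma lamM p q : (p <= 3)%N -> (q <= 3)%N -> lam p * lam q = 8 -> (p + q = 3)%N.
Proof.
move=> p3 q3 h; have {h} : (8%:R^-1 * (lam p * lam q)) * 4%:R = 4%:R.
  by rewrite h mulVf ?mul1r // pnatr_eq0.
have ni0 : 4%:R != 0 :> C by rewrite pnatr_eq0.
have n2 (x : C) : (x == - x) = (x == 0).
  by rewrite -subr_eq0 opprK -mulr2n mulrn_eq0.
have ii : 'i != - 1 :> C.
  by apply/eqP => h; have := i2; rewrite h sqrrN expr1n => /eqP; rewrite n2 oner_eq0.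
have ii' : 'i != 1 :> C.
  by apply/eqP => h; have := i2; rewrite h expr1n => /eqP; rewrite n2 oner_eq0.
have n1 : (-1 : C) != 1 by rewrite eq_sym n2 oner_eq0.
have key (x : C) : 8%:R^-1 * x * 4%:R = 4%:R -> x = 8.
  move=> h; apply: (mulfI (x := 8%:R^-1 * 4%:R)).
    by rewrite mulf_neq0 // invr_eq0 pnatr_eq0.
  by rewrite mulrAC h mulrAC mulVf ?mul1r // pnatr_eq0.
move/key.
have r1 : 8 * 'i <> 8 :> C.
  by rewrite -[RHS]mulr1 => /mulfI h; case/eqP: ii'; apply: h; rewrite pnatr_eq0.
have r2 : - 8 * 'i <> 8 :> C.
  rewrite mulNr -mulrN -[RHS]mulr1 => /mulfI h; case/eqP: ii; apply/eqP.
  by rewrite -eqr_oppLR; apply/eqP/h; rewrite pnatr_eq0.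
have r3 : - 8 <> 8 :> C by move/eqP; rewrite eq_sym n2 pnatr_eq0.
move: p p3 q q3 => [|[|[|[|//]]]] _ [|[|[|[|//]]]] _ //; rewrite !lamE => h; exfalso;
  try (apply: r1; rewrite -[RHS]h; ring: i2);
  try (apply: r2; rewrite -[RHS]h; ring: i2);
  try (apply: r3; rewrite -[RHS]h; ring: i2).
Qed.

Lemma lam_subM p : (p <= 3)%N -> lam p * lam (3 - p) = 8.
Proof.
by move: p => [|[|[|[|//]]]] _; rewrite ?subnn /= ?subSS ?subn0 !lamE; ring: i2.
Qed.

Lemma lam_inj p q : (p <= 3)%N -> (q <= 3)%N -> lam p = lam q -> p = q.
Proof.
move=> p3 q3 h; have := @lamM p (3 - q) p3 (leq_subr _ _).
rewrite h (lam_subM q3) => /(_ erefl); lia.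
Qed.

Definition oneJ (v : V) : V := v + tJ v.
Local Notation pb := (@pullback R V 3 oneJ).

Lemma pb_lin a f g : pb (a *: f + g) = a *: pb f + pb g.
Proof. by []. Qed.

(* The Fourier projector of the order-four operator (1 + J)^* / lam p; here
   8^-1 * lam (3 - p) is the inverse of lam p. *)
Definition proj p f : Form :=
  let m := 8^-1 * lam (3 - p) in
  4^-1 *: (f + m *: pb f + m ^+ 2 *: pb (pb f) + m ^+ 3 *: pb (pb (pb f))).

Lemma proj_lin p a f g : proj p (a *: f + g) = a *: proj p f + proj p g.
Proof.
apply/funext => v; rewrite /proj ?(addrfctE, scalrfctE).
rewrite /pullback /= ?(addrfctE, scalrfctE) /= /GRing.scale /=.
ring.
Qed.

Lemma proj_eig p q f : (p <= 3)%N -> (q <= 3)%N -> pb f = lam p *: f ->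
  proj q f = (p == q)%:R *: f.
Proof.
move=> p3 q3 h; rewrite /proj !h.
have pbZ a g : pb (a *: g) = a *: pb g by [].
rewrite !pbZ !h !pbZ !h.
apply/funext => v; rewrite ?(addrfctE, scalrfctE) /= /GRing.scale /=.
have n8 : 8 != 0 :> C by rewrite pnatr_eq0.
have n4 : 4 != 0 :> C by rewrite pnatr_eq0.
move: p q p3 q3 {h} => [|[|[|[|//]]]] [|[|[|[|//]]]] _ _; rewrite ?subnn ?subSS ?subn0 !lamE /=;
  field: i2; rewrite ?n8 ?n4 //.
Qed.

(** The factors lam (3 - p) / 8 differ by the fourth roots of unity, so their first, second and
    third powers sum to zero over p. *)
Lemma proj_sum f : \sum_(p < 4) proj p f = f.
Proof.
rewrite !big_ord_recl big_ord0 /= /proj.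
apply/funext => v; rewrite ?(addrfctE, scalrfctE) /= /GRing.scale /=.
have n8 : 8 != 0 :> C by rewrite pnatr_eq0.
have n4 : 4 != 0 :> C by rewrite pnatr_eq0.
rewrite /bump !leq0n /= !add1n ?subSS ?subn0 !lamE; field: i2; rewrite ?n8 ?n4 //.
Qed.

(** The projectors are polynomials in the operator, so a stable subspace contains the Hodge
    components of its elements. *)
Lemma pb_subspace (U : set Form) p f : is_subspace (idR C) U ->
  (forall g, U g -> U (pb g)) -> U f -> U (proj p f).
Proof.
move=> hU h Uf; have hZ a g : U g -> U (a *: g) by apply: (subspaceZ (e := idR C) a hU).
have hD g g' : U g -> U g' -> U (g + g') by apply: (subspaceD hU).
have U1 := h _ Uf; have U2 := h _ U1; have U3 := h _ U2.
rewrite /proj; apply: (hZ).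
exact: hD (hD _ _ (hD _ _ Uf (hZ _ _ U1)) (hZ _ _ U2)) (hZ _ _ U3).
Qed.

Hypothesis J_lin : linear (@tJ _ X).
Hypothesis JJ : forall v, @tJ _ X (tJ v) = - v.

Lemma tJD u v : @tJ _ X (u + v) = tJ u + tJ v.
Proof. by have := J_lin 1 u v; rewrite !scale1r. Qed.
Lemma tJN u : @tJ _ X (- u) = - tJ u.
Proof. by rewrite -[in LHS]JJ -!JJ. Qed.
Lemma tJ0 : @tJ _ X 0 = 0.
Proof. by apply: (addrI (@tJ _ X 0)); rewrite -tJD !addr0. Qed.

(** (1 + J)^2 = 2 J, and 2 J squares to -4. *)
Lemma oneJ4 v : oneJ (oneJ (oneJ (oneJ v))) = (-4) *: v.
Proof.
have M2 u : oneJ (oneJ u) = (2 : R) *: tJ u.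
  by rewrite /oneJ tJD JJ [u + _]addrC addrACA subrr addr0 scaler_nat mulr2n.
by rewrite M2 [oneJ (oneJ v)]M2 -[(2 *: tJ v)]addr0 J_lin tJ0 addr0 JJ scalerA scalerN scaleNr
  -natrM.
Qed.

Lemma pb4 f : is_altform f -> pb (pb (pb (pb f))) = (-64) *: f.
Proof.
move/altformP => af; rewrite -[LHS]ternK -[RHS]ternK; congr unt.
do 3 apply/funext => ?; rewrite /tern /pullback scalrfctE !tri_comp !oneJ4 -/(tern f _ _ _).
have [l _ _] := af.
rewrite (elinZ _ _ (l _ _)) (elinZ _ _ (alt3_lin2 _ _ af)) (elinZ _ _ (alt3_lin3 _ _ af)).
rewrite /GRing.scale /= -/(tern f _ _ _) -!/(real_complex R _) rmorphN rmorph_nat; ring.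
Qed.

Lemma pb_proj p f : (p <= 3)%N -> is_altform f -> pb (proj p f) = lam p *: proj p f.
Proof.
move=> p3 af; rewrite /proj.
have E a b d f0 f1 f2 f3 (k : C) : pb (k *: (f0 + a *: f1 + b *: f2 + d *: f3)) =
   k *: (pb f0 + a *: pb f1 + b *: pb f2 + d *: pb f3) by [].
rewrite E pb4 //.
have n8 : 8 != 0 :> C by rewrite pnatr_eq0.
have n4 : 4 != 0 :> C by rewrite pnatr_eq0.
apply/funext => v; rewrite ?(addrfctE, scalrfctE) /= /GRing.scale /=.
by move: p p3 => [|[|[|[|//]]]] _; rewrite ?subnn ?subSS ?subn0 !lamE /=;
  field: i2; rewrite ?n8 ?n4.
Qed.

Lemma altform_pb f : is_altform f -> is_altform (pb f).
Proof.
have oD r x y : oneJ (r *: x + y) = r *: oneJ x + oneJ y.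
  by rewrite /oneJ J_lin scalerDr addrACA.
move/altformP => [l s1 s2]; apply/altformP; split=> [y z r x x'|x y z|x y z];
  rewrite /tern /pullback !tri_comp -!/(tern f _ _ _).
- by rewrite oD l.
- exact: s1.
- exact: s2.
Qed.

Lemma altform_proj p f : is_altform f -> is_altform (proj p f).
Proof. by apply: pb_subspace altform_pb; apply: altform_subspace. Qed.

Local Notation Hpq := (hcomp (cohomology X 3)).

Lemma Hpq_subspace p q : is_subspace (idR C) (Hpq p q).
Proof. exact: cspan_subspace. Qed.

Lemma oneJ_H10 a v : H10 a -> a (oneJ v) = (1 + 'i) * a v.
Proof. by case=> l h; rewrite /oneJ (@elinD _ _ eR _ a _ _ l) h mulrDl mul1r. Qed.
Lemma oneJ_H01 a v : H01 a -> a (oneJ v) = (1 - 'i) * a v.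
Proof. by case=> l h; rewrite /oneJ (@elinD _ _ eR _ a _ _ l) h mulrDl mul1r. Qed.

(** The pullback multiplies each J-linear factor of a wedge by 1 + i and each J-antilinear one by 1
    - i. *)
Lemma Hpq_sub p q f : (p + q = 3)%N -> Hpq p q f ->
  is_altform f /\ pb f = lam p *: f.
Proof.
move=> pq; suff h : Hpq p q `<=` (@is_altform R V 3 `&` [set f | pb f = lam p *: f]).
  by move/h.
apply: cspan_min.
  apply: subspaceI; first exact: altform_subspace.
  split; first by rewrite /= scaler0.
  by move=> a u v /= hu hv; rewrite pb_lin hu hv scalerDr !scalerA mulrC.
move=> _ [_ [a ha ->]]; split.
  apply/altformP; rewrite wedgeE; apply: alt3_wedge3.
  - by have := ha 0; case: ifP => _ [].
  - by have := ha 1; case: ifP => _ [].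
  - by have := ha 2; case: ifP => _ [].
have hE i v : a i (oneJ v) = (if (i < p)%N then 1 + 'i else 1 - 'i) * a i v.
  by have := ha i; case: ifP => _ h; [apply: oneJ_H10|apply: oneJ_H01].
rewrite /= wedgeE; apply/funext => v; rewrite /pullback /unt /wedge3 /= !hE scalrfctE
  /GRing.scale /=.
have -> : p = (3 - q)%N by lia.
move: q pq {ha hE} => [|[|[|[|q]]]] pq; last by lia.
- rewrite /lam /=; ring.
- rewrite /lam /=; ring.
- rewrite /lam /=; ring.
- rewrite /lam /=; ring.
Qed.

(** The definition of H^{p,q} wants the J-linear factors in front; at most one transposition, at the
    cost of a sign, brings any pattern to that order. *)
Lemma wedge_Hpq (s0 s1 s2 : bool) (a0 a1 a2 : V -> C) :
  (if s0 then H10 a0 else H01 a0) -> (if s1 then H10 a1 else H01 a1) ->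
  (if s2 then H10 a2 else H01 a2) ->
  Hpq (s0 + s1 + s2) (3 - (s0 + s1 + s2)) (unt (wedge3 a0 a1 a2)).
Proof.
have base p (a b d : V -> C) : (p <= 3)%N ->
    (if (0 < p)%N then H10 a else H01 a) -> (if (1 < p)%N then H10 b else H01 b) ->
    (if (2 < p)%N then H10 d else H01 d) -> Hpq p (3 - p) (unt (wedge3 a b d)).
  move=> p3 ha hb hd; apply: sub_cspan; split; first by lia.
  exists (tri a b d); last by rewrite wedge_tri.
  by move=> i; have [->|->|->] := ord3P i.
have sw p q f g : Hpq p q g -> f = (-1) *: g -> Hpq p q f.
  by move=> hg ->; apply: (subspaceZ _ (Hpq_subspace p q)).
case: s0; case: s1; case: s2 => h0 h1 h2; try exact: base.
- apply: (sw _ _ _ (unt (wedge3 a0 a2 a1))); first exact: base.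
  by apply/funext => v; rewrite scalrfctE /unt /wedge3 /GRing.scale /=; ring.
- apply: (sw _ _ _ (unt (wedge3 a2 a1 a0))); first exact: base.
  by apply/funext => v; rewrite scalrfctE /unt /wedge3 /GRing.scale /=; ring.
- apply: (sw _ _ _ (unt (wedge3 a1 a0 a2))); first exact: base.
  by apply/funext => v; rewrite scalrfctE /unt /wedge3 /GRing.scale /=; ring.
- apply: (sw _ _ _ (unt (wedge3 a2 a1 a0))); first exact: base.
  by apply/funext => v; rewrite scalrfctE /unt /wedge3 /GRing.scale /=; ring.
Qed.

Lemma H1_split (a : V -> C) : real_linear a ->
  exists a1 a2, [/\ H10 a1, H01 a2 & a = a1 \+ a2].
Proof.
move=> la; have lN v : a (- v) = - a v.
  by rewrite -scaleN1r (@elinZ _ _ eR _ a _ _ la) rmorphN rmorph1 mulN1r.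
exists (fun v => 2^-1 * (a v - 'i * a (tJ v))), (fun v => 2^-1 * (a v + 'i * a (tJ v))).
split; first split.
- by move=> r x y; rewrite J_lin !la; ring.
- move=> v; rewrite JJ lN; by field: i2.
- split; first by move=> r x y; rewrite J_lin !la; ring.
  move=> v; rewrite JJ lN; by field: i2.
- by apply/funext => v /=; field.
Qed.

(** Splitting every factor into its J-linear and J-antilinear parts gives eight pure wedges; the
    projector keeps those of type (p, 3 - p) and kills the others. *)
Lemma proj_wedge p a0 a1 a2 : (p <= 3)%N ->
  real_linear a0 -> real_linear a1 -> real_linear a2 ->
  Hpq p (3 - p) (proj p (unt (wedge3 a0 a1 a2))).
Proof.
move=> p3.
have pw (s0 s1 s2 : bool) (b0 b1 b2 : V -> C) :
  (if s0 then H10 b0 else H01 b0) -> (if s1 then H10 b1 else H01 b1) ->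
  (if s2 then H10 b2 else H01 b2) -> Hpq p (3 - p) (proj p (unt (wedge3 b0 b1 b2))).
  move=> h0 h1 h2; have hw := wedge_Hpq h0 h1 h2.
  have s3 : (s0 + s1 + s2 <= 3)%N by case: s0 s1 s2 {h0 h1 h2 hw} => [] [] [].
  have [|_ hp] := Hpq_sub _ hw; first by lia.
  rewrite (proj_eig s3 p3 hp); case: eqP => [<-|_].
    by rewrite scale1r.
  by rewrite scale0r; case: (Hpq_subspace p (3 - p)).
move=> /H1_split [b0 [d0 [h0 k0 ->]]] /H1_split [b1 [d1 [h1 k1 ->]]].
move=> /H1_split [b2 [d2 [h2 k2 ->]]].
have -> : unt (wedge3 (b0 \+ d0) (b1 \+ d1) (b2 \+ d2)) =
  1 *: unt (wedge3 b0 b1 b2) + (1 *: unt (wedge3 b0 b1 d2) +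
  (1 *: unt (wedge3 b0 d1 b2) + (1 *: unt (wedge3 b0 d1 d2) +
  (1 *: unt (wedge3 d0 b1 b2) + (1 *: unt (wedge3 d0 b1 d2) +
  (1 *: unt (wedge3 d0 d1 b2) + unt (wedge3 d0 d1 d2))))))).
  by apply/funext => v; rewrite ?(addrfctE, scalrfctE) /unt /wedge3 /GRing.scale /=; ring.
rewrite !proj_lin.
do !(apply: (Hpq_subspace p (3 - p)).2).
- exact: (pw true true true).
- exact: (pw true true false).
- exact: (pw true false true).
- exact: (pw true false false).
- exact: (pw false true true).
- exact: (pw false true false).
- exact: (pw false false true).
- exact: (pw false false false).
Qed.

Variables (n : nat) (b : 'I_n -> V) (c : 'I_n -> V -> R).
Hypothesis bc : forall x, x = \sum_i c i x *: b i.
Hypothesis c_lin : forall i, elin eR (eR \o c i).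
Hypothesis cb : forall i j, c i (b j) = (i == j)%:R.

Definition bwedge (t : triple n) : Form := unt (cowedge eR c t).

Lemma altform_basis f : is_altform f ->
  f = \sum_(t : triple n) f (tri (b (tr0 t)) (b (tr1 t)) (b (tr2 t))) *: bwedge t.
Proof.
move/altformP => af; apply/funext => v; rewrite fct_sumE -{1}(triE v).
rewrite -/(tern f _ _ _) (alt3_basis bc c_lin cb af).
by apply: eq_bigr => t _; rewrite scalrfctE.
Qed.

(** An eigenvector equals its own projection, and an alternating form is a combination of wedges of
    coordinates, whose projections are of the right type. From here on a Hodge type is one
    eigenvalue equation. *)
Lemma HpqP p q f : (p + q = 3)%N ->
  Hpq p q f <-> is_altform f /\ pb f = lam p *: f.
Proof.
move=> pq; split; first exact: Hpq_sub.
have qE : q = (3 - p)%N by lia.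
have p3 : (p <= 3)%N by lia.
move=> [af h]; have -> : f = proj p f by rewrite (proj_eig p3 p3 h) eqxx scale1r.
rewrite (altform_basis af).
elim/big_rec: _ => [|t g _ IH].
  have -> : proj p 0 = 0.
    have := proj_lin p 0 0 (0 : Form); rewrite !scale0r add0r => ->; rewrite add0r.
    by apply/funext => v; rewrite /proj /pullback /= !scaler0 !addr0 scaler0.
  by case: (Hpq_subspace p q).
rewrite proj_lin; apply: (Hpq_subspace p q).2 => //.
rewrite qE; apply: proj_wedge => //; exact: c_lin.
Qed.

End WeilOperator.

(** * Rational structures and Hodge substructures *)

Section RationalForms.
Variable R : realType.
Local Notation C := R[i].

Lemma has_dim_fin (F K : pzRingType) (e : {rmorphism F -> K}) (M : lmodType K)
    (U : set M) (I : finType) (b : I -> M) :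
  is_subspace e U -> (forall i, U (b i)) ->
  (forall u, U u -> exists c : I -> F, u = \sum_i e (c i) *: b i) ->
  (forall c : I -> F, \sum_i e (c i) *: b i = 0 -> forall i, c i = 0) ->
  has_dim e U #|I|.
Proof.
move=> hU Ub sp ind; exists (b \o enum_val); split => //.
- by move=> i; apply: Ub.
- move=> u /sp [c ->]; exists (c \o enum_val).
  by rewrite (reindex (@enum_val I predT)) //=; apply/onW_bij/enum_val_bij.
- move=> c h i; rewrite -(enum_valK i).
  apply: (ind (c \o enum_rank)); rewrite -[RHS]h.
  rewrite (reindex (@enum_val I predT)) //=; last exact/onW_bij/enum_val_bij.
  by apply: eq_bigr => j _; rewrite /= enum_valK.
Qed.

(** A maximal independent system of rational coordinate rows of elements of [U] is a Q-basis. It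
    stays independent over C because the rank of a rational matrix does not change under field
    extension. *)
Lemma rational_basis (M : lmodType C) (N : nat) (g : 'I_N -> M) (U : set M) :
  (forall c : 'I_N -> C, \sum_i c i *: g i = 0 -> forall i, c i = 0) ->
  is_subspace (QtoC R) U ->
  (forall u, U u -> exists r : 'I_N -> rat, u = \sum_i ratr (r i) *: g i) ->
  exists d (b : 'I_d -> M),
    is_basis (QtoC R) U b /\ is_basis (idR C) (cspan U) b.
Proof.
move=> gfree hU gspan.
pose comb (r : 'rV[rat]_N) : M := \sum_j ratr (r 0 j) *: g j.
(* [U] is an arbitrary set, so the maximal rank is found through the boolean reflection of an
   existence statement, bounded by [N]. *)
pose P k := `[< exists A : 'M[rat]_(k, N), row_free A /\ forall i, U (comb (row i A)) >].
have P0 : P 0%N.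
  by apply/asboolP; exists 0; split; [rewrite /row_free mxrank0|case].
have PN k : P k -> (k <= N)%N.
  by move/asboolP => [A [fA _]]; have := rank_leq_col A; rewrite (eqP fA).
case: (ex_maxnP (ex_intro (fun k => is_true (P k)) _ P0) PN) => k /asboolP [A [Afree AU]] kmax.
have combM (D : 'rV[rat]_k) : comb (D *m A) = \sum_i ratr (D 0 i) *: comb (row i A).
  rewrite /comb; under [RHS]eq_bigr => i _ do rewrite scaler_sumr.
  rewrite exchange_big /=; apply: eq_bigr => j _.
  rewrite mxE rmorph_sum scaler_suml; apply: eq_bigr => i _.
  by rewrite !mxE scalerA rmorphM.
have Uspan u : U u -> exists D : 'rV[rat]_k, u = \sum_i ratr (D 0 i) *: comb (row i A).
  move=> Uu; have [r ur] := gspan _ Uu.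
  pose rr : 'rV[rat]_N := \row_j r j.
  have urr : u = comb rr by rewrite ur; apply: eq_bigr => j _; rewrite mxE.
  have [/submxP[D rD]|nrA] := boolP (rr <= A)%MS; first by exists D; rewrite urr rD combM.
  suff /kmax : P (k + 1)%N by rewrite addn1 ltnn.
  apply/asboolP; exists (col_mx A rr); split.
    rewrite /row_free eqn_leq rank_leq_row.
    have -> : \rank (col_mx A rr) = \rank (A + rr)%MS by rewrite addsmxE.
    have kA := eqP Afree; rewrite -{1}kA addn1; apply: rank_ltmx.
    rewrite ltmxE addsmxSl /=; apply: contra nrA => h.
    exact: submx_trans (addsmxSr _ _) h.
  move=> i; case: (split_ordP i) => j ->; rewrite ?rowKu ?rowKd //.
  by rewrite (ord1 j) row_id -urr.
have bfree (c : 'I_k -> C) : \sum_i c i *: comb (row i A) = 0 -> forall i, c i = 0.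
  move=> h.
  have : (\row_i c i) *m map_mx (ratr : rat -> C) A = 0.
    set B := _ *m _; apply/rowP => j; rewrite [RHS]mxE.
    apply: (gfree (fun j => B 0 j)); rewrite -[RHS]h /comb; under [RHS]eq_bigr => i _ do
      rewrite scaler_sumr.
    rewrite exchange_big /=; apply: eq_bigr => l _.
    by rewrite mxE scaler_suml; apply: eq_bigr => i _; rewrite !mxE scalerA.
  have fA : row_free (map_mx (ratr : rat -> C) A) by rewrite row_free_map.
  rewrite -(mul0mx _ (map_mx (ratr : rat -> C) A)) => /(row_free_inj fA) /rowP h0 i.
  by have := h0 i; rewrite !mxE.
exists k, (fun i => comb (row i A)); split; split => //.
- by move=> u /Uspan [D ->]; exists (fun i => D 0 i).
- move=> c /bfree h i; apply/eqP; rewrite -(fmorph_eq0 (ratr : rat -> C)); exact/eqP/h.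
- exact: cspan_subspace.
- by move=> i; apply/sub_cspan/AU.
- move=> u; pose S := [set u | exists c : 'I_k -> C, u = \sum_i c i *: comb (row i A)].
  suff : cspan U `<=` S by move=> h /h.
  apply: cspan_min.
    split; first by exists (fun=> 0); rewrite big1 // => i _; rewrite scale0r.
    move=> a _ _ [c1 ->] [c2 ->]; exists (fun i => a * c1 i + c2 i).
    rewrite scaler_sumr -big_split; apply: eq_bigr => i _ /=.
    by rewrite scalerA scalerDl.
  by move=> _ /Uspan [D ->]; exists (fun i => ratr (D 0 i)).
Qed.

(** Every clause restricts; for positivity, a conjugate computed from [U] is also a conjugate
    computed from [ratsp X]. *)
Lemma polarization_sub (M : lmodType C) (X : hodge_data M) (Q : M -> M -> C)
    (U : set M) :
  is_hodge_polarization X Q -> is_hodge (sub_hodge X U) -> U `<=` ratsp X ->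
  is_hodge_polarization (sub_hodge X U) Q.
Proof.
move=> [hX [Ql Qr] [Qrat Qsym] Qorth Qpos] hU sU.
have cU : cspan U `<=` cspan (ratsp X).
  by move=> _ [n [c [u [Uu ->]]]]; exists n, c, u; split => // i; apply: sU.
split => //=.
- by split=> *; [apply: Ql|apply: Qr]; apply: cU.
- by split=> *; [apply: Qrat; apply: sU|apply: Qsym; apply: cU].
- by move=> p q p' q' u v pq pq' [_ hu] [_ hv]; apply: (Qorth p q p' q').
- move=> p q u w pq [_ hu] u0 [n [c [x [Ux ux wx]]]]; apply: (Qpos p q) => //.
  by exists n, c, x; split => // i; apply: sU.
Qed.

End RationalForms.

(** * The criterion for Hodge substructures of H^3 *)

Section HodgeSubstructures.
Variables (R : realType) (X : torus R).
Local Notation C := R[i].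
Local Notation V := (tV X).
Local Notation eR := (real_complex R).
Local Notation Form := (('I_3 -> V) -> C).
Hypothesis J_lin : linear (@tJ _ X).
Hypothesis JJ : forall v, @tJ _ X (tJ v) = - v.
Variables (n : nat) (b : 'I_n -> V) (c : 'I_n -> V -> R).
Hypothesis bc : forall x, x = \sum_i c i x *: b i.
Hypothesis c_lin : forall i, elin eR (eR \o c i).
Hypothesis cb : forall i j, c i (b j) = (i == j)%:R.
Hypothesis L_b : forall i, tL (b i).
Hypothesis L_int : forall v, tL v -> forall i, exists m : int, c i v = m%:~R.
Local Notation pb := (@pullback R V 3 (@oneJ R X)).
Local Notation H := (cohomology X 3).
Implicit Types f g : Form.

Definition is_rat (z : C) := exists r : rat, z = ratr r.

Lemma is_ratD x y : is_rat x -> is_rat y -> is_rat (x + y).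
Proof. by move=> [r ->] [s ->]; exists (r + s); rewrite rmorphD. Qed.
Lemma is_ratM x y : is_rat x -> is_rat y -> is_rat (x * y).
Proof. by move=> [r ->] [s ->]; exists (r * s); rewrite rmorphM. Qed.
Lemma is_ratN x : is_rat x -> is_rat (- x).
Proof. by move=> [r ->]; exists (- r); rewrite rmorphN. Qed.
Lemma is_rat_int (m : int) : is_rat m%:~R.
Proof. by exists m%:~R; rewrite ratr_int. Qed.
Lemma is_rat_sum (I : Type) (s : seq I) (P : pred I) (F : I -> C) :
  (forall i, P i -> is_rat (F i)) -> is_rat (\sum_(i <- s | P i) F i).
Proof. by move=> h; elim/big_rec: _ => [|i x Pi hx]; [exact: (is_rat_int 0)|apply: is_ratD =>
  //; apply: h]. Qed.

Lemma bwedge_rat t v : (forall i, tL (v i)) -> is_rat (bwedge c t v).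
Proof.
move=> Lv.
have ci i j : is_rat (eR (c i (v j))).
  have [m ->] := L_int (Lv j) i; exists m%:~R; rewrite ratr_int.
  exact: (rmorph_int (real_complex R)).
rewrite /bwedge /unt /cowedge /wedge3 /=.
by do ?[apply: is_ratD | apply: is_ratN | apply: is_ratM]; apply: ci.
Qed.

Lemma bwedge_basis s t :
  bwedge c t (tri (b (tr0 s)) (b (tr1 s)) (b (tr2 s))) = (t == s)%:R.
Proof. exact: (cowedge_basis eR cb s t). Qed.

Lemma altform_bwedge t : is_altform (bwedge c t).
Proof. by apply/altformP; apply: alt3_cowedge. Qed.

Lemma ratsp_bwedge t : ratsp H (bwedge c t).
Proof. split; [exact: altform_bwedge|exact: bwedge_rat]. Qed.

Lemma ratspP f : ratsp H f <->
  is_altform f /\ forall t : triple n, is_rat (f (tri (b (tr0 t)) (b (tr1 t)) (b (tr2 t)))).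
Proof.
split=> [[af fr]|[af fr]]; split => //.
  by move=> t; apply: fr => i; have [->|->|->] := ord3P i; apply: L_b.
move=> v Lv; rewrite (altform_basis bc c_lin cb af) fct_sumE; apply: is_rat_sum => t _.
by apply: is_ratM; [apply: fr|apply: bwedge_rat].
Qed.

Lemma ratsp_subspace : is_subspace (QtoC R) (ratsp H).
Proof.
split; first by split; [case: (altform_subspace V)|move=> v _; exact: (is_rat_int 0)].
move=> a f g [af fr] [ag gr]; split; first by apply: (altform_subspace V).2.
move=> v Lv; apply: is_ratD; last exact: gr.
by apply: is_ratM; [exists a|exact: fr].
Qed.

(** A rational class takes real values on all of V, not only on the lattice. Hence conjugation of
    classes is conjugation of values, which serves both Hodge symmetry and the positivity of
    [Qform]. *)
Lemma ratsp_conj f v : ratsp H f -> (f v)^* = f v.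
Proof.
move/ratspP => [af fr]; rewrite (altform_basis bc c_lin cb af) fct_sumE rmorph_sum.
apply: eq_bigr => t _; rewrite scalrfctE /GRing.scale /= rmorphM; congr (_ * _).
  have [r ->] := fr t; exact: fmorph_rat.
rewrite /bwedge /unt /cowedge /wedge3 /=.
have E (x : R) : (x%:C%C : C)^* = x%:C%C by apply: conjc_real.
by rewrite !(rmorphD, rmorphN, rmorphM) /= ?E.
Qed.

Lemma bwedge_free (k : triple n -> C) :
  \sum_t k t *: bwedge c t = 0 -> forall t, k t = 0.
Proof.
move=> h s; have := congr1 (fun f : Form => f (tri (b (tr0 s)) (b (tr1 s)) (b (tr2 s)))) h.
rewrite fct_sumE (bigD1 s) //= scalrfctE bwedge_basis eqxx big1 => [|t /negPf ts].
  by rewrite addr0 /GRing.scale /= mulr1.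
by rewrite scalrfctE bwedge_basis ts scaler0.
Qed.

Lemma cspan_ratsp : cspan (ratsp H) = @is_altform R V 3.
Proof.
apply/seteqP; split=> f.
  by apply: cspan_min f; [exact: altform_subspace|move=> f []].
move=> af; rewrite /= (altform_basis bc c_lin cb af).
by apply: csubspace_sum => [|t _]; [exact: cspan_subspace|exact/sub_cspan/ratsp_bwedge].
Qed.

Lemma ratsp_basis (U : set Form) : is_subspace (QtoC R) U -> U `<=` ratsp H ->
  exists d (g : 'I_d -> Form), is_basis (QtoC R) U g /\ is_basis (idR C) (cspan U) g.
Proof.
move=> hU sU.
pose gg (i : 'I_#|{: triple n}|) := bwedge c (enum_val i).
apply: (@rational_basis R _ _ gg) => // [k h i|u /sU /ratspP [au ur]].
  rewrite -(enum_valK i); apply: (bwedge_free (k := k \o enum_rank)).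
  rewrite -[RHS]h (reindex (@enum_val {: triple n} predT)) /=; last exact/onW_bij/enum_val_bij.
  by apply: eq_bigr => j _; rewrite /= enum_valK.
have [r hr] := choice ur; exists (r \o enum_val).
rewrite (altform_basis bc c_lin cb au) (reindex (@enum_val {: triple n} predT)) /=.
  by apply: eq_bigr => j _; rewrite hr.
exact/onW_bij/enum_val_bij.
Qed.

(** The projectors split a stable span into its eigenspaces, and the conjugate of an eigenform for
    [lam p] is one for [lam (3 - p)], which gives Hodge symmetry. *)
Lemma sub_hodgeP (U : set Form) : is_subspace (QtoC R) U -> U `<=` ratsp H ->
  (forall f, cspan U f -> cspan U (pb f)) -> is_hodge (sub_hodge H U).
Proof.
move=> hU sU pU.
have cU f : cspan U f -> is_altform f.
  apply: cspan_min; [exact: altform_subspace|by move=> g /sU []].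
have hpq := HpqP J_lin JJ bc c_lin cb.
split.
- exact: ratsp_basis.
- by move=> p q _; apply: subspaceI; [exact: cspan_subspace|exact: Hpq_subspace].
- split => /=.
  + move=> u hu; elim/big_rec: _ => [|i x _ Ux]; first by case: (cspan_subspace U).
    by apply: (subspaceD (cspan_subspace U)) => //; case: (hu i).
  + move=> f Uf; exists (fun p : 'I_4 => proj p f); last by rewrite proj_sum.
    move=> p; have p3 : (p <= 3)%N by have := ltn_ord p; lia.
    split; first by apply: pb_subspace => //; apply: cspan_subspace.
    apply/hpq; first by lia.
    split; first by apply: altform_proj => //; apply: cU.
    by apply: pb_proj => //; apply: cU.
  + move=> u hu u0 q.
    have q3 : (q <= 3)%N by have := ltn_ord q; lia.
    have projD g1 g2 : proj q (g1 + g2) = proj q g1 + proj q g2.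
      by have := proj_lin q 1 g1 g2; rewrite !scale1r.
    have proj0 : proj q (0 : Form) = 0.
      by apply: (addrI (proj q (0 : Form))); rewrite -projD !addr0.
    have : proj q (\sum_p u p) = u q.
      rewrite (big_morph _ projD proj0) (bigD1 q) //= big1 => [|p pq].
        have [_ /hpq [|_ h]] := hu q; first by lia.
        by rewrite (proj_eig q3 q3 h) eqxx scale1r addr0.
      have p3 : (p <= 3)%N by have := ltn_ord p; lia.
      have [_ /hpq [|_ h]] := hu p; first by lia.
      rewrite (proj_eig p3 q3 h); move: pq; rewrite -val_eqE /= => /negPf ->.
      by rewrite scale0r.
    by rewrite u0 proj0.
- move=> p q v w pq [_ /(hpq _ _ _ pq) [av hv]] [k [d [u [Uu vE wE]]]].
  have cw : cspan U w by rewrite wE; exists k, (fun i => (d i)^*), u.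
  split => //=; apply/hpq; first by rewrite addnC.
  split; first exact: cU.
  have wv x : w x = (v x)^*.
    rewrite wE vE !fct_sumE rmorph_sum; apply: eq_bigr => i _.
    by rewrite !scalrfctE -{1}(ratsp_conj x (sU _ (Uu i))) -[RHS]/((d i * u i x)^*) rmorphM.
  apply/funext => x; transitivity ((pb v x)^*); first exact: wv.
  rewrite hv; transitivity ((lam R p * v x)^*); first by [].
  have p3 : (p <= 3)%N by rewrite /= in pq; lia.
  have -> : q = (3 - p)%N by rewrite /= in pq; lia.
  by rewrite rmorphM /= lam_conj // -wv.
Qed.

(** Viewing H^3 as a substructure of itself lets [sub_hodgeP] also prove that H^3 is a Hodge
    structure. *)
Lemma sub_hodge_id : sub_hodge H (ratsp H) = H.
Proof.
rewrite /sub_hodge; case E : H => [k r h]; congr HodgeData.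
have -> : r = ratsp H by rewrite E.
apply/funext => p; apply/funext => q; apply/seteqP; split => f; first by case.
move=> hf; split => //; rewrite cspan_ratsp.
have {hf} : hcomp H p q f by rewrite E.
apply: cspan_min; first exact: altform_subspace.
move=> g hg; have [pq _] := hg.
by have [] := Hpq_sub pq (sub_cspan hg).
Qed.

Lemma cohomology_hodge : is_hodge H.
Proof.
rewrite -sub_hodge_id; apply: sub_hodgeP => //; first exact: ratsp_subspace.
by move=> f; rewrite cspan_ratsp; apply: altform_pb.
Qed.

End HodgeSubstructures.

(** * Polarization of H^3 induced from H^1 *)

Section Orthonormal.
Variables (R : realType) (V : lmodType R) (n : nat) (b : 'I_n -> V) (c : 'I_n -> V -> R).
Hypothesis bc : forall x, x = \sum_i c i x *: b i.
Hypothesis c0 : forall (r : 'I_n -> R), \sum_i r i *: b i = 0 -> forall i, r i = 0.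
Variable g : V -> V -> R.
Hypothesis gl : forall a u v t, g (a *: u + v) t = a * g u t + g v t.
Hypothesis gC : forall u v, g u v = g v u.
Hypothesis g_gt0 : forall v, v != 0 -> 0 < g v v.

Lemma bil0 t : g 0 t = 0.
Proof. by apply: (addrI (1 * g 0 t)); rewrite -gl scaler0 !addr0 mul1r. Qed.

Lemma bilZ a u t : g (a *: u) t = a * g u t.
Proof. by rewrite -[a *: u]addr0 gl bil0 addr0. Qed.

Lemma bil_sum (I : Type) (s : seq I) (P : pred I) (r : I -> R) (u : I -> V) t :
  g (\sum_(i <- s | P i) r i *: u i) t = \sum_(i <- s | P i) r i * g (u i) t.
Proof. by elim/big_rec2: _ => [|i y x _ <-]; rewrite ?bil0 ?gl. Qed.

(** A dimension count provides the next vector: the matrix of products of the [n] basis vectors with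
    the [k] vectors found so far has a nonzero left kernel. The vector is then normalized by a real
    square root. *)
Lemma orthonormal_family k : (k <= n)%N ->
  exists d : 'I_k -> V, forall i j, g (d i) (d j) = (i == j)%:R.
Proof.
elim: k => [|k IH] kn; first by exists (fun=> 0); case.
have [d hd] := IH (ltnW kn).
pose A : 'M[R]_(n, k) := \matrix_(i, j) g (b i) (d j).
have : kermx A != 0.
  by rewrite -mxrank_eq0 mxrank_ker subn_eq0 -ltnNge (leq_ltn_trans (rank_leq_col A)).
case/rowV0Pn => r /sub_kermxP rA r0.
pose x := \sum_i r 0 i *: b i.
have x0 : x != 0.
  by apply: contraNneq r0 => /c0 h; apply/eqP/rowP => i; rewrite mxE h.
have xd j : g x (d j) = 0.
  have /rowP/(_ j) := rA; rewrite !mxE => h; rewrite bil_sum -[RHS]h.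
  by apply: eq_bigr => i _; rewrite mxE.
pose s := Num.sqrt (g x x).
have s0 : s != 0 by rewrite sqrtr_eq0 -ltNge g_gt0.
have ss : s * s = g x x by rewrite -expr2 sqr_sqrtr // ltW // g_gt0.
exists (fun i => if unlift ord_max i is Some j then d j else s^-1 *: x) => i j.
case: (unliftP ord_max i) => [i' ->|->]; case: (unliftP ord_max j) => [j' ->|->].
- by rewrite hd (inj_eq (@lift_inj _ _)).
- by rewrite gC bilZ xd mulr0 eq_sym (negPf (neq_lift _ _)).
- by rewrite bilZ xd mulr0 (negPf (neq_lift _ _)).
- by rewrite bilZ gC bilZ -ss eqxx /=; field.
Qed.

(** Orthonormal vectors are independent, so their square matrix of coordinates is invertible and
    they span; pairing with [d j] recovers the coefficients. *)
Lemma orthonormal_basis :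
  exists d : 'I_n -> V, forall x, x = \sum_j g x (d j) *: d j.
Proof.
have [d hd] := orthonormal_family (leqnn n).
have gd (r : 'I_n -> R) j : g (\sum_i r i *: d i) (d j) = r j.
  rewrite bil_sum (bigD1 j) //= hd eqxx mulr1 big1 ?addr0 // => i /negPf ij.
  by rewrite hd ij mulr0.
pose D : 'M[R]_n := \matrix_(i, j) c j (d i).
have comb (r : 'rV[R]_n) : \sum_j (r *m D) 0 j *: b j = \sum_i r 0 i *: d i.
  under [RHS]eq_bigr => i _ do rewrite [d i]bc scaler_sumr.
  rewrite exchange_big /=; apply: eq_bigr => j _; rewrite mxE scaler_suml.
  by apply: eq_bigr => i _; rewrite scalerA mxE.
have Dfree : row_free D.
  apply: inj_row_free => r rD; apply/rowP => j; rewrite mxE -(gd (fun i => r 0 i)).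
  by rewrite -comb rD big1 ?bil0 // => i _; rewrite mxE scale0r.
have Du : D \in unitmx by rewrite -row_free_unit.
exists d => x; pose r : 'rV[R]_n := (\row_j c j x) *m invmx D.
have xr : x = \sum_i r 0 i *: d i.
  rewrite -comb mulmxKV // [LHS]bc; apply: eq_bigr => j _; by rewrite mxE.
transitivity (\sum_i r 0 i *: d i) => //; apply: eq_bigr => j _.
by rewrite -(gd (fun i => r 0 i) j) -xr.
Qed.

End Orthonormal.

(** * The pairing on 3-forms and the Hodge-Riemann relations *)

Section TensorPolarization.
Variables (R : realType) (X : torus R).
Local Notation C := R[i].
Local Notation V := (tV X).
Local Notation eR := (real_complex R).
Local Notation Form := (('I_3 -> V) -> C).
Hypothesis J_lin : linear (@tJ _ X).
Hypothesis JJ : forall v, @tJ _ X (tJ v) = - v.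
Variables (n : nat) (b : 'I_n -> V) (c : 'I_n -> V -> R).
Hypothesis bc : forall x, x = \sum_i c i x *: b i.
Hypothesis c_lin : forall i, elin eR (eR \o c i).
Hypothesis cb : forall i j, c i (b j) = (i == j)%:R.
Hypothesis L_b : forall i, tL (b i).
Hypothesis L_int : forall v, tL v -> forall i, exists m : int, c i v = m%:~R.
Variable E : V -> V -> R.
Hypothesis polE : is_polarization E.
Variable bs : 'I_n -> V.
Hypothesis L_bs : forall i, tL (bs i).
Hypothesis Eb : forall i j, E (b i) (bs j) = (i == j)%:R.
Local Notation pb := (@pullback R V 3 (@oneJ R X)).
Local Notation H := (cohomology X 3).
Implicit Types f g : Form.

(* Equivalently, the tensor sum_i d_i (x) ds_i is the inverse of E; this is why
   [tpair] below does not depend on the dual pair of bases. *)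
Definition dualp m (d ds : 'I_m -> V) : Prop :=
  (forall x, x = \sum_j E x (ds j) *: d j) /\ (forall x, x = \sum_j E (d j) x *: ds j).

Let El a u v t : E (a *: u + v) t = a * E u t + E v t.
Proof. by case: polE => -[]. Qed.
Let Er a u v t : E t (a *: u + v) = a * E t u + E t v.
Proof. by case: polE => -[]. Qed.
Let E0 v : E v v = 0. Proof. by case: polE. Qed.
Let EJ u v : E (tJ u) (tJ v) = E u v. Proof. by case: polE. Qed.
Let EJ_gt0 v : v != 0 -> 0 < E v (tJ v). Proof. by case: polE => _ _ _ _; apply. Qed.
Let EC u v : E v u = - E u v.
Proof.
have D a d e : E (a + d) e = E a e + E d e by have := El 1 a d e; rewrite scale1r mul1r.
have D' a d e : E e (a + d) = E e a + E e d by have := Er 1 a d e; rewrite scale1r mul1r.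
by have := E0 (v + u); rewrite D !D' !E0 add0r addr0 => /eqP; rewrite addr_eq0 => /eqP.
Qed.
Let ErZ a u t : E t (a *: u) = a * E t u.
Proof. by rewrite EC (bilZ (g := E)) // -mulrN -EC. Qed.
Let ErN u t : E t (- u) = - E t u.
Proof. by rewrite -scaleN1r ErZ mulN1r. Qed.
Let E_tJ u v : E (tJ u) v = - E u (tJ v).
Proof. by rewrite -EJ JJ EC ErN opprK EC. Qed.
Let EM u v : E (oneJ u) (oneJ v) = 2 * E u v.
Proof.
have D a d e : E (a + d) e = E a e + E d e by have := El 1 a d e; rewrite scale1r mul1r.
have D' a d e : E e (a + d) = E e a + E e d by have := Er 1 a d e; rewrite scale1r mul1r.
rewrite /oneJ D !D' EJ E_tJ; ring.
Qed.

Let tJ_sum m (r : 'I_m -> R) (d : 'I_m -> V) :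
  tJ (\sum_i r i *: d i) = \sum_i r i *: tJ (d i) :> V.
Proof. by elim/big_rec2: _ => [|i y x _ <-]; rewrite ?(tJ0 J_lin) ?J_lin. Qed.

(** The second expansion comes from nondegeneracy: the difference [y] of the two sides pairs to zero
    with every vector, and E(y, J y) > 0 unless y = 0. *)
Lemma dualp_b : dualp b bs.
Proof.
split=> x.
  rewrite {1}(bc x); apply: eq_bigr => j _; congr (_ *: _).
  rewrite {2}(bc x) (bil_sum (g := E)) // (bigD1 j) //= Eb eqxx mulr1 big1 ?addr0 //.
  by move=> i /negPf ij; rewrite Eb ij mulr0.
apply/eqP; rewrite -subr_eq0; set y := x - _; apply/negP => /negP /EJ_gt0.
suff h v : E v y = 0 by rewrite EC h oppr0 ltxx.
rewrite (bc v) (bil_sum (g := E)) // big1 // => i _.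
suff -> : E (b i) y = 0 by rewrite mulr0.
have EN u w' : E u (- w') = - E u w' by apply: ErN.
have ED u w1 w2 : E u (w1 + w2) = E u w1 + E u w2.
  by have := Er 1 w1 w2 u; rewrite scale1r mul1r.
have Esum u (r : 'I_n -> R) (w : 'I_n -> V) :
    E u (\sum_j r j *: w j) = \sum_j r j * E u (w j).
  rewrite EC (bil_sum (g := E)) // -sumrN; apply: eq_bigr => j _.
  by rewrite -mulrN -EC.
rewrite /y ED EN Esum (bigD1 i) //= Eb eqxx mulr1 big1 => [|j /negPf ji].
  by rewrite addr0 subrr.
by rewrite Eb eq_sym ji mulr0.
Qed.

(** The factor 1/2 compensates E((1 + J) u, (1 + J) v) = 2 E(u, v). The new vectors still span
    because (1 + J)(1 - J) = 2. *)
Lemma dualp_oneJ m (d ds : 'I_m -> V) : dualp d ds ->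
  dualp (fun i => oneJ (d i)) (fun i => 2^-1 *: oneJ (ds i)).
Proof.
move=> [h1 h2].
have oJ (r : 'I_m -> R) (w : 'I_m -> V) : oneJ (\sum_i r i *: w i) = \sum_i r i *: oneJ (w i).
  rewrite /oneJ tJ_sum -big_split; apply: eq_bigr => i _ /=; by rewrite scalerDr.
have n2 : 2 != 0 :> R by rewrite pnatr_eq0.
have surj (x : V) : exists y, x = oneJ y.
  have tJZ a u : tJ (a *: u) = a *: tJ u :> V.
    by have := J_lin a u 0; rewrite !addr0 (tJ0 J_lin) addr0.
  pose h : R := 2^-1.
  exists (h *: (x - tJ x)); rewrite /oneJ tJZ (tJD J_lin) (tJN JJ) JJ opprK -scalerDr.
  rewrite [tJ x + x]addrC addrACA addNr addr0 -mulr2n -scaler_nat scalerA.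
  by rewrite /h mulVf // scale1r.
split=> x; have [y ->] := surj x.
  rewrite {1}(h1 y) oJ; apply: eq_bigr => i _; congr (_ *: _).
  by rewrite ErZ EM mulrA mulVf // mul1r.
rewrite {1}(h2 y) oJ; apply: eq_bigr => i _; rewrite scalerA; congr (_ *: _).
by rewrite EM mulrAC mulfV // mul1r.
Qed.

Lemma dualp_opp m (d ds : 'I_m -> V) : dualp d ds -> dualp ds (fun i => - d i).
Proof.
move=> [h1 h2]; split=> x.
  by rewrite {1}(h2 x); apply: eq_bigr => i _; rewrite ErN -EC.
by rewrite {1}(h1 x); apply: eq_bigr => i _; rewrite scalerN -scaleNr -EC.
Qed.

(** For a basis orthonormal with respect to E(u, J v), the dual basis is its image under [J]. *)
Lemma dualp_orthonormal : exists d : 'I_n -> V, dualp d (fun i => tJ (d i)).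
Proof.
have gC u v : E u (tJ v) = E v (tJ u).
  by rewrite -[LHS]opprK -E_tJ -EC.
have [||||d hd] := @orthonormal_basis R V n b c bc _ (fun u v => E u (tJ v)).
- move=> r h i; have := congr1 (eR \o c i) h.
  rewrite (elin_sum _ _ _ (c_lin i)) (elin0 (c_lin i)) (bigD1 i) // big1 => [|j /negPf ji].
    rewrite [LHS]addr0 (@elinZ _ _ eR _ _ _ _ (c_lin i)) /= cb eqxx rmorph1 mulr1.
    by move/eqP; rewrite (fmorph_eq0 eR) => /eqP.
  by rewrite (@elinZ _ _ eR _ _ _ _ (c_lin i)) /= cb eq_sym ji rmorph0 mulr0.
- by move=> a u v t; rewrite El.
- exact: gC.
- exact: EJ_gt0.
exists d; split=> x; first exact: hd.
transitivity (- tJ (tJ x)); first by rewrite JJ opprK.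
rewrite {1}(hd (tJ x)) tJ_sum -sumrN; apply: eq_bigr => j _.
by rewrite EJ -scaleNr -EC.
Qed.

Lemma dualp_indep m m' (d ds : 'I_m -> V) (d' ds' : 'I_m' -> V) (B : V -> V -> C) :
  dualp d ds -> dualp d' ds' ->
  (forall t, elin eR (fun u => B u t)) -> (forall t, elin eR (B t)) ->
  \sum_i B (d i) (ds i) = \sum_i B (d' i) (ds' i).
Proof.
move=> [h1 h2] [h1' h2'] Bl Br.
transitivity (\sum_i \sum_j eR (E (d i) (ds' j)) * B (d' j) (ds i)).
  apply: eq_bigr => i _; rewrite {1}(h1' (d i)) (elin_sum _ _ _ (Bl _)).
  by apply: eq_bigr => j _; rewrite (elinZ _ _ (Bl _)).
rewrite exchange_big /=; apply: eq_bigr => j _.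
rewrite [in RHS](h2 (ds' j)) (elin_sum _ _ _ (Br _)).
by apply: eq_bigr => i _; rewrite (elinZ _ _ (Br _)).
Qed.

(** The pairing that the inverse of E induces on the third tensor power of H^1. *)
Definition tpair m (d ds : 'I_m -> V) f g : C :=
  \sum_i \sum_j \sum_k f (tri (d i) (d j) (d k)) * g (tri (ds i) (ds j) (ds k)).

Lemma tpair_indep m m' (d ds : 'I_m -> V) (d' ds' : 'I_m' -> V) f g :
  is_altform f -> is_altform g -> dualp d ds -> dualp d' ds' ->
  tpair d ds f g = tpair d' ds' f g.
Proof.
move=> /altformP af /altformP ag hd hd'; have [l _ _] := af; have [lg _ _] := ag.
rewrite /tpair.
transitivity (\sum_i' \sum_j \sum_k f (tri (d' i') (d j) (d k)) * g (tri (ds' i') (ds j) (ds k))).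
  apply: (dualp_indep (B := fun u v => \sum_j \sum_k f (tri u (d j) (d k)) * g (tri v (ds j)
    (ds k)))) => // t r x y.
    rewrite mulr_sumr -big_split; apply: eq_bigr => j _.
    rewrite mulr_sumr -big_split; apply: eq_bigr => k _ /=.
    by have := l (d j) (d k) r x y; rewrite /tern /= => ->; ring.
  rewrite mulr_sumr -big_split; apply: eq_bigr => j _.
  rewrite mulr_sumr -big_split; apply: eq_bigr => k _ /=.
  by have := lg (ds j) (ds k) r x y; rewrite /tern /= => ->; ring.
apply: eq_bigr => i _.
transitivity (\sum_j \sum_k f (tri (d' i) (d' j) (d k)) * g (tri (ds' i) (ds' j) (ds k))).
  apply: (dualp_indep (B := fun u v => \sum_k f (tri (d' i) u (d k)) * g (tri (ds' i) v (ds
    k)))) => // t r x y.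
    rewrite mulr_sumr -big_split; apply: eq_bigr => k _ /=.
    by have := alt3_lin2 (d' i) (d k) af r x y; rewrite /tern /= => ->; ring.
  rewrite mulr_sumr -big_split; apply: eq_bigr => k _ /=.
  by have := alt3_lin2 (ds' i) (ds k) ag r x y; rewrite /tern /= => ->; ring.
apply: eq_bigr => j _.
apply: (dualp_indep (B := fun u v => f (tri (d' i) (d' j) u) * g (tri (ds' i) (ds' j) v))) =>
  // t r x y.
  by have := alt3_lin3 (d' i) (d' j) af r x y; rewrite /tern /= => ->; ring.
by have := alt3_lin3 (ds' i) (ds' j) ag r x y; rewrite /tern /= => ->; ring.
Qed.

(** The lattice basis and its dual basis both consist of lattice vectors, so rational classes have a
    rational pairing. *)
Definition Qform f g : C := tpair b bs f g.

(** Changing to the dual pair of [dualp_oneJ] gives a factor 2 for each slot. On H^{p,q} and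
    H^{p',q'} a nonzero value then requires lam p lam p' = 8, which by [lamM] is the first
    Hodge-Riemann relation. *)
Lemma Qform_pb f g : is_altform f -> is_altform g -> Qform (pb f) (pb g) = 8 * Qform f g.
Proof.
move=> af ag; rewrite /Qform [in RHS](tpair_indep af ag dualp_b (dualp_oneJ dualp_b)).
rewrite /tpair mulr_sumr; apply: eq_bigr => i _.
rewrite mulr_sumr; apply: eq_bigr => j _.
rewrite mulr_sumr; apply: eq_bigr => k _.
rewrite /pullback !tri_comp.
move/altformP: ag => ag; have [l _ _] := ag.
rewrite -!/(tern g _ _ _) (elinZ _ _ (l _ _)) (elinZ _ _ (alt3_lin2 _ _ ag)) (elinZ _ _
  (alt3_lin3 _ _ ag)).
by rewrite fmorphV rmorph_nat; field.
Qed.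

(** Passing to the dual pair (ds, -d) exchanges the two forms and costs one sign per slot, three in
    all. *)
Lemma Qform_sym f g : is_altform f -> is_altform g -> Qform g f = - Qform f g.
Proof.
move=> af ag; rewrite /Qform (tpair_indep af ag dualp_b (dualp_opp dualp_b)).
rewrite /tpair -sumrN; apply: eq_bigr => i _.
rewrite -sumrN; apply: eq_bigr => j _.
rewrite -sumrN; apply: eq_bigr => k _.
move/altformP: ag => ag; have [l _ _] := ag.
have N a : elin eR a -> forall x : V, a (- x) = - a x.
  by move=> la x; rewrite -scaleN1r (elinZ _ _ la) rmorphN rmorph1 mulN1r.
rewrite -!/(tern g _ _ _) (N _ (l _ _)) (N _ (alt3_lin2 _ _ ag)) (N _ (alt3_lin3 _ _ ag)).
ring.
Qed.

(** Since (1 + J)^2 = 2 J, the eigenvalue is (lam p)^2 / 8 = i^(p - q), exactly the factor in the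
    second Hodge-Riemann relation. *)
Lemma Hpq_J p q f x y z : (p + q = 3)%N -> hcomp H p q f ->
  f (tri (tJ x) (tJ y) (tJ z)) = 'i ^+ p / 'i ^+ q * f (tri x y z).
Proof.
move=> pq /(Hpq_sub pq) [/altformP af hf].
have M2 (u : V) : oneJ (oneJ u) = (2 : R) *: tJ u.
  by rewrite /oneJ (tJD J_lin) JJ [u + _]addrC addrACA subrr addr0 scaler_nat mulr2n.
have pbE u v w : f (tri (oneJ u) (oneJ v) (oneJ w)) = lam R p * f (tri u v w).
  by have := congr1 (fun g : Form => g (tri u v w)) hf; rewrite /pullback tri_comp.
have [l _ _] := af.
have : f (tri (oneJ (oneJ x)) (oneJ (oneJ y)) (oneJ (oneJ z))) =
   8 * f (tri (tJ x) (tJ y) (tJ z)).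
  rewrite !M2 -!/(tern f _ _ _) (elinZ _ _ (l _ _)) (elinZ _ _ (alt3_lin2 _ _ af)) (elinZ _ _
    (alt3_lin3 _ _ af)).
  rewrite rmorph_nat; ring.
rewrite !pbE => h; apply: (mulfI (x := 8)); first by rewrite pnatr_eq0.
rewrite -h mulrA [RHS]mulrA; congr (_ * _).
have i2 : 'i ^+ 2 = -1 :> C := sqrCi _.
have -> : q = (3 - p)%N by lia.
move: p pq {hf pbE h} => [|[|[|[|p]]]] pq; last by lia.
all: rewrite ?subnn ?subSS ?subn0 -exprVn invCi ?lamE; ring: i2.
Qed.

Lemma Qform_polarization : is_hodge_polarization H Qform.
Proof.
have csp : cspan (ratsp H) = @is_altform R V 3 := cspan_ratsp bc c_lin cb L_int.
split.
- exact: (cohomology_hodge J_lin JJ bc c_lin cb L_b L_int).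
- split=> a u v t _ _ _; rewrite /Qform /tpair mulr_sumr -big_split; apply: eq_bigr => i _;
  rewrite mulr_sumr -big_split; apply: eq_bigr => j _;
  rewrite mulr_sumr -big_split; apply: eq_bigr => k _ /=.
    by rewrite mulrDl mulrA.
  by rewrite mulrDr mulrCA.
- split=> u v.
    move=> [_ ur] [_ vr]; rewrite -/(is_rat _) /Qform /tpair.
    apply: is_rat_sum => i _; apply: is_rat_sum => j _; apply: is_rat_sum => k _.
    have L3 (d : 'I_n -> V) : (forall i, tL (d i)) -> forall l, tL (tri (d i) (d j) (d k) l).
      by move=> hd l; have [->|->|->] := ord3P l; apply: hd.
    by apply: is_ratM; [apply: ur|apply: vr]; apply: L3.
  rewrite csp => au av; rewrite (Qform_sym au av) /=; ring.
- move=> p q p' q' u v pq pq' hu hv pq0.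
  have [au eu] := Hpq_sub pq hu; have [av ev] := Hpq_sub pq' hv.
  have := Qform_pb au av; rewrite eu ev.
  have -> : Qform (lam R p *: u) (lam R p' *: v) = lam R p * lam R p' * Qform u v.
    rewrite /Qform /tpair mulr_sumr; apply: eq_bigr => i _.
    rewrite mulr_sumr; apply: eq_bigr => j _.
    rewrite mulr_sumr; apply: eq_bigr => k _.
    by rewrite !scalrfctE /GRing.scale /=; ring.
  move/eqP; rewrite -subr_eq0 -mulrBl mulf_eq0 => /orP[|/eqP //].
  rewrite subr_eq0 => /eqP /lamM; rewrite /= in pq pq'.
  by move=> h; have {h} : (p + p' = 3)%N; [apply: h; lia|move/eqP: pq0; lia].
- move=> p q u w pq hu u0 [k [d [x [Ux uE wE]]]].
  have [au eu] := Hpq_sub pq hu.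
  have wv y : w y = (u y)^*.
    rewrite wE uE !fct_sumE rmorph_sum; apply: eq_bigr => i _.
    by rewrite !scalrfctE -{1}(ratsp_conj bc c_lin cb L_b L_int y (Ux i)) -[RHS]/((d i * x i
      y)^*) rmorphM.
  have aw : is_altform w.
    have : cspan (ratsp H) w by rewrite wE; exists k, (fun i => (d i)^*), x.
    by rewrite csp.
  have [e he] := dualp_orthonormal.
  rewrite /Qform (tpair_indep au aw dualp_b he).
  (* In the dual pair (e, J e) the factor i^(p - q) moves the arguments of [u] from e to J e, where
     the conjugate class is evaluated too; the pairing becomes a sum of squared absolute values. *)
  pose T (i j k : 'I_n) := u (tri (tJ (e i)) (tJ (e j)) (tJ (e k))).
  have -> : 'i ^+ p / 'i ^+ q * tpair e (fun i => tJ (e i)) u w =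
      \sum_i \sum_j \sum_k T i j k * (T i j k)^*.
    rewrite /tpair mulr_sumr; apply: eq_bigr => i _.
    rewrite mulr_sumr; apply: eq_bigr => j _.
    rewrite mulr_sumr; apply: eq_bigr => l _.
    by rewrite mulrA -(Hpq_J _ _ _ pq hu) wv.
  have T0 i j l : 0 <= T i j l * (T i j l)^* by rewrite mul_conjC_ge0.
  rewrite lt0r; apply/andP; split; last by do 3 (apply: sumr_ge0 => ? _).
  apply: contraNneq u0 => S0.
  have TE i j l : T i j l = 0.
    move/eqP: S0; rewrite psumr_eq0; last by move=> *; do 2 (apply: sumr_ge0 => ? _).
    move/allP/(_ i (mem_index_enum _)); rewrite /= psumr_eq0; last by move=> *; apply: sumr_ge0
      => ? _.
    move/allP/(_ j (mem_index_enum _)); rewrite /= psumr_eq0 //.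
    by move/allP/(_ l (mem_index_enum _)); rewrite /= mul_conjC_eq0 => /eqP.
  apply/eqP/funext => v; rewrite -(triE v).
  move/altformP: au => au; rewrite -/(tern u _ _ _).
  by rewrite (alt3_eq0_basis he.2 au) // => t; apply: TE.
Qed.

End TensorPolarization.

(** * The complex torus *)

Section HermitianForm.
Variable R : realType.
Local Notation C := R[i].
Local Notation C6 := 'rV[R[i]]_6.
Implicit Types u v x : C6.

Lemma hformDr u v x : hform u (v + x) = hform u v + hform u x.
Proof. exact: (linearD (hform u : C6 -> C^o)). Qed.
Lemma hformZr a u v : hform u (a *: v) = a * hform u v.
Proof. by rewrite /hform mulr_sumr; apply: eq_bigr => j _; rewrite mxE; ring. Qed.
Lemma hformDl u v x : hform (v + x) u = hform v u + hform x u.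
Proof. by rewrite hform_conj hformDr rmorphD /= -!hform_conj. Qed.
Lemma hformZl a u v : hform (a *: u) v = a^* * hform u v.
Proof. by rewrite hform_conj hformZr rmorphM /= -hform_conj. Qed.
Lemma hform0r u : hform u 0 = 0.
Proof. by rewrite /hform big1 // => j _; rewrite mxE mulr0. Qed.
Lemma hform_real v : hform v v \is Num.real.
Proof. by apply/CrealP; rewrite -hform_conj. Qed.

Lemma hform_delta j v : hform (delta_mx 0 j) v = sgn6 R j * v 0 j.
Proof.
rewrite /hform (bigD1 j) //= mxE !eqxx rmorph1 mulr1 big1 ?addr0 // => k /negPf kj.
by rewrite mxE kj andbF rmorph0 mulr0 mul0r.
Qed.

Lemma dim_bigcap_lker (vT : vectType C) m (f : 'I_m -> 'Hom(vT, C^o)) :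
  (\dim {:vT} <= \dim (\bigcap_i lker (f i)) + m)%N.
Proof.
elim: m f => [|m IH] f; first by rewrite big_ord0 addn0.
rewrite big_ord_recr /=; set U := (\bigcap_i _)%VS.
apply: leq_trans (IH (fun i => f (widen_ord (leqnSn m) i))) _.
have h : (\dim (f ord_max @: U) <= 1)%N.
  by apply: leq_trans (dimvS (subvf _)) _; rewrite dimvf.
rewrite -/U -(limg_ker_dim (f ord_max) U); lia.
Qed.

Section PositiveSubspace.
Variables (Vp : {vspace C6}) (dim_Vp : \dim Vp = 3%N).
Hypothesis Vp_gt0 : forall v, v \in Vp -> v != 0 -> 0 < hform v v.

Lemma dim_hperp : \dim (hperp Vp) = 3%N.
Proof.
have cap := capv_hperp Vp_gt0.
have le : (\dim (Vp + hperp Vp) <= 6)%N.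
  by apply: leq_trans (dimvS (subvf _)) _; rewrite dimvf.
have := dimv_sum_cap Vp (hperp Vp).
have ge : (6 <= \dim (hperp Vp) + 3)%N.
  have := dim_bigcap_lker (fun i : 'I_(\dim Vp) => linfun (hform (vbasis Vp)`_i : C6 -> C^o)).
  by rewrite dimvf => h; apply: leq_trans h _; rewrite leq_add2l dim_Vp.
by rewrite cap dimv0 dim_Vp; lia.
Qed.

Lemma addv_hperp : (Vp + hperp Vp = fullv)%VS.
Proof.
apply/eqP; rewrite eqEdim subvf dimvf /=; suff: (6 <= \dim (Vp + hperp Vp))%N by [].
have := dimv_sum_cap Vp (hperp Vp).
by rewrite (capv_hperp Vp_gt0) dimv0 dim_Vp dim_hperp; lia.
Qed.

Lemma hperp_dec v : exists p q, [/\ p \in Vp, q \in hperp Vp & v = p + q].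
Proof.
have : v \in (Vp + hperp Vp)%VS by rewrite addv_hperp memvf.
by case/memv_addP => p hp [q hq ->]; exists p, q.
Qed.

Lemma hform_pq p q : p \in Vp -> q \in hperp Vp -> hform p q = 0.
Proof. by move=> hp /hperpP; apply. Qed.
Lemma hform_qp p q : p \in Vp -> q \in hperp Vp -> hform q p = 0.
Proof. by move=> hp hq; rewrite hform_conj (hform_pq hp hq) rmorph0. Qed.

(* If H(q, q) >= 0 then H is nonnegative on the 4-dimensional space Vp + <q>, which
   meets the 3-dimensional negative definite space x_1 = x_2 = x_3 = 0. *)
Lemma hperp_lt0 q : q \in hperp Vp -> q != 0 -> hform q q < 0.
Proof.
move=> hq q0; rewrite real_ltNge ?real0 ?hform_real //; apply/negP => q_ge0.
pose f (i : 'I_3) : 'Hom(C6, C^o) :=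
  linfun (hform (delta_mx 0 (widen_ord (isT : (3 <= 6)%N) i)) : C6 -> C^o).
have fE i v : f i v = v 0 (widen_ord (isT : (3 <= 6)%N) i).
  by rewrite /f lfunE /= hform_delta /sgn6 /= ltn_ord mul1r.
pose N := (\bigcap_i lker (f i))%VS.
have dimN : (3 <= \dim N)%N.
  have : (6 <= \dim N + 3)%N by have := dim_bigcap_lker f; rewrite dimvf.
  lia.
pose U := (Vp + <[q]>)%VS.
have qV : (Vp :&: <[q]> = 0)%VS.
  have qh : (<[q]> <= hperp Vp)%VS by rewrite -memvE.
  by apply/eqP; rewrite -subv0 -[X in (_ <= X)%VS](capv_hperp Vp_gt0) capvS.
have dimU : \dim U = 4%N.
  by have := dimv_sum_cap Vp <[q]>; rewrite qV dimv0 dim_Vp dim_vline q0 -/U; lia.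
have : (U :&: N)%VS != 0%VS.
  apply/eqP => UN; have := dimv_sum_cap U N; rewrite UN dimv0 dimU => h.
  have h6 : (4 + \dim N <= 6)%N.
    by rewrite -h addn0; apply: leq_trans (dimvS (subvf _)) _; rewrite dimvf.
  have h7 : (4 + 3 <= 4 + \dim N)%N by rewrite leq_add2l.
  by have := leq_trans h7 h6.
rewrite -vpick0; set x := vpick _ => x0.
have : x \in (U :&: N)%VS by apply: memv_pick.
rewrite memv_cap => /andP[/memv_addP [p hp [_ /vlineP [k ->] xE]] xN].
have x3 (j : 'I_6) : (j < 3)%N -> x 0 j = 0.
  move=> j3; have : x \in lker (f (Ordinal j3)).
    by apply: subvP xN; apply: (bigcapv_inf (Ordinal j3)).
  rewrite memv_ker fE => /eqP; congr (x 0 _ = 0); exact: val_inj.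
have : 0 <= hform x x.
  rewrite xE hformDl !hformDr !hformZr !hformZl (hform_pq hp hq) (hform_qp hp hq).
  rewrite !mulr0 addr0 add0r addr_ge0 //.
    by have [->|/(Vp_gt0 hp)/ltW //] := eqVneq p 0; rewrite hform0r.
  by rewrite mulrA mulr_ge0 // mul_conjC_ge0.
have xx : hform x x = - \sum_j (x 0 j)^* * x 0 j.
  rewrite /hform -sumrN; apply: eq_bigr => j _; rewrite /sgn6; case: ifP => [/x3 ->|_].
    by rewrite !mulr0 oppr0.
  by rewrite !mulN1r mulNr.
have t0 j : 0 <= (x 0 j)^* * x 0 j by rewrite mulrC mul_conjC_ge0.
rewrite xx oppr_ge0 => le0.
have : \sum_j (x 0 j)^* * x 0 j == 0 by rewrite eq_le le0 sumr_ge0.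
rewrite psumr_eq0 // => /allP h; case/eqP: x0; apply/rowP => j.
by have := h j (mem_index_enum _); rewrite /= mulrC mul_conjC_eq0 mxE => /eqP.
Qed.

Lemma Jop_linear : linear (Jop Vp).
Proof.
move=> a u v; rewrite /Jop.
move: (daddv_pi Vp _) (daddv_pi _ Vp) => f g.
have -> : f (a *: u + v) = a *: f u + f v by exact: linearP.
have -> : g (a *: u + v) = a *: g u + g v by exact: linearP.
move: (f u) (f v) (g u) (g v) => x y z t.
by apply/rowP => j; rewrite !mxE; ring.
Qed.

Lemma Jop_dec p q : p \in Vp -> q \in hperp Vp -> Jop Vp (p + q) = 'i *: p - 'i *: q.
Proof.
move=> hp hq; have := Jop_linear 1 p q; rewrite !scale1r => ->.
by rewrite (Jop_Vp Vp_gt0 hp) (Jop_hperp Vp_gt0 hq) scaleNr.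
Qed.

Lemma JopJ v : Jop Vp (Jop Vp v) = - v.
Proof.
have [p [q [hp hq ->]]] := hperp_dec v.
rewrite (Jop_dec hp hq) -scaleNr Jop_dec ?memvZ // !scalerA mulrN -!expr2 sqrCi opprK.
by rewrite scaleN1r scale1r opprD.
Qed.

Lemma hform_J u v : hform (Jop Vp u) (Jop Vp v) = hform u v.
Proof.
have [p [q [hp hq ->]]] := hperp_dec u; have [p' [q' [hp' hq' ->]]] := hperp_dec v.
rewrite (Jop_dec hp hq) (Jop_dec hp' hq') -!scaleNr !hformDl !hformDr !hformZl !hformZr.
rewrite (hform_pq hp hq') (hform_qp hp' hq) rmorphN /= conjCi opprK.
have i2 : 'i ^+ 2 = -1 :> C := sqrCi _.
ring: i2.
Qed.

(** For v = p + q the value H(v, J v) is i (H(p, p) - H(q, q)), with H positive on [Vp] and negative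
    on its orthogonal. *)
Lemma Im_hform_J_gt0 v : v != 0 -> 0 < complex.Im (hform v (Jop Vp v)).
Proof.
have [p [q [hp hq ->]]] := hperp_dec v => v0.
rewrite (Jop_dec hp hq) -!scaleNr hformDl !hformDr !hformZr (hform_pq hp hq) (hform_qp hp hq).
rewrite !mulr0 addr0 add0r.
have gp : 0 <= hform p p.
  by have [->|/(Vp_gt0 hp)/ltW //] := eqVneq p 0; rewrite hform0r.
have gq : hform q q <= 0.
  by have [->|/(hperp_lt0 hq)/ltW //] := eqVneq q 0; rewrite hform0r.
have : 0 < hform p p - hform q q.
  have [p0|/(Vp_gt0 hp) h] := eqVneq p 0.
    rewrite subr_gt0; have [q0|/(hperp_lt0 hq) h] := eqVneq q 0.
      by rewrite p0 q0 addr0 eqxx in v0.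
    exact: lt_le_trans gp.
  by rewrite subr_gt0; exact: le_lt_trans h.
rewrite mulNr -mulrBr -complexiE; case: (_ - _) => a b.
by rewrite ltcE /= => /andP[/eqP b0 a0]; rewrite b0 mul0r mul1r add0r.
Qed.

End PositiveSubspace.
End HermitianForm.

(** * Arithmetic of Z[w] *)

Section EisensteinNumbers.
Variables (R : realType) (w : R[i]).
Local Notation C := R[i].
Hypothesis w_prim : 3.-primitive_root w.

Lemma w_sq : w ^+ 2 = -1 - w.
Proof.
have w3 := prim_expr_order w_prim.
have w1 : w - 1 != 0.
  by rewrite subr_eq0 -[w]expr1 -[1](expr0 w) (eq_prim_root_expr w_prim).
apply: (mulfI w1); apply/eqP; rewrite -subr_eq0; apply/eqP.
transitivity (w ^+ 3 - 1); first by ring.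
by rewrite w3 subrr.
Qed.

Lemma w_ReIm : complex.Re w = - 2^-1 /\ complex.Im w ^+ 2 = 3 / 4.
Proof.
have := w_sq; case: w => a b /eqP; rewrite eq_complex /= => /andP[/eqP h1 /eqP h2].
have b0 : b != 0.
  apply/eqP => b0; move: h1; rewrite b0 => h1.
  have : a ^+ 2 + a + 1 = 0 by rewrite -[RHS](subrr (a * a - 0 * 0)) {2}h1; ring.
  by have : 0 <= (a + 2^-1) ^+ 2 by [exact: sqr_ge0]; lra.
have a2 : a = - 2^-1.
  apply: (mulfI b0); lra.
by split => //; move: h1; rewrite a2; lra.
Qed.

Let b := complex.Im w.

Lemma Im_w_neq0 : b != 0.
Proof. by have [_ h] := w_ReIm; rewrite -sqrf_eq0 /b h; lra. Qed.

Lemma w_conj : w^* = -1 - w.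
Proof.
have [h1 _] := w_ReIm; move: h1; case: w => a' b' /= ->.
by apply/eqP; rewrite eq_complex /=; apply/andP; split; apply/eqP; lra.
Qed.

Lemma w_conjM : w^* * w = 1.
Proof. by rewrite w_conj; ring: w_sq. Qed.

Lemma w_neq0 : w != 0.
Proof. by apply/eqP => w0; have := w_conjM; rewrite w0 mulr0 => /esym/eqP; rewrite oner_eq0. Qed.

Lemma w_inv : w^-1 = -1 - w.
Proof. by apply: (mulfI w_neq0); rewrite mulfV ?w_neq0 //; ring: w_sq. Qed.

(* Real coordinates in the basis (1, w) of C; note that Re w = -1/2. *)
Definition cx (z : C) : R := complex.Re z + complex.Im z / b / 2.
Definition cy (z : C) : R := complex.Im z / b.

Lemma cxy z : z = (cx z)%:C%C + (cy z)%:C%C * w.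
Proof.
have b0 := Im_w_neq0; have [a2 _] := w_ReIm.
rewrite /cx /cy; move: a2 b0; rewrite /b; case: w z => a' b' [x y] /= -> b0.
by apply/eqP; rewrite eq_complex /=; apply/andP; split; apply/eqP; field.
Qed.

Lemma cx_eq (x y : R) : cx (x%:C%C + y%:C%C * w) = x.
Proof.
have b0 := Im_w_neq0; have [a2 _] := w_ReIm.
by rewrite /cx; move: a2 b0; rewrite /b; case: w => a' b' /= -> b0; field.
Qed.

Lemma cy_eq (x y : R) : cy (x%:C%C + y%:C%C * w) = y.
Proof.
have b0 := Im_w_neq0; have [a2 _] := w_ReIm.
by rewrite /cy; move: a2 b0; rewrite /b; case: w => a' b' /= -> b0; field.
Qed.

Lemma cxD (r : R) z t : cx (r%:C%C * z + t) = r * cx z + cx t.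
Proof. by case: z t => [x y] [x' y']; rewrite /cx /=; ring. Qed.
Lemma cyD (r : R) z t : cy (r%:C%C * z + t) = r * cy z + cy t.
Proof. by case: z t => [x y] [x' y']; rewrite /cy /=; ring. Qed.

Definition eis (z : C) := exists x y : int, z = x%:~R + y%:~R * w.

Lemma eisD z t : eis z -> eis t -> eis (z + t).
Proof.
by move=> [x [y ->]] [x' [y' ->]]; exists (x + x'), (y + y'); rewrite !rmorphD /=; ring.
Qed.
Lemma eisM z t : eis z -> eis t -> eis (z * t).
Proof.
move=> [x [y ->]] [x' [y' ->]]; exists (x * x' - y * y'), (x * y' + y * x' - y * y').
by rewrite !(rmorphD, rmorphN, rmorphM) /=; ring: w_sq.
Qed.
Lemma eis_int (m : int) : eis m%:~R.
Proof. by exists m, 0; rewrite mul0r addr0. Qed.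
Lemma eisw : eis w.
Proof. by exists 0, 1; rewrite mul1r add0r. Qed.
Lemma eisN z : eis z -> eis (- z).
Proof. by rewrite -mulN1r => h; apply: eisM => //; apply: (eis_int (-1)). Qed.
Lemma eis_sum (I : Type) (s : seq I) (P : pred I) (F : I -> C) :
  (forall i, P i -> eis (F i)) -> eis (\sum_(i <- s | P i) F i).
Proof. by move=> h; elim/big_rec: _ => [|i x Pi hx]; [exact: (eis_int 0)|apply: eisD => //;
  apply: h]. Qed.
Lemma eis_conj z : eis z -> eis z^*.
Proof.
move=> [x [y ->]]; rewrite rmorphD rmorphM /= !rmorph_int w_conj.
by exists (x - y), (- y); rewrite rmorphB rmorphN /=; ring.
Qed.

Lemma eisP z : eis z <-> (exists m : int, cx z = m%:~R) /\ (exists m : int, cy z = m%:~R).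
Proof.
have E (m : int) : (m%:~R : C) = (m%:~R : R)%:C%C.
  exact: (esym (rmorph_int (real_complex R) m)).
split=> [[x [y ->]]|[[x hx] [y hy]]].
  by rewrite !E cx_eq cy_eq; split; [exists x|exists y].
by exists x, y; rewrite {1}(cxy z) hx hy -!E.
Qed.

(* The sign of Im w. *)
Definition sw : R := 2 / Num.sqrt 3 * b.

Lemma sw_sq : sw * sw = 1.
Proof.
have [_ h] := w_ReIm.
have s3 : Num.sqrt 3 ^+ 2 = 3 :> R by rewrite sqr_sqrtr // ler0n.
have s0 : Num.sqrt 3 != 0 :> R by rewrite sqrtr_eq0 -ltNge ltr0n.
transitivity (4 * b ^+ 2 / Num.sqrt 3 ^+ 2); first by rewrite /sw; field.
by rewrite s3 /b h; field.
Qed.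

Lemma sw_int : exists m : int, sw = m%:~R.
Proof.
have : (sw - 1) * (sw + 1) = 0 by rewrite mulrDr !mulrBl sw_sq; ring.
move/eqP; rewrite mulf_eq0 subr_eq0 addr_eq0 => /orP[/eqP ->|/eqP ->]; first by exists 1.
by exists (-1).
Qed.

End EisensteinNumbers.

(** * Lattices given by integral coordinates *)

Section LatticeFromCoordinates.
Variables (R : realType) (V : lmodType R) (L : set V) (n : nat).
Variables (b : 'I_n -> V) (c : 'I_n -> V -> R).
Hypothesis bc : forall x, x = \sum_i c i x *: b i.
Hypothesis c_lin : forall i r x y, c i (r *: x + y) = r * c i x + c i y.
Hypothesis cb : forall i j, c i (b j) = (i == j)%:R.
Hypothesis LP : forall v, L v <-> forall i, exists m : int, c i v = m%:~R.

Lemma lattice_basis_coord : is_lattice_basis L b.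
Proof.
have c0 i : c i 0 = 0 by apply: (addrI (1 * c i 0)); rewrite -c_lin scaler0 !addr0 mul1r.
have csum (r : 'I_n -> R) i : c i (\sum_j r j *: b j) = r i.
  have -> : c i (\sum_j r j *: b j) = \sum_j r j * c i (b j).
    by elim/big_rec2: _ => [|j y x _ <-].
  by rewrite (bigD1 i) //= cb eqxx mulr1 big1 ?addr0 // => j /negPf ji; rewrite cb eq_sym ji
    mulr0.
split; split => //.
- split; first by apply/LP => i; exists 0.
  move=> a u v /LP hu /LP hv; apply/LP => i; rewrite c_lin.
  by have [m ->] := hu i; have [m' ->] := hv i; exists (a * m + m'); rewrite rmorphD rmorphM.
- by move=> i; apply/LP => j; exists (j == i)%:R; rewrite cb rmorph_nat.
- move=> u /LP hu; have [m hm] := choice hu; exists m.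
  by rewrite {1}(bc u); apply: eq_bigr => i _; rewrite hm.
- move=> m h i; have := csum (fun i => (m i)%:~R) i; rewrite h c0 => /esym/eqP.
  by rewrite intr_eq0 => /eqP.
- by move=> u _; exists (fun i => c i u); apply: bc.
- by move=> r h i; rewrite -(csum r i) h c0.
Qed.

End LatticeFromCoordinates.

(** * The principal polarization E' *)

Section WeilTorus.
Variables (R : realType) (w : R[i]).
Local Notation C := R[i].
Local Notation C6 := 'rV[R[i]]_6.
Hypothesis w_prim : 3.-primitive_root w.
Variables (Vp : {vspace C6}) (dim_Vp : \dim Vp = 3%N).
Hypothesis Vp_gt0 : forall v, v \in Vp -> v != 0 -> 0 < hform v v.
Local Notation X := (weil_torus w Vp).
Local Notation V := (tV X).
Local Notation eR := (real_complex R).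

Definition er (j : 'I_6) : R := if (j < 3)%N then 1 else -1.

Lemma sgn6E j : sgn6 R j = (er j)%:C%C.
Proof. by rewrite /sgn6 /er; case: ifP => _; rewrite ?rmorphN rmorph1. Qed.

Lemma er_sq j : er j * er j = 1.
Proof. by rewrite /er; case: ifP => _; rewrite ?mulrNN mul1r. Qed.

Lemma tJ_linear : linear (@tJ _ X).
Proof. by move=> a u v; have := Jop_linear Vp a%:C%C u v. Qed.

Lemma tJJ v : @tJ _ X (tJ v) = - v.
Proof. exact: (JopJ dim_Vp Vp_gt0). Qed.

(* The symplectic basis (e_j, +- w e_j) of the lattice, and its coordinates [lc]. *)
Definition lb (i : 'I_(6 + 6)) : V :=
  match fintype.split i with
  | inl j => delta_mx 0 j : C6
  | inr j => ((sw w * er j)%:C%C * w) *: (delta_mx 0 j : C6)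
  end.

Definition lc (i : 'I_(6 + 6)) (v : V) : R :=
  match fintype.split i with
  | inl j => cx w ((v : C6) 0 j)
  | inr j => sw w * er j * cy w ((v : C6) 0 j)
  end.

Lemma lb_l j : lb (lshift 6 j) = (delta_mx 0 j : C6).
Proof. by rewrite /lb -[lshift 6 j]/(unsplit (inl j)) unsplitK. Qed.
Lemma lb_r j : lb (rshift 6 j) = ((sw w * er j)%:C%C * w) *: (delta_mx 0 j : C6).
Proof. by rewrite /lb -[rshift 6 j]/(unsplit (inr j)) unsplitK. Qed.
Lemma lc_l j v : lc (lshift 6 j) v = cx w ((v : C6) 0 j).
Proof. by rewrite /lc -[lshift 6 j]/(unsplit (inl j)) unsplitK. Qed.
Lemma lc_r j v : lc (rshift 6 j) v = sw w * er j * cy w ((v : C6) 0 j).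
Proof. by rewrite /lc -[rshift 6 j]/(unsplit (inr j)) unsplitK. Qed.

Lemma sw_er j : sw w * er j * (sw w * er j) = 1.
Proof. by rewrite mulrACA (sw_sq w_prim) er_sq mul1r. Qed.

Lemma lb_lc x : x = \sum_i lc i x *: lb i.
Proof.
rewrite big_split_ord /= -big_split /=.
transitivity (\sum_j (x : C6) 0 j *: (delta_mx 0 j : C6)); first exact: row_sum_delta.
apply: eq_bigr => j _; rewrite lc_l lb_l lc_r lb_r.
have E (r : R) (v : V) : r *: v = r%:C%C *: (v : C6) :> C6 by [].
have D (a d : C) (e : C6) : ((a *: e : C6) : V) + ((d *: e : C6) : V) = (a + d) *: e :> C6.
  by rewrite scalerDl.
rewrite !E scalerA D {1}(cxy w_prim ((x : C6) 0 j)); congr ((_ + _) *: _).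
rewrite mulrA -rmorphM; congr (_%:C%C * _).
by rewrite mulrAC sw_er mul1r.
Qed.

Lemma lc_linear i r x y : lc i (r *: x + y) = r * lc i x + lc i y.
Proof.
have E k : ((r *: x + y : V) : C6) 0 k = r%:C%C * (x : C6) 0 k + (y : C6) 0 k.
  by rewrite !mxE.
case: (split_ordP i) => j ->.
  by rewrite !lc_l E cxD.
by rewrite !lc_r E cyD; ring.
Qed.

Lemma lc_lb i j : lc i (lb j) = (i == j)%:R.
Proof.
have cx0 : cx w 0 = 0 by have := cx_eq w_prim 0 0; rewrite !rmorph0 mul0r addr0.
have cy0 : cy w 0 = 0 by have := cy_eq w_prim 0 0; rewrite !rmorph0 mul0r addr0.
have cx1 : cx w 1 = 1 by have := cx_eq w_prim 1 0; rewrite rmorph1 rmorph0 mul0r addr0.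
have cy1 : cy w 1 = 0 by have := cy_eq w_prim 1 0; rewrite rmorph1 rmorph0 mul0r addr0.
have cxw y : cx w (y%:C%C * w) = 0 by have := cx_eq w_prim 0 y; rewrite rmorph0 add0r.
have cyw y : cy w (y%:C%C * w) = y by have := cy_eq w_prim 0 y; rewrite rmorph0 add0r.
case: (split_ordP i) => i' ->; case: (split_ordP j) => j' ->.
- rewrite lc_l lb_l !mxE (inj_eq (@lshift_inj _ _)) /=.
  by case: eqP.
- rewrite lc_l lb_r !mxE eq_lrshift /=; case: eqP => _; rewrite ?mulr1 ?mulr0 //.
- rewrite lc_r lb_l !mxE eq_rlshift /=; case: eqP => _; by rewrite ?cy1 ?cy0 mulr0.
- rewrite lc_r lb_r !mxE (inj_eq (@rshift_inj _ _)) /=.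
  case: eqP => [->|_]; rewrite ?mulr1 ?mulr0 ?cy0 ?mulr0 //.
  by rewrite cyw sw_er.
Qed.

Lemma lc_elin i : elin eR (eR \o lc i).
Proof. by move=> r x y; rewrite /= lc_linear rmorphD rmorphM. Qed.

Lemma latticeP (v : V) : tL v <-> forall i, exists m : int, lc i v = m%:~R.
Proof.
have [s hs] := sw_int w_prim.
have he j : exists e : int, er j = e%:~R by rewrite /er; case: ifP => _; [exists 1|exists (-1)].
split=> [h i|h j].
  case: (split_ordP i) => j ->; have /(eisP w_prim) [[m hm] [m' hm']] := h j.
    by rewrite lc_l hm; exists m.
  by have [e ee] := he j; rewrite lc_r hm' hs ee; exists (s * e * m'); rewrite !rmorphM.
apply/(eisP w_prim); split; first by have := h (lshift 6 j); rewrite lc_l.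
have [m] := h (rshift 6 j); rewrite lc_r => hm; have [e ee] := he j.
exists (s * e * m); rewrite !rmorphM /= -hs -ee -hm mulrA sw_er mul1r //.
Qed.

Lemma lattice_basis_lb : is_lattice_basis (@tL _ X) lb.
Proof. exact: (lattice_basis_coord lb_lc lc_linear lc_lb latticeP). Qed.

Lemma tL_lb i : tL (lb i).
Proof. by apply/latticeP => j; exists (j == i)%:R; rewrite lc_lb rmorph_nat. Qed.

Lemma weil_torus_complex : is_complex_torus X 6.
Proof. by split; [exact: tJ_linear|exact: tJJ|exists lb; exact: lattice_basis_lb]. Qed.

Lemma Im_rM (r : R) (z : C) : complex.Im (r%:C%C * z) = r * complex.Im z.
Proof. by case: z => x y /=; ring. Qed.

Lemma eis_hform u v : (forall j, eis w ((u : C6) 0 j)) -> (forall j, eis w ((v : C6) 0 j)) ->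
  eis w (hform u v).
Proof.
move=> hu hv; apply: eis_sum => j _; apply: (eisM w_prim) => //.
apply: (eisM w_prim); last exact: eis_conj.
rewrite /sgn6; case: ifP => _; [exact: (eis_int w 1)|exact: (eis_int w (-1))].
Qed.

Lemma formE_polarization : @is_polarization R X (@formE R).
Proof.
have Dl (a : R) (u v : V) : (a *: u + v : V) = a%:C%C *: (u : C6) + (v : C6) :> C6 by [].
have ca (a : R) : (a%:C%C : C)^* = a%:C%C by apply: conjc_real.
split.
- split=> a u v t; rewrite /formE Dl.
    rewrite hformDl hformZl ca raddfD /= Im_rM; ring.
  rewrite hformDr hformZr raddfD /= Im_rM; ring.
- move=> v; rewrite /formE; have /complex_realP [k ->] := hform_real v.
  by rewrite /= mulr0.
(* For lattice vectors H(u, v) = x + y w with integers x and y, and the normalization 2 / sqrt 3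
   turns Im w into its sign. *)
- move=> u v hu hv; rewrite /formE.
  have [x [y ->]] := eis_hform hu hv.
  have E (m : int) : (m%:~R : C) = (m%:~R : R)%:C%C.
    exact: (esym (rmorph_int (real_complex R) m)).
  rewrite !E raddfD /= Im_rM add0r mulrCA -/(sw w).
  by have [s ->] := sw_int w_prim; exists (y * s); rewrite rmorphM.
- by move=> u v; rewrite /formE (hform_J dim_Vp Vp_gt0).
- move=> v v0; apply: mulr_gt0; last exact: (Im_hform_J_gt0 dim_Vp Vp_gt0).
  by rewrite divr_gt0 ?ltr0n // sqrtr_gt0 ltr0n.
Qed.

(** H is diagonal on coordinate vectors, and only the pairs of some e_j with some w e_k have an
    imaginary part. There the factors [er j] and [sw w] in [lb] cancel the signs of H and of Im
    w. *)
Lemma formE_lb i j : formE (lb i) (lb j) =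
  (block_mx 0 1%:M (- 1%:M) 0 : 'M[R]_(6 + 6)) i j.
Proof.
have dd (a b : 'I_6) : hform (delta_mx 0 a : C6) (delta_mx 0 b) = sgn6 R a * (a == b)%:R.
  by rewrite hform_delta mxE eqxx.
have ca (a : R) : (a%:C%C : C)^* = a%:C%C by apply: conjc_real.
have rn (n : nat) : (n%:R : C) = (n%:R : R)%:C%C by exact: (esym (rmorph_nat (real_complex R) n)).
have Ereal (r : R) : complex.Im r%:C%C = 0 by [].
rewrite /formE; case: (split_ordP i) => i' ->; case: (split_ordP j) => j' ->.
- by rewrite !lb_l dd block_mxEul mxE sgn6E rn -rmorphM Ereal mulr0.
- rewrite lb_l lb_r hformZr dd block_mxEur !mxE sgn6E rn.
  have -> : (sw w * er j')%:C%C * w * ((er i')%:C%C * (i' == j')%:R%:C%C) =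
     (sw w * er j' * er i' * (i' == j')%:R)%:C%C * w by rewrite !rmorphM /=; ring.
  rewrite Im_rM mulrCA -/(sw w); case: eqP => [->|_]; last by rewrite mulr0 mul0r.
  rewrite /=; transitivity (er j' * er j' * (sw w * sw w)); first by ring.
  by rewrite er_sq (sw_sq w_prim) mul1r.
- rewrite lb_l lb_r hformZl dd block_mxEdl !mxE sgn6E rn rmorphM /= ca (w_conj w_prim).
  have -> : (sw w * er i')%:C%C * (-1 - w) * ((er i')%:C%C * (i' == j')%:R%:C%C) =
     (- (sw w * er i' * er i' * (i' == j')%:R))%:C%C + 
     (- (sw w * er i' * er i' * (i' == j')%:R))%:C%C * w by rewrite !(rmorphM, rmorphN) /=; ring.
  rewrite raddfD /= Im_rM add0r mulrCA -/(sw w) mulNr; congr (- _).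
  case: eqP => _; last by rewrite mulr0 mul0r.
  by rewrite mulr1 -mulrA er_sq mulr1 (sw_sq w_prim).
- rewrite !lb_r hformZl hformZr dd block_mxEdr mxE sgn6E rn rmorphM /= ca.
  have -> (a e f g : C) : a * w^* * (e * w * (f * g)) = a * e * f * g * (w^* * w) by ring.
  by rewrite (w_conjM w_prim) mulr1 -!rmorphM Ereal mulr0.
Qed.

Lemma weil_torus_ppav : @is_ppav R X (@formE R) 6.
Proof.
split; [exact: weil_torus_complex|exact: formE_polarization|].
by exists lb; [exact: lattice_basis_lb|apply/matrixP => i j; rewrite mxE formE_lb].
Qed.

(** The basis dual to [lb] for E', read off the symplectic matrix; it consists of lattice vectors
    again. *)
Definition lbs (i : 'I_(6 + 6)) : V :=
  match fintype.split i with inl j => lb (rshift 6 j) | inr j => - lb (lshift 6 j) end.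

Lemma lbs_l j : lbs (lshift 6 j) = lb (rshift 6 j).
Proof. by rewrite /lbs -[lshift 6 j]/(unsplit (inl j)) unsplitK. Qed.
Lemma lbs_r j : lbs (rshift 6 j) = - lb (lshift 6 j).
Proof. by rewrite /lbs -[rshift 6 j]/(unsplit (inr j)) unsplitK. Qed.

Lemma tL_lbs i : tL (lbs i).
Proof.
rewrite /lbs; case: (fintype.split i) => j; first exact: tL_lb.
apply/latticeP => k; exists (- (k == lshift 6 j)%:R).
have := lc_linear k (-1) (lb (lshift 6 j)) 0; rewrite scaleN1r addr0 => ->.
have -> : lc k 0 = 0.
  by apply: (addrI (1 * lc k 0)); rewrite -lc_linear scaler0 !addr0 mul1r.
by rewrite lc_lb addr0 rmorphN rmorph_nat mulN1r.
Qed.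

Lemma formE_lbs i j : formE (lb i) (lbs j) = (i == j)%:R.
Proof.
case: (split_ordP j) => j' ->.
  rewrite lbs_l formE_lb.
  case: (split_ordP i) => i' ->; rewrite ?block_mxEur ?block_mxEdr mxE.
    by rewrite (inj_eq (@lshift_inj _ _)).
  by rewrite eq_rlshift.
have EN u v : formE u (- v : C6) = - formE u v.
  by rewrite /formE -scaleN1r hformZr mulN1r raddfN mulrN.
rewrite lbs_r EN formE_lb; case: (split_ordP i) => i' ->; rewrite ?block_mxEul ?block_mxEdl !mxE.
  by rewrite eq_lrshift oppr0.
by rewrite opprK (inj_eq (@rshift_inj _ _)).
Qed.

Definition H3_polarization :=
  Qform_polarization tJ_linear tJJ lb_lc lc_elin lc_lb tL_lb
    (fun v => (latticeP v).1) formE_polarization tL_lbs formE_lbs.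

End WeilTorus.

(** * The action of Q(w) on the torus *)

Section WeilType.
Variables (R : realType) (w : R[i]).
Local Notation C := R[i].
Local Notation C6 := 'rV[R[i]]_6.
Hypothesis w_prim : 3.-primitive_root w.
Variables (Vp : {vspace C6}) (dim_Vp : \dim Vp = 3%N).
Hypothesis Vp_gt0 : forall v, v \in Vp -> v != 0 -> 0 < hform v v.
Local Notation X := (weil_torus w Vp).
Local Notation V := (tV X).

(** A basis of [Vp] followed by one of its orthogonal diagonalizes [J]. It serves for the Weil type,
    for the determinant of 1 + J and for the Hodge numbers. *)
Lemma adapted_basis : exists (u : 'I_(3 + 3) -> C6) (y : 'I_(3 + 3) -> C6 -> C),
  [/\ forall x, x = \sum_i y i x *: u i,
      forall i a x x', y i (a *: x + x') = a * y i x + y i x',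
      forall i j, y i (u j) = (i == j)%:R,
      forall i : 'I_3, u (lshift 3 i) \in Vp
    & forall i : 'I_3, u (rshift 3 i) \in hperp Vp].
Proof.
pose s := vbasis Vp ++ vbasis (hperp Vp).
have s6 : size s == (3 + 3)%N.
  by rewrite size_cat !size_tuple dim_Vp (dim_hperp dim_Vp Vp_gt0).
pose t := Tuple s6.
have dir : directv (Vp + hperp Vp).
  by rewrite directv_addE !directvE /= !eqxx (capv_hperp Vp_gt0) eqxx.
have bt : basis_of fullv t.
  rewrite -(addv_hperp dim_Vp Vp_gt0).
  exact: (cat_basis dir (vbasisP _) (vbasisP _)).
exists (fun i => t`_i), (fun i x => coord t i x); split.
- by move=> x; apply: (coord_basis bt (memvf x)).
- by move=> i a x x'; exact: linearP.
- by move=> i j; rewrite (coord_free _ _ (basis_free bt)) eq_sym.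
- move=> i; have lt : (i < \dim Vp)%N by rewrite dim_Vp.
  rewrite /t /= /s nth_cat size_tuple lt.
  by apply/vbasis_mem/mem_nth; rewrite size_tuple.
- move=> i; have lt : (3 + i < \dim Vp)%N = false by rewrite dim_Vp ltnNge leq_addr.
  have e : (3 + i - \dim Vp)%N = i by rewrite dim_Vp addKn.
  rewrite /t /= /s nth_cat size_tuple lt e.
  by apply/vbasis_mem/mem_nth; rewrite size_tuple (dim_hperp dim_Vp Vp_gt0).
Qed.

Lemma cscale_Vp z (v : V) : (v : C6) \in Vp -> cscale z v = z *: (v : C6).
Proof.
move=> hv; rewrite /cscale /= (Jop_Vp Vp_gt0 hv).
transitivity ((complex.Re z)%:C%C *: (v : C6) + (complex.Im z)%:C%C *: ('i *: (v : C6))) => //.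
by rewrite scalerA -scalerDl [in RHS](complexE z) -complexiE [('i)%C * _]mulrC.
Qed.

(** On the orthogonal of [Vp] the complex structure of the torus is -i, so its scalars act through
    conjugation. This is where the conjugate eigenvalues of the Weil type come from. *)
Lemma cscale_hperp z (v : V) : (v : C6) \in hperp Vp -> cscale z v = z^* *: (v : C6).
Proof.
move=> hv; rewrite /cscale /= (Jop_hperp Vp_gt0 hv).
transitivity ((complex.Re z)%:C%C *: (v : C6) + (complex.Im z)%:C%C *: (- 'i *: (v : C6))) => //.
rewrite scalerA -scalerDl -complexiE; congr (_ *: _); case: z => a b.
by apply/eqP; rewrite eq_complex /=; apply/andP; split; apply/eqP; ring.
Qed.

Lemma eis_Theta (z : C) (v : V) : eis w z -> tL v -> @tL _ X (z *: (v : C6)).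
Proof. by move=> hz hv j; rewrite mxE; apply: eisM. Qed.

Lemma JopZ (U : {vspace C6}) z v : Jop U (z *: v) = z *: Jop U v.
Proof.
have J0 : Jop U 0 = 0.
  by apply: (addrI (1 *: Jop U 0)); rewrite -Jop_linear scaler0 !addr0 scale1r.
by have := Jop_linear U z v 0; rewrite !addr0 J0 addr0.
Qed.

Lemma scale_End (z : C) : eis w z -> @in_End R X (fun v => z *: (v : C6)).
Proof.
move=> hz; split.
- move=> a u v; transitivity (z *: (a%:C%C *: (u : C6) + (v : C6))) => //.
  by rewrite scalerDr scalerA mulrC -scalerA.
- by move=> v; exact: (esym (JopZ Vp z v)).
- by move=> v; apply: eis_Theta.
Qed.

Lemma Theta_automorphism : @is_automorphism R X (fun v => w *: (v : C6)).
Proof.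
have w0 := w_neq0 w_prim.
exists (fun v => w^-1 *: (v : C6)); split.
- exact/scale_End/eisw.
- apply: scale_End; rewrite (w_inv w_prim); apply: eisD; last exact/(eisN w_prim)/eisw.
  exact: (eis_int w (-1)).
- by move=> v; rewrite /= scalerA mulVf // scale1r.
- by move=> v; rewrite /= scalerA mulfV // scale1r.
Qed.

Lemma Theta_order : @has_order R X (fun v => w *: (v : C6)) 3.
Proof.
split=> // m.
have itE (v : V) : iter m (fun v : V => w *: (v : C6) : V) v = w ^+ m *: (v : C6).
  by elim: m => [|m IH]; rewrite ?scale1r // iterS IH scalerA exprS.
have wm : (3 %| m)%N = (w ^+ m == 1) by rewrite (prim_order_dvd w_prim).
split=> [h|]; last first.
  rewrite wm => /eqP w1 v; rewrite itE w1 scale1r.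
  have -> : (v : V) - v = 0 by rewrite subrr.
  by move=> j; rewrite mxE; exists 0, 0; rewrite mul0r addr0.
rewrite wm; apply/negP => /negP w1.
have d0 : w ^+ m - 1 != 0 by rewrite subr_eq0.
(* If w^m were not 1, this vector would be sent by w^m - 1 to half a coordinate vector, and 1/2 is
   not in Z[w]. *)
have /(_ ord0) := h ((2 * (w ^+ m - 1))^-1 *: (delta_mx 0 ord0 : C6)).
rewrite itE.
set v : C6 := _ *: delta_mx _ _.
have -> : (w ^+ m *: v - v : V) = (w ^+ m - 1) *: v :> C6.
  by transitivity (w ^+ m *: v - v : C6) => //; rewrite scalerBl scale1r.
rewrite /v scalerA !mxE !eqxx mulr1 => hz.
have : eis w 2^-1.
  suff <- : (w ^+ m - 1) * (2 * (w ^+ m - 1))^-1 = 2^-1 by [].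
  by field.
move/(eisP w_prim) => [[k hk] _].
have : cx w 2^-1 = 2^-1.
  have -> : (2^-1 : C) = (2^-1)%:C%C + 0%:C%C * w.
    by rewrite rmorph0 mul0r addr0 fmorphV rmorph_nat.
  exact: cx_eq.
rewrite hk => /(congr1 (fun x => x * 2)); rewrite mulVf ?pnatr_eq0 // => h2.
have : (k * 2)%:~R = 1%:~R :> R by rewrite rmorphM /= h2.
move/eqP; rewrite eqr_int => /eqP; lia.
Qed.

Lemma Qadjoin_eis (z : C) : Qadjoin w z ->
  exists2 m : nat, (0 < m)%N & eis w (m%:R * z).
Proof.
case=> a [b ->].
exists (`|denq a| * `|denq b|)%N; first by rewrite muln_gt0 !absz_gt0 !denq_neq0.
have E (r : rat) : (`|denq r|%N%:R : C) * ratr r = (numq r)%:~R.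
  have -> : (`|denq r|%N%:R : C) = (denq r)%:~R by rewrite -[in RHS](gez0_abs (denq_ge0 r)).
  by rewrite /ratr mulrC mulfVK // intr_eq0 denq_neq0.
exists (numq a * `|denq b|%N%:Z), (numq b * `|denq a|%N%:Z).
rewrite natrM !intrM -!E -!pmulrn; ring.
Qed.

Lemma ratw_free (a b : rat) : ratr a + ratr b * w = 0 :> C -> a = 0 /\ b = 0.
Proof.
have E (r : rat) : (ratr r : C) = (ratr r : R)%:C%C by rewrite -(fmorph_rat (real_complex R)).
rewrite !E => h.
have := cx_eq w_prim (ratr a) (ratr b); have := cy_eq w_prim (ratr a) (ratr b).
have z0 : 0 = 0%:C%C + 0%:C%C * w by rewrite !rmorph0 mul0r addr0.
have := cx_eq w_prim 0 0; have := cy_eq w_prim 0 0; rewrite -z0 => c0 d0.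
rewrite h c0 d0 => /esym/eqP hb /esym/eqP ha.
by move: ha hb; rewrite !fmorph_eq0 => /eqP -> /eqP ->.
Qed.

Lemma Qadjoin_quadratic : is_imag_quadratic (Qadjoin w).
Proof.
have b0 := Im_w_neq0 w_prim.
have Kr (r : rat) : Qadjoin w (ratr r) by exists r, 0; rewrite rmorph0 mul0r addr0.
have KM x y : Qadjoin w x -> Qadjoin w y -> Qadjoin w (x * y).
  move=> [a [b ->]] [c [d ->]]; exists (a * c - b * d), (a * d + b * c - b * d).
  by rewrite !(rmorphD, rmorphN, rmorphM) /=; ring: (w_sq w_prim).
have indep := ratw_free.
split.
- split; first by have := Kr 1; rewrite rmorph1.
  move=> x y [a [b ->]] [c [d ->]]; exists (a - c), (b - d); rewrite !rmorphB /=; ring.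
- split => // x [a [b ->]].
  have [->|x0] := eqVneq (ratr a + ratr b * w) 0; first by rewrite invr0; have := Kr 0; rewrite
    rmorph0.
  (* The norm of a + b w, whose conjugate is (a - b) - b w. *)
  pose N := a ^+ 2 - a * b + b ^+ 2.
  have NE : (ratr a + ratr b * w) * (ratr (a - b) + ratr (- b) * w) = ratr N :> C.
    by rewrite /N !(rmorphD, rmorphN, rmorphM, rmorphXn) /=; ring: (w_sq w_prim).
  have N0 : ratr N != 0 :> C.
    rewrite -NE mulf_eq0 negb_or x0 /=; apply/eqP => /indep [h1 h2].
    have bz : b = 0 by apply: oppr_inj; rewrite h2 oppr0.
    have az : a = 0 by move: h1; rewrite bz subr0.
    by move: x0; rewrite az bz rmorph0 mul0r addr0 eqxx.
  have -> : (ratr a + ratr b * w)^-1 = ratr (N^-1) * (ratr (a - b) + ratr (- b) * w).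
    apply: (mulfI x0); rewrite mulfV // mulrCA NE fmorphV mulVf //.
  by apply: KM => //; exists (a - b), (- b).
- exists (fun i : 'I_2 => if i == 0 then 1 else w); split.
  + split; first by have := Kr 0; rewrite rmorph0.
    move=> a x y [c [d ->]] [c' [d' ->]]; exists (a * c + c'), (a * d + d').
    rewrite /GRing.scale /= !rmorphD !rmorphM /=; ring.
  + move=> i; case: ifP => _; first by have := Kr 1; rewrite rmorph1.
    by exists 0, 1; rewrite rmorph0 rmorph1 mul1r add0r.
  + move=> _ [a [b ->]]; exists (fun i : 'I_2 => if i == 0 then a else b).
    by rewrite !big_ord_recl big_ord0 /= addr0 /GRing.scale /= mulr1.
  + move=> c; rewrite !big_ord_recl big_ord0 /= addr0 /GRing.scale /= mulr1 => /indep [h0 h1].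
    move=> i; have : (i == ord0) || (i == lift ord0 ord0) by case: i => [[|[|//]]].
    by case/orP => /eqP ->.
- exists w; first by exists 0, 1; rewrite rmorph0 rmorph1 mul1r add0r.
  apply/negP => /complex_realP [k hk]; move: b0; by rewrite hk /= eqxx.
Qed.

Lemma weil_type : @is_weil_type R X 3 (Qadjoin w) (fun k v => k *: (v : C6)).
Proof.
split.
- split; first exact: weil_torus_complex.
  by exists (@formE R); apply: formE_polarization.
- exact: Qadjoin_quadratic.
- move=> k /Qadjoin_eis [m m0 hm]; exists m => //.
  have -> : (fun v : V => (k *: (v : C6) : V) *+ m) = (fun v : V => (m%:R * k) *: (v : C6)).
    apply/funext => v; transitivity ((k *: (v : C6)) *+ m); first by elim: m {m0 hm} => // m
      IH; rewrite !mulrS IH.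
    by rewrite -scaler_nat scalerA.
  exact: scale_End.
- split.
  + by move=> v; rewrite scale1r.
  + by move=> x y v _ _; rewrite scalerDl.
  + by move=> x y v _ _; rewrite scalerA.
  + move=> x y _ _ /(_ (delta_mx 0 ord0 : C6)) /(congr1 (fun v : C6 => v 0 ord0)).
    by rewrite !mxE !eqxx !mulr1.
- move=> k _; have [u [y [uy ylin yu uV uW]]] := adapted_basis.
  have conjK2 (z : C) : z^*^* = z by exact: conjCK.
  (* [d i] translates scalars of the tangent space into scalars of C^6: the identity on [Vp],
     conjugation on its orthogonal. Being an involution, it carries the coordinates [y] to unique
     coordinates in the tangent space. *)
  pose d (i : 'I_(3 + 3)) (z : C) := if fintype.split i is inl _ then z else z^*.
  have dK i z : d i (d i z) = z by rewrite /d; case: (fintype.split i) => // _; apply: conjK2.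
  have csE i z : @cscale R X z (u i) = d i z *: u i.
    rewrite /d; case: (split_ordP i) => j ->.
      by apply: cscale_Vp; apply: uV.
    by apply: cscale_hperp; apply: uW.
  have sumE (c : 'I_(3 + 3) -> C) : (\sum_i @cscale R X (c i) (u i) : V) = \sum_i d i (c i) *:
    u i :> C6.
    by apply: eq_bigr => i _; rewrite csE.
  exists u.
    move=> v; exists [ffun i => d i (y i v)]; split.
      rewrite sumE {1}(uy v); apply: eq_bigr => i _; by rewrite ffunE dK.
    move=> c; rewrite sumE => vE; apply/ffunP => i; rewrite ffunE vE.
    have y0 : y i 0 = 0 by apply: (addrI (1 * y i 0)); rewrite -ylin scaler0 !addr0 mul1r.
    have -> : y i (\sum_j d j (c j) *: u j) = \sum_j d j (c j) * y i (u j).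
      by elim/big_rec2: _ => [|j a b _ <-].
    rewrite (bigD1 i) //= yu eqxx mulr1 big1 ?addr0 ?dK // => j /negPf ji.
    by rewrite yu eq_sym ji mulr0.
  by move=> i; rewrite cscale_Vp ?uV // cscale_hperp ?uW // conjK2.
Qed.

End WeilType.

(** * The star operator between trilinear and antitrilinear forms *)

Section Det6.
Variable R : realType.
Local Notation C := R[i].
Local Notation C6 := 'rV[R[i]]_6.

Definition row6 (T : Type) (a b c x y z : T) (i : nat) : T :=
  match i with 0 => a | 1 => b | 2 => c | 3 => x | 4 => y | _ => z end%N.

Definition det6 (a b c x y z : C6) : C :=
  \det (\matrix_(i < 6) row6 a b c x y z i).

Lemma det6_swap (r r' : nat -> C6) (i j : 'I_6) : i != j -> r' i = r j -> r' j = r i ->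
  (forall k : 'I_6, k != i -> k != j -> r' k = r k) ->
  \det (\matrix_(k < 6) r' k) = - \det (\matrix_(k < 6) r k).
Proof.
move=> ij hi hj hk; have -> : \matrix_(k < 6) r' k = xrow i j (\matrix_(k < 6) r k).
  apply/matrixP => k l; rewrite !mxE.
  by case: tpermP => [->|->|/eqP ki /eqP kj]; rewrite ?hi ?hj // hk.
by rewrite xrowE det_mulmx /tperm_mx det_perm odd_tperm ij expr1 mulN1r.
Qed.

Lemma det6_lin (r r1 r2 : nat -> C6) (i : 'I_6) a : r i = a *: r1 i + r2 i ->
  (forall k : 'I_6, k != i -> r1 k = r k) -> (forall k : 'I_6, k != i -> r2 k = r k) ->
  \det (\matrix_(k < 6) r k) = a * \det (\matrix_(k < 6) r1 k) + \det (\matrix_(k < 6) r2 k).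
Proof.
move=> hi h1 h2; rewrite -[X in _ + X]mul1r; apply: (@determinant_multilinear _ _ _ _ _ i).
- by rewrite !rowK scale1r.
- by apply/matrixP => k l; rewrite !mxE h1 // eq_sym neq_lift.
- by apply/matrixP => k l; rewrite !mxE h2 // eq_sym neq_lift.
Qed.

Lemma alt3_det6l x y z : alt3 (idR C) (fun a b c => det6 a b c x y z).
Proof.
split.
- move=> b c r a a'; apply: (@det6_lin _ _ _ (inord 0)); rewrite ?inordK //.
    by move=> k; rewrite -val_eqE /= inordK //; case: k => [[|[|[|[|[|[|//]]]]]] h].
  by move=> k; rewrite -val_eqE /= inordK //; case: k => [[|[|[|[|[|[|//]]]]]] h].
- move=> a b c; apply: (@det6_swap _ _ (inord 0) (inord 1)); rewrite -?val_eqE /= ?inordK //.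
  by move=> k; rewrite -!val_eqE /= ?inordK //; case: k => [[|[|[|[|[|[|//]]]]]] h].
- move=> a b c; apply: (@det6_swap _ _ (inord 1) (inord 2)); rewrite -?val_eqE /= ?inordK //.
  by move=> k; rewrite -!val_eqE /= ?inordK //; case: k => [[|[|[|[|[|[|//]]]]]] h].
Qed.

Lemma alt3_det6r a b c : alt3 (idR C) (det6 a b c).
Proof.
split.
- move=> y z r x x'; apply: (@det6_lin _ _ _ (inord 3)); rewrite ?inordK //.
    by move=> k; rewrite -val_eqE /= inordK //; case: k => [[|[|[|[|[|[|//]]]]]] h].
  by move=> k; rewrite -val_eqE /= inordK //; case: k => [[|[|[|[|[|[|//]]]]]] h].
- move=> x y z; apply: (@det6_swap _ _ (inord 3) (inord 4)); rewrite -?val_eqE /= ?inordK //.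
  by move=> k; rewrite -!val_eqE /= ?inordK //; case: k => [[|[|[|[|[|[|//]]]]]] h].
- move=> x y z; apply: (@det6_swap _ _ (inord 4) (inord 5)); rewrite -?val_eqE /= ?inordK //.
  by move=> k; rewrite -!val_eqE /= ?inordK //; case: k => [[|[|[|[|[|[|//]]]]]] h].
Qed.

(** Three transpositions exchange the blocks. This is the sign (-1)^9 in the square of the star
    operator. *)
Lemma det6_block a b c x y z : det6 x y z a b c = - det6 a b c x y z.
Proof.
rewrite /det6 (@det6_swap (row6 a y z x b c) (row6 x y z a b c) (inord 0) (inord 3));
  rewrite -?val_eqE /= ?inordK //; last first.
  by move=> k; rewrite -!val_eqE /= ?inordK //; case: k => [[|[|[|[|[|[|//]]]]]] h].
rewrite (@det6_swap (row6 a b z x y c) (row6 a y z x b c) (inord 1) (inord 4));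
  rewrite -?val_eqE /= ?inordK //; last first.
  by move=> k; rewrite -!val_eqE /= ?inordK //; case: k => [[|[|[|[|[|[|//]]]]]] h].
rewrite (@det6_swap (row6 a b c x y z) (row6 a b z x y c) (inord 2) (inord 5));
  rewrite -?val_eqE /= ?inordK //; last first.
  by move=> k; rewrite -!val_eqE /= ?inordK //; case: k => [[|[|[|[|[|[|//]]]]]] h].
by rewrite opprK.
Qed.

Lemma det6_mul (M : 'M[C]_6) a b c x y z :
  det6 (a *m M) (b *m M) (c *m M) (x *m M) (y *m M) (z *m M) = \det M * det6 a b c x y z.
Proof.
rewrite mulrC /det6 -det_mulmx; congr (\det _); apply/row_matrixP => k.
by rewrite row_mul !rowK; case: k => [[|[|[|[|[|[|//]]]]]] h].
Qed.

Local Notation ee j := (delta_mx 0 j : C6).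

(** A permutation matrix satisfies A A^T = 1. The star operator is only ever squared, so the sign of
    the permutation itself need not be computed. *)
Lemma det6_sq (k : nat -> 'I_6) :
  (forall i j : 'I_6, k i = k j -> i = j) ->
  det6 (ee (k 0)) (ee (k 1)) (ee (k 2)) (ee (k 3)) (ee (k 4)) (ee (k 5)) ^+ 2 = 1.
Proof.
move=> kinj; rewrite /det6 expr2; set A := \matrix_i _.
rewrite -{2}(det_tr A) -det_mulmx -(det1 _ 6); congr (\det _).
have AE i j : A i j = (k i == j)%:R.
  have : row i A = ee (k i).
    by rewrite rowK; case: i => [[|[|[|[|[|[|//]]]]]] h].
  by move/rowP/(_ j); rewrite !mxE eqxx /= eq_sym.
clearbody A; apply/matrixP => i j; rewrite !mxE (bigD1 (k i)) //= mxE !AE eqxx mul1r big1 ?addr0.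
  by rewrite eq_sym; congr (_%:R); congr nat_of_bool; apply/eqP/eqP => [/kinj|->].
by move=> l /negPf li; rewrite mxE AE eq_sym li mul0r.
Qed.

End Det6.

(** * Complementary triples of indices *)

Section ComplementTriples.

Definition disj3 (i j k l m n : nat) : bool :=
  all (fun x => x \notin [:: l; m; n]) [:: i; j; k].
Definition compl3 (i j k : nat) : seq nat := [seq x <- iota 0 6 | x \notin [:: i; j; k]].
Definition small (i : nat) : bool := (i < 3)%N.

(** Quantification over the six indices as a boolean test on natural numbers, which [vm_compute]
    decides. *)
Definition all6 (P : nat -> bool) := all P (iota 0 6).
Lemma all6P P : all6 P -> forall i, (i < 6)%N -> P i.
Proof. by move=> /allP h i i6; apply: h; rewrite mem_iota. Qed.

Lemma compl3_check : all6 (fun i => all6 (fun j => all6 (fun k =>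
  (i < j < k)%N ==>
    let c := compl3 i j k in
    [&& (nth 0 c 0 < nth 0 c 1)%N, (nth 0 c 1 < nth 0 c 2 < 6)%N,
        disj3 i j k (nth 0 c 0) (nth 0 c 1) (nth 0 c 2) &
        odd (small i + small j + small k + small (nth 0 c 0) + small (nth 0 c 1)
             + small (nth 0 c 2))]))).
Proof. by vm_compute. Qed.

Lemma compl3_uniq : all6 (fun i => all6 (fun j => all6 (fun k =>
  if (i < j < k)%N then
    all6 (fun l => all6 (fun m => all6 (fun n =>
      if (l < m < n)%N && disj3 i j k l m n then compl3 i j k == [:: l; m; n] else true)))
  else true))).
Proof. by vm_compute. Qed.

Definition disjt (s t : triple 6) : bool :=
  disj3 (tr0 s) (tr1 s) (tr2 s) (tr0 t) (tr1 t) (tr2 t).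

Lemma disjtC s t : disjt s t = disjt t s.
Proof.
rewrite /disjt /disj3 /= !inE.
have E (x y : nat) : (x == y) = (y == x) := eq_sym x y.
rewrite (E (tr0 t) (tr0 s)) (E (tr0 t) (tr1 s)) (E (tr0 t) (tr2 s)).
rewrite (E (tr1 t) (tr0 s)) (E (tr1 t) (tr1 s)) (E (tr1 t) (tr2 s)).
rewrite (E (tr2 t) (tr0 s)) (E (tr2 t) (tr1 s)) (E (tr2 t) (tr2 s)).
move: (_ == _) (_ == _) (_ == _) (_ == _) (_ == _) (_ == _) (_ == _) (_ == _) (_ == _).
by do 9!case.
Qed.

Lemma disjt_uniq s t t' : disjt s t -> disjt s t' -> t = t'.
Proof.
have c (t0 : triple 6) : disjt s t0 ->
    compl3 (tr0 s) (tr1 s) (tr2 s) = [:: tr0 t0 : nat; tr1 t0 : nat; tr2 t0 : nat].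
  move=> hd; have := all6P compl3_uniq (ltn_ord (tr0 s)).
  move=> /all6P/(_ _ (ltn_ord (tr1 s))) /all6P/(_ _ (ltn_ord (tr2 s))).
  have [-> ->] := tripleP s; rewrite /=.
  move=> /all6P/(_ _ (ltn_ord (tr0 t0))) /all6P/(_ _ (ltn_ord (tr1 t0))).
  move=> /all6P/(_ _ (ltn_ord (tr2 t0))).
  have [-> ->] := tripleP t0.
  by rewrite -[disj3 _ _ _ _ _ _]/(disjt s t0) hd => /eqP.
move=> /c h /c; rewrite h => -[/val_inj e0 /val_inj e1 /val_inj e2].
exact: triple_inj.
Qed.

Lemma disjt_ex (s : triple 6) : exists t : triple 6, disjt s t /\
  odd (small (tr0 s) + small (tr1 s) + small (tr2 s) +
       small (tr0 t) + small (tr1 t) + small (tr2 t)).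
Proof.
have := all6P compl3_check (ltn_ord (tr0 s)) => /all6P/(_ _ (ltn_ord (tr1 s)))
     /all6P/(_ _ (ltn_ord (tr2 s))).
have [-> ->] := tripleP s; case/and4P.
set c := compl3 _ _ _ => h0 /andP[h1 h2] hd ho.
have n1 : (nth 0 c 1 < 6)%N by apply: ltn_trans h1 h2.
have n0 : (nth 0 c 0 < 6)%N by apply: ltn_trans h0 n1.
have ok : (nth 0 c 0 < nth 0 c 1)%N && (nth 0 c 1 < nth 0 c 2)%N by rewrite h0 h1.
by exists (exist (fun t : 'I_6 * 'I_6 * 'I_6 => is_true ((t.1.1 < t.1.2)%N && (t.1.2 < t.2)%N))
  (Ordinal n0, Ordinal n1, Ordinal h2) ok).
Qed.

End ComplementTriples.

(** * The star operator in coordinates *)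

Section Star.
Variable R : realType.
Local Notation C := R[i].
Local Notation C6 := 'rV[R[i]]_6.
Local Notation ee j := (delta_mx 0 j : C6).
Local Notation conjc := (Num.conj : {rmorphism C -> C}).
Implicit Types F G : C6 -> C6 -> C6 -> C.

Definition coord6 (j : 'I_6) (x : C6) : C := x 0 j.

Lemma coord6_dec x : x = \sum_j coord6 j x *: ee j.
Proof. exact: row_sum_delta. Qed.
Lemma coord6_ee i j : coord6 i (ee j) = (i == j)%:R.
Proof. by rewrite /coord6 mxE eqxx. Qed.
Lemma coord6_elin (e : {rmorphism C -> C}) i : elin e (e \o coord6 i).
Proof. by move=> r x y; rewrite /= /coord6 !mxE rmorphD rmorphM. Qed.

Definition std (F : C6 -> C6 -> C6 -> C) (t : triple 6) : C :=
  F (ee (tr0 t)) (ee (tr1 t)) (ee (tr2 t)).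

Lemma alt3_ext (e : {rmorphism C -> C}) F G : alt3 e F -> alt3 e G ->
  (forall t, std F t = std G t) -> forall x y z, F x y z = G x y z.
Proof.
move=> aF aG h x y z; apply/eqP; rewrite -subr_eq0 addrC -mulN1r; apply/eqP.
pose Hf x y z := (-1) * G x y z + F x y z.
have aH : alt3 e Hf by apply: alt3_D.
apply: (alt3_eq0_basis coord6_dec aH).
by move=> t; rewrite /Hf -/(std F t) -/(std G t) h mulN1r addNr.
Qed.

Lemma alt3_conj' G : alt3 conjc G -> alt3 (idR C) (fun x y z => (G x y z)^*).
Proof.
have cK (z : C) : z^*^* = z by exact: conjCK.
move=> [l s1 s2]; split.
- by move=> y z r x x'; rewrite l rmorphD rmorphM /= cK.
- by move=> x y z; rewrite s1 rmorphN.
- by move=> x y z; rewrite s2 rmorphN.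
Qed.

(** The coefficients of the linear form H(x, -), antilinear in [x]. In the determinants below, rows
    stand for linear forms. *)
Definition hrow (x : C6) : C6 := \row_j hform x (ee j).

Lemma hrow_lin a x y : hrow (a *: x + y) = a^* *: hrow x + hrow y.
Proof. by apply/rowP => j; rewrite !mxE hformDl hformZl. Qed.

Lemma hrow_ee j : hrow (ee j) = sgn6 R j *: ee j.
Proof. by apply/rowP => k; rewrite !mxE hform_delta mxE eqxx eq_sym. Qed.

Definition Dt (t : triple 6) (x y z : C6) : C :=
  det6 (ee (tr0 t)) (ee (tr1 t)) (ee (tr2 t)) (hrow x) (hrow y) (hrow z).

Lemma alt3_Dt t : alt3 conjc (Dt t).
Proof.
have [l s1 s2] := alt3_det6r (ee (tr0 t)) (ee (tr1 t)) (ee (tr2 t)).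
split; rewrite /Dt.
- by move=> y z r x x'; rewrite hrow_lin l.
- by move=> x y z; rewrite s1.
- by move=> x y z; rewrite s2.
Qed.

(* Up to a factor, tau F (x, y, z) is the wedge product of F with H(x,-), H(y,-) and
   H(z,-) in the one-dimensional space of alternating 6-forms. *)
Definition tau F : C6 -> C6 -> C6 -> C :=
  fun x y z => \sum_(t : triple 6) std F t * Dt t x y z.
(** The counterpart on antitrilinear forms, obtained from [tau] by conjugating source and target. *)
Definition tauB G : C6 -> C6 -> C6 -> C :=
  fun x y z => \sum_(t : triple 6) std G t * (Dt t x y z)^*.

Lemma alt3_tau F : alt3 conjc (tau F).
Proof. by apply: alt3_sum => t; apply: alt3_Dt. Qed.

Lemma tauBE G x y z : tauB G x y z = (tau (fun x y z => (G x y z)^*) x y z)^*.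
Proof.
have cK (c : C) : c^*^* = c by exact: conjCK.
rewrite /tauB /tau rmorph_sum; apply: eq_bigr => t _.
by rewrite rmorphM /= /std cK.
Qed.

Lemma alt3_tauB G : alt3 (idR C) (tauB G).
Proof.
have -> : tauB G = fun x y z => (tau (fun x y z => (G x y z)^*) x y z)^*.
  by do 3 apply/funext => ?; apply: tauBE.
exact/alt3_conj'/alt3_tau.
Qed.

(** The matrix of the star operator in the basis of triples, up to the signs of H: the sign of the
    permutation (t, s) for complementary triples, zero otherwise. *)
Definition NN (t s : triple 6) : C :=
  det6 (ee (tr0 t)) (ee (tr1 t)) (ee (tr2 t)) (ee (tr0 s)) (ee (tr1 s)) (ee (tr2 s)).
Definition sg3 (s : triple 6) : C := sgn6 R (tr0 s) * sgn6 R (tr1 s) * sgn6 R (tr2 s).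

Lemma Dt_ee t s : std (Dt t) s = sg3 s * NN t s.
Proof.
rewrite /std /Dt !hrow_ee.
have a := alt3_det6r (ee (tr0 t)) (ee (tr1 t)) (ee (tr2 t)); have [l _ _] := a.
rewrite (elinZ _ _ (l _ _)) (elinZ _ _ (alt3_lin2 _ _ a)) (elinZ _ _ (alt3_lin3 _ _ a)).
by rewrite /= !mulrA.
Qed.

Lemma NN_block t s : NN s t = - NN t s.
Proof. exact: det6_block. Qed.

Lemma det6_eq0 (r : nat -> C6) (i j : 'I_6) : i != j -> r i = r j ->
  \det (\matrix_(k < 6) r k) = 0.
Proof.
by move=> ij h; apply: (determinant_alternate ij) => k; rewrite !mxE h.
Qed.

Lemma NN_eq0 t s : ~~ disjt t s -> NN t s = 0.
Proof.
have E (i j : nat) (i6 : (i < 6)%N) (j6 : (j < 6)%N) : i != j ->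
    row6 (tr0 t) (tr1 t) (tr2 t) (tr0 s) (tr1 s) (tr2 s) i =
    row6 (tr0 t) (tr1 t) (tr2 t) (tr0 s) (tr1 s) (tr2 s) j :> nat -> NN t s = 0.
  move=> ij /val_inj h.
  apply: (@det6_eq0 (row6 (ee (tr0 t)) (ee (tr1 t)) (ee (tr2 t)) (ee (tr0 s)) (ee (tr1 s)) (ee
    (tr2 s))) (Ordinal i6) (Ordinal j6)) => //.
  have rE k : row6 (ee (tr0 t)) (ee (tr1 t)) (ee (tr2 t)) (ee (tr0 s)) (ee (tr1 s)) (ee (tr2 s)) k
     = ee (row6 (tr0 t) (tr1 t) (tr2 t) (tr0 s) (tr1 s) (tr2 s) k).
    by case: k => [|[|[|[|[|k]]]]].
  by rewrite !rE h.
rewrite /disjt /disj3 /= !inE !negb_and !negbK /= orbF => /or3P[] /or3P[] /eqP h.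
- exact: (E 0 3)%N.
- exact: (E 0 4)%N.
- exact: (E 0 5)%N.
- exact: (E 1 3)%N.
- exact: (E 1 4)%N.
- exact: (E 1 5)%N.
- exact: (E 2 3)%N.
- exact: (E 2 4)%N.
- exact: (E 2 5)%N.
Qed.

Lemma NN_sq t s : disjt t s -> NN t s * NN t s = 1.
Proof.
move=> d; rewrite -expr2.
apply: (@det6_sq R (row6 (tr0 t) (tr1 t) (tr2 t) (tr0 s) (tr1 s) (tr2 s))) => i j.
move/(congr1 val) => h; apply: val_inj; move: h.
have [t1 t2] := tripleP t; have [s1 s2] := tripleP s.
move: d; rewrite /disjt /disj3 /= !inE !negb_or !andbT.
move=> /and3P[/and3P[/eqP a0 /eqP a1 /eqP a2] /and3P[/eqP b0 /eqP b1 /eqP b2] /and3P[/eqP c0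
  /eqP c1 /eqP c2]].
by case: i => [[|[|[|[|[|[|//]]]]]] hi]; case: j => [[|[|[|[|[|[|//]]]]]] hj] //= h;
  exfalso; lia.
Qed.

Lemma sgn6_conj j : (sgn6 R j)^* = sgn6 R j.
Proof. by rewrite /sgn6; case: ifP; rewrite ?rmorphN rmorph1. Qed.

Lemma sg3_conj s : (sg3 s)^* = sg3 s.
Proof. by rewrite /sg3 !rmorphM /= !sgn6_conj. Qed.

Lemma NN_conj t s : (NN t s)^* = NN t s.
Proof.
rewrite /NN /det6 -det_map_mx; congr (\det _); apply/matrixP => i j; rewrite !mxE.
by case: i => [[|[|[|[|[|[|//]]]]]] hi]; rewrite /= mxE rmorph_nat.
Qed.

Lemma sg3_disj t s : odd (small (tr0 s) + small (tr1 s) + small (tr2 s) +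
       small (tr0 t) + small (tr1 t) + small (tr2 t)) -> sg3 s * sg3 t = -1.
Proof.
rewrite /sg3 /sgn6 -!/(small _).
by case: (small _); case: (small _); case: (small _); case: (small _); case: (small _);
  case: (small _) => // _; ring.
Qed.

(** At [s'] only the complement [s] contributes, with coefficient sg3 s sg3 s' NN s' s NN s s'. The
    signs of H multiply to -1, and the exchange of blocks supplies a second -1. *)
Lemma tauK F : alt3 (idR C) F -> forall x y z, tauB (tau F) x y z = F x y z.
Proof.
move=> aF; apply: (alt3_ext (alt3_tauB _) aF) => s'.
have [s [d o]] := disjt_ex s'.
have -> : std (tauB (tau F)) s' = \sum_(s : triple 6) std (tau F) s * (std (Dt s) s')^* by [].
rewrite (bigD1 s) //= big1 ?addr0; last first.
  move=> t ts; rewrite Dt_ee NN_eq0 ?mulr0 ?rmorph0 ?mulr0 //.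
  by apply: contra ts => d'; apply/eqP; apply: (@disjt_uniq s') => //; rewrite disjtC.
have -> : std (tau F) s = \sum_(t : triple 6) std F t * std (Dt t) s by [].
rewrite (bigD1 s') //= big1 ?addr0; last first.
  move=> t ts; rewrite Dt_ee NN_eq0 ?mulr0 //.
  by apply: contra ts => d'; apply/eqP; apply: (@disjt_uniq s); rewrite disjtC.
rewrite !Dt_ee rmorphM /= sg3_conj NN_conj (NN_block s' s).
have E (p q r k : C) : p * (q * r) * (k * - r) = - (p * (k * q) * (r * r)) by ring.
by rewrite E (sg3_disj o) (NN_sq d); ring.
Qed.

Lemma tauBK G : alt3 conjc G -> forall x y z, tau (tauB G) x y z = G x y z.
Proof.
have cK (c : C) : c^*^* = c by exact: conjCK.
move=> aG x y z; apply: (can_inj cK).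
rewrite -[RHS](tauK (alt3_conj' aG)) tauBE; congr (_^*).
rewrite /tau; apply: eq_bigr => t _; congr (_ * _).
by rewrite /std tauBE.
Qed.

Section Equivariance.
Variable M : 'M[C]_6.
Hypothesis M_hform : forall x y, hform (x *m M) (y *m M) = 2 * hform x y.
Hypothesis det_M : \det M = 8.

(** On coefficient rows, [M^T] is the pullback of linear forms along [M], and [M] scales H by 2. *)
Lemma hrow_M x : hrow (x *m M) *m M^T = 2 *: hrow x.
Proof.
apply/rowP => j; rewrite !mxE -M_hform.
have -> : ee j *m M = \sum_i M j i *: ee i.
  by rewrite -rowE [LHS]row_sum_delta; apply: eq_bigr => i _; rewrite mxE.
rewrite (big_morph (hform (x *m M)) (hformDr _) (hform0r _)).
by apply: eq_bigr => i _; rewrite hformZr !mxE mulrC.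
Qed.

(* M scales H by 2 and the 6-forms by det M = 8 = 2^3, so the factors cancel; this is
   where dim V_+ = dim V_- matters. *)
Lemma tau_equiv F : alt3 (idR C) F -> forall x y z,
  tau F (x *m M) (y *m M) (z *m M) = tau (fun x y z => F (x *m M) (y *m M) (z *m M)) x y z.
Proof.
move=> aF x y z; apply: (mulfI (x := 8)); first by rewrite pnatr_eq0.
have cb := coord6_ee; have cl := coord6_elin (idR C).
transitivity (8 * \sum_(t : triple 6) std F t *
   det6 (ee (tr0 t) *m M^T) (ee (tr1 t) *m M^T) (ee (tr2 t) *m M^T) (hrow x) (hrow y) (hrow z)).
  rewrite /tau !mulr_sumr; apply: eq_bigr => t _.
  rewrite mulrCA [in RHS]mulrCA; congr (_ * _).
  rewrite -[8 in LHS]det_M -det_tr /Dt -det6_mul !hrow_M.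
  have a := alt3_det6r (ee (tr0 t) *m M^T) (ee (tr1 t) *m M^T) (ee (tr2 t) *m M^T).
  have [l _ _] := a.
  rewrite (elinZ _ _ (l _ _)) (elinZ _ _ (alt3_lin2 _ _ a)) (elinZ _ _ (alt3_lin3 _ _ a)) /=.
  ring.
congr (8 * _).
(* Expansion in the first three slots produces the 3 by 3 minors of [M^T] with rows [t] and columns
   [s]. They are the minors of [M] with rows [s] and columns [t], by which [F] expands along [M]. *)
have D a b c : det6 a b c (hrow x) (hrow y) (hrow z) =
    \sum_(s : triple 6) Dt s x y z * cowedge (idR C) coord6 s a b c.
  exact: (alt3_basis coord6_dec cl cb (alt3_det6l (hrow x) (hrow y) (hrow z))).
under eq_bigr => t _ do rewrite D mulr_sumr.
rewrite exchange_big /=; apply: eq_bigr => s _.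
rewrite [in RHS]/std (alt3_basis coord6_dec cl cb aF) mulr_suml; apply: eq_bigr => t _.
rewrite -/(std F t) -[RHS]mulrA; congr (_ * _); rewrite mulrC; congr (_ * _).
rewrite /cowedge /wedge3 /= /coord6 -!rowE !mxE; ring.
Qed.

Lemma tauB_equiv G : alt3 conjc G -> forall x y z,
  tauB G (x *m M) (y *m M) (z *m M) = tauB (fun x y z => G (x *m M) (y *m M) (z *m M)) x y z.
Proof. by move=> aG x y z; rewrite !tauBE (tau_equiv (alt3_conj' aG)). Qed.

End Equivariance.
End Star.

(** * The Theta-invariant forms *)

Section ThetaInvariants.
Variables (R : realType) (w : R[i]).
Local Notation C := R[i].
Local Notation C6 := 'rV[R[i]]_6.
Local Notation conjc := (Num.conj : {rmorphism C -> C}).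
Hypothesis w_prim : 3.-primitive_root w.
Variables (Vp : {vspace C6}) (dim_Vp : \dim Vp = 3%N).
Hypothesis Vp_gt0 : forall v, v \in Vp -> v != 0 -> 0 < hform v v.
Local Notation X := (weil_torus w Vp).
Local Notation V := (tV X).
Local Notation eR := (real_complex R).
Local Notation Form := (('I_3 -> V) -> C).
Implicit Types (f g : Form) (F G : C6 -> C6 -> C6 -> C).

Definition Theta (v : V) : V := w *: (v : C6).
Definition WC : set Form := [set f | is_altform f /\ pullback Theta f = f].

Definition wb : C := -1 - w.
(** With L the action of [w] on the first slot, kk (L - wb) and kk (w - L) are the projectors onto
    the eigenspaces of L for [w] and [wb]. *)
Definition kk : C := (w - wb)^-1.

Let w2 : w ^+ 2 = -1 - w := w_sq w_prim.

Lemma w_wb : w - wb != 0.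
Proof.
have b0 := Im_w_neq0 w_prim; apply/eqP => h; case/eqP: b0.
have : complex.Im (w - wb) = 0 by rewrite h.
by rewrite /wb; case: w => a b /=; lra.
Qed.

Lemma kkE : kk * (w - wb) = 1.
Proof. by rewrite /kk mulVf // w_wb. Qed.

Lemma wb_conj : w^* = wb. Proof. exact: w_conj. Qed.
(** The arguments are typed in C^6 instead of its underlying real space, so that complex scalars
    apply. *)
Definition ternC (f : Form) : C6 -> C6 -> C6 -> C := tern f.

(* The C-trilinear and C-antitrilinear components of a Theta-invariant form. *)
Definition cA f : C6 -> C6 -> C6 -> C :=
  fun x y z => kk * (ternC f (w *: x) y z - wb * ternC f x y z).
Definition cB f : C6 -> C6 -> C6 -> C :=
  fun x y z => kk * (w * ternC f x y z - ternC f (w *: x) y z).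

Lemma cA_lin a f g x y z : cA (a *: f + g) x y z = a * cA f x y z + cA g x y z.
Proof.
have E u v t : ternC (a *: f + g) u v t = a * ternC f u v t + ternC g u v t by [].
rewrite /cA !E; ring.
Qed.
Lemma cB_lin a f g x y z : cB (a *: f + g) x y z = a * cB f x y z + cB g x y z.
Proof.
have E u v t : ternC (a *: f + g) u v t = a * ternC f u v t + ternC g u v t by [].
rewrite /cB !E; ring.
Qed.

Lemma cA0 x y z : cA 0 x y z = 0.
Proof. by rewrite /cA /ternC /tern /=; ring. Qed.
Lemma cB0 x y z : cB 0 x y z = 0.
Proof. by rewrite /cB /ternC /tern /=; ring. Qed.

Lemma cAB f x y z : cA f x y z + cB f x y z = ternC f x y z.
Proof. rewrite -[RHS]mul1r -kkE /cA /cB; ring. Qed.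

Lemma cABf f : f = unt (fun x y z => cA f x y z + cB f x y z).
Proof.
rewrite -[LHS]ternK; congr unt; do 3 apply/funext => ?; exact: (esym (cAB _ _ _ _)).
Qed.

Lemma WC_subspace : is_subspace (idR C) WC.
Proof.
split; first by split; [case: (altform_subspace V)|].
move=> a f g [af hf] [ag hg]; split; first by apply: (altform_subspace V).2.
by have -> : pullback Theta (idR C a *: f + g) = a *: pullback Theta f + pullback Theta g by
  []; rewrite hf hg.
Qed.

Section Slots.
Variable f : Form.
Hypothesis Wf : WC f.
Local Notation F := (ternC f).

Let aF : alt3 eR (tern f). Proof. by apply/altformP; case: Wf. Qed.

Lemma ternC_D1 x x' y z : F (x + x') y z = F x y z + F x' y z.
Proof. by case: aF => l _ _; apply: (elinD _ _ (l _ _)). Qed.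
Lemma ternC_Z1 (r : R) x y z : F (r%:C%C *: x) y z = r%:C%C * F x y z.
Proof. by case: aF => l _ _; exact (elinZ r (x : V) (l (y : V) (z : V))). Qed.
Lemma ternC_s1 x y z : F x y z = - F y x z.
Proof. by case: aF => _ s _; apply: s. Qed.
Lemma ternC_s2 x y z : F x y z = - F x z y.
Proof. by case: aF => _ _ s; apply: s. Qed.
Lemma ternC_w x y z : F (w *: x) (w *: y) (w *: z) = F x y z.
Proof.
have [_ h] := Wf; have := congr1 (fun g : Form => g (tri (x : V) (y : V) (z : V))) h.
by rewrite /pullback tri_comp.
Qed.

Lemma wwE (x : C6) : w *: (w *: x) = (-1)%:C%C *: x + (-1)%:C%C *: (w *: x).
Proof. by rewrite !scalerA -scalerDl -expr2 w2 rmorphN rmorph1 mulN1r. Qed.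

Lemma ternC_ww x y z : F (w *: (w *: x)) y z = - F x y z - F (w *: x) y z.
Proof. by rewrite wwE ternC_D1 !ternC_Z1 rmorphN rmorph1 !mulN1r. Qed.
Lemma ternC_ww2 x y z : F x (w *: (w *: y)) z = - F x y z - F x (w *: y) z.
Proof. by rewrite ternC_s1 ternC_ww 2![F _ x z]ternC_s1; ring. Qed.
Lemma ternC_ww3 x y z : F x y (w *: (w *: z)) = - F x y z - F x y (w *: z).
Proof. by rewrite ternC_s2 ternC_ww2 2![F x _ y]ternC_s2; ring. Qed.

(* With L_i the operator w acting on slot i, L_1 L_2 L_3 = 1 and L_i^2 + L_i + 1 = 0
   force L_1 = L_2 = L_3: the mixed isotypic components vanish. *)
Lemma WC_slot x y z : F (w *: x) y z = F x (w *: y) z.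
Proof.
have w3 (t : C6) : w *: (w *: (w *: t)) = t.
  by rewrite !scalerA -[RHS]scale1r -(prim_expr_order w_prim); congr (_ *: _); ring.
(* Here L_3 = L_1^2 L_2^2 and L_3^2 = L_1 L_2, so L_3^2 + L_3 + 1 = 0 turns into 2 + L_1 + L_2 + 2
   L_1 L_2 = 0. *)
have E1 a b c : 2 * F a b c + F (w *: a) b c + F a (w *: b) c + 2 * F (w *: a) (w *: b) c = 0.
  have h1 : F a b (w *: c) = F (w *: (w *: a)) (w *: (w *: b)) c.
    by rewrite -(ternC_w a b (w *: c)) -(ternC_w (w *: a)) w3.
  have h2 : F a b (w *: (w *: c)) = F (w *: a) (w *: b) c.
    by rewrite -(ternC_w a b (w *: (w *: c))) w3.
  have h3 := ternC_ww3 a b c; rewrite h1 h2 in h3.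
  rewrite ternC_ww !ternC_ww2 in h3.
  transitivity (F (w *: a) (w *: b) c - (- F a b c -
     (- (- F a b c - F a (w *: b) c) - (- F (w *: a) b c - F (w *: a) (w *: b) c)))).
    by ring.
  by rewrite {1}h3 subrr.
(* Multiplying that relation by L_1 and by L_2 and subtracting leaves 3 (L_1 - L_2) = 0. *)
have h1 := E1 (w *: x) y z; have h2 := E1 x (w *: y) z.
rewrite ternC_ww ternC_ww in h1; rewrite !ternC_ww2 in h2.
have h : 3 * (F (w *: x) y z - F x (w *: y) z) = 0.
  rewrite -[RHS](subrr 0) -{1}h1 -h2; ring.
move/eqP: h; rewrite mulf_eq0 pnatr_eq0 /= subr_eq0 => /eqP //.
Qed.

Lemma C_split (r : C) : r = (cx w r)%:C%C + (cy w r)%:C%C * w.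
Proof. exact: cxy. Qed.

(** C = R + R w, so semilinearity is real linearity together with the action of [w]. *)
Lemma elin_from_w (e : {rmorphism C -> C}) (a : C6 -> C) :
  (forall s : R, e s%:C%C = s%:C%C) ->
  (forall x y, a (x + y) = a x + a y) ->
  (forall (s : R) x, a (s%:C%C *: x) = s%:C%C * a x) ->
  (forall x, a (w *: x) = e w * a x) -> elin e a.
Proof.
move=> er aD aZ aw r x y; rewrite aD; congr (_ + _).
move: (cx w r) (cy w r) (C_split r) => p q ->.
rewrite scalerDl -scalerA aD !aZ aw rmorphD rmorphM !er; ring.
Qed.

Lemma scale_swap (a d : C) (x : C6) : a *: (d *: x) = d *: (a *: x).
Proof. by rewrite !scalerA mulrC. Qed.

(** Antisymmetry in the first two slots rests on [WC_slot]: the factor [w] in the definition sits on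
    the first slot and has to move to the second. *)
Lemma cA_alt : alt3 (idR C) (cA f).
Proof.
split.
- move=> y z; apply: elin_from_w => //.
  + by move=> x x'; rewrite /cA scalerDr !ternC_D1; ring.
  + by move=> s x; rewrite /cA (scale_swap w) !ternC_Z1; ring.
  + move=> x; rewrite /cA ternC_ww /wb /=; ring: w2.
- by move=> x y z; rewrite /cA WC_slot (ternC_s1 x (w *: y) z) (ternC_s1 x y z); ring.
- by move=> x y z; rewrite /cA (ternC_s2 (w *: x) y z) (ternC_s2 x y z); ring.
Qed.

Lemma cB_alt : alt3 conjc (cB f).
Proof.
split.
- move=> y z; apply: elin_from_w => //.
  + by move=> s; apply: conjc_real.
  + by move=> x x'; rewrite /cB scalerDr !ternC_D1; ring.
  + by move=> s x; rewrite /cB (scale_swap w) !ternC_Z1; ring.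
  + by move=> x; rewrite /cB ternC_ww /= wb_conj /wb; ring: w2.
- by move=> x y z; rewrite /cB WC_slot (ternC_s1 x (w *: y) z) (ternC_s1 x y z); ring.
- by move=> x y z; rewrite /cB (ternC_s2 (w *: x) y z) (ternC_s2 x y z); ring.
Qed.

End Slots.

Section FromComponents.
Variables F G : C6 -> C6 -> C6 -> C.
Hypothesis (aF : alt3 (idR C) F) (aG : alt3 conjc G).

Definition AB : Form := unt (fun x y z : V => F x y z + G x y z).

Lemma AB_alt : is_altform AB.
Proof.
have cr (s : R) : (s%:C%C : C)^* = s%:C%C by apply: conjc_real.
apply/altformP; have [l s1 s2] := aF; have [l' s1' s2'] := aG; split.
- move=> y z r x x'; rewrite /tern /AB /unt.
  have /= -> := l y z r%:C%C x x'; have /= -> := l' y z r%:C%C x x'.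
  by rewrite cr; ring.
- by move=> x y z; rewrite /tern /AB /unt s1 s1'; ring.
- by move=> x y z; rewrite /tern /AB /unt s2 s2'; ring.
Qed.

Lemma AB_wA x y z : F (w *: x) y z = w * F x y z.
Proof. by have [l _ _] := aF; apply: (elinZ w x (l y z)). Qed.
Lemma AB_wB x y z : G (w *: x) y z = wb * G x y z.
Proof. by have [l _ _] := aG; rewrite -wb_conj; apply: (elinZ w x (l y z)). Qed.

Lemma cA_AB : cA AB = F.
Proof.
do 3 apply/funext => ?; rewrite /cA /ternC /tern /AB /unt /= AB_wA AB_wB.
by rewrite -[RHS]mul1r -kkE; ring.
Qed.
Lemma cB_AB : cB AB = G.
Proof.
do 3 apply/funext => ?; rewrite /cB /ternC /tern /AB /unt /= AB_wA AB_wB.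
by rewrite -[RHS]mul1r -kkE; ring.
Qed.

Lemma AB_WC : WC AB.
Proof.
split; first exact: AB_alt.
apply/funext => v; rewrite /pullback /AB /unt /=.
have [l _ _] := aF; have [l' _ _] := aG.
have w3 := prim_expr_order w_prim.
have -> : F (Theta (v 0)) (Theta (v 1)) (Theta (v 2)) = w ^+ 3 * F (v 0) (v 1) (v 2).
  rewrite (elinZ _ _ (l _ _)) (elinZ _ _ (alt3_lin2 _ _ aF)) (elinZ _ _ (alt3_lin3 _ _ aF)) /=.
  ring.
have -> : G (Theta (v 0)) (Theta (v 1)) (Theta (v 2)) = (w ^+ 3)^* * G (v 0) (v 1) (v 2).
  rewrite (elinZ _ _ (l' _ _)) (elinZ _ _ (alt3_lin2 _ _ aG)) (elinZ _ _ (alt3_lin3 _ _ aG)) /=.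
  rewrite rmorphXn /=; ring.
by rewrite w3 rmorph1 !mul1r.
Qed.

End FromComponents.

Lemma ABK f : AB (cA f) (cB f) = f.
Proof. by rewrite [RHS]cABf. Qed.

Lemma WC_ext f g : cA f = cA g -> cB f = cB g -> f = g.
Proof. by move=> hA hB; rewrite -[f]ABK -[g]ABK hA hB. Qed.

Definition star f : Form := AB (tauB (cB f)) (tau (cA f)).

Lemma star_WC f : WC (star f).
Proof. by apply: AB_WC; [apply: alt3_tauB|apply: alt3_tau]. Qed.

Lemma cA_star f : cA (star f) = tauB (cB f).
Proof. by apply: cA_AB; [apply: alt3_tauB|apply: alt3_tau]. Qed.
Lemma cB_star f : cB (star f) = tau (cA f).
Proof. by apply: cB_AB; [apply: alt3_tauB|apply: alt3_tau]. Qed.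

Lemma starK f : WC f -> star (star f) = f.
Proof.
move=> Wf; apply: WC_ext; rewrite ?cA_star ?cB_star ?cA_star; do 3 apply/funext => ?.
  exact/tauK/cA_alt.
exact/tauBK/cB_alt.
Qed.

Lemma star_lin a f g : star (a *: f + g) = a *: star f + star g.
Proof.
apply/funext => v; transitivity (a * star f v + star g v); last by [].
have eA x y z : tau (cA (a *: f + g)) x y z = a * tau (cA f) x y z + tau (cA g) x y z.
  rewrite /tau mulr_sumr -big_split; apply: eq_bigr => t _ /=.
  by rewrite /std cA_lin; ring.
have eB x y z : tauB (cB (a *: f + g)) x y z = a * tauB (cB f) x y z + tauB (cB g) x y z.
  rewrite /tauB mulr_sumr -big_split; apply: eq_bigr => t _ /=.
  by rewrite /std cB_lin; ring.
rewrite /star /AB /unt eA eB; ring.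
Qed.

Definition oneJC (x : C6) : C6 := x + Jop Vp x.
Definition Mm : 'M[C]_6 := \matrix_i oneJC (delta_mx 0 i).

Lemma oneJC_lin a x y : oneJC (a *: x + y) = a *: oneJC x + oneJC y.
Proof. by rewrite /oneJC Jop_linear [in RHS]scalerDr; exact: addrACA. Qed.

Lemma oneJC_Z a x : oneJC (a *: x) = a *: oneJC x.
Proof. by rewrite /oneJC JopZ [in RHS]scalerDr. Qed.

Lemma MmE x : x *m Mm = oneJC x.
Proof.
have o0 : oneJC 0 = 0.
  by apply: (addrI (1 *: oneJC 0)); rewrite -oneJC_lin scaler0 !addr0 scale1r.
rewrite mulmx_sum_row {2}(row_sum_delta x).
elim/big_rec2: _ => [|i y z _ ->]; first by rewrite o0.
by rewrite rowK oneJC_lin.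
Qed.

(** [J] is an isometry of H with square -1, hence skew for H, and the cross terms cancel. *)
Lemma Mm_hform x y : hform (x *m Mm) (y *m Mm) = 2 * hform x y.
Proof.
have h : hform (Jop Vp x) y = - hform x (Jop Vp y).
  rewrite -(hform_J dim_Vp Vp_gt0) (JopJ dim_Vp Vp_gt0) -scaleN1r hformZl.
  by rewrite rmorphN rmorph1 mulN1r.
rewrite !MmE /oneJC hformDl !(hformDr _ y) (hform_J dim_Vp Vp_gt0) h; ring.
Qed.

(** An adapted basis shows the eigenvalues 1 + i and 1 - i, three times each, with product 2^3. *)
Lemma det_Mm : \det Mm = 8.
Proof.
have [u [y [uy ylin yu uV uW]]] := adapted_basis dim_Vp Vp_gt0.
pose U : 'M[C]_(3 + 3) := \matrix_i u i.
pose Y : 'M[C]_(3 + 3) := \matrix_(i, j) y j (delta_mx 0 i).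
have rU i : row i U = u i by rewrite rowK.
have YU : Y *m U = 1%:M.
  apply/row_matrixP => i; rewrite row_mul row1 mulmx_sum_row.
  by rewrite [RHS]uy; apply: eq_bigr => j _; rewrite rU !mxE.
have U0 : \det U != 0.
  have := congr1 determinant YU; rewrite det_mulmx det1 => h.
  by apply/eqP => U0; move: h; rewrite U0 mulr0 => /esym/eqP; rewrite oner_eq0.
pose d : 'rV[C]_(3 + 3) := \row_i (if (i < 3)%N then 1 + 'i else 1 - 'i).
have UM : U *m (Mm : 'M_(3 + 3)) = diag_mx d *m U.
  apply/row_matrixP => i; rewrite row_mul rU MmE mul_diag_mx.
  have -> : row i (\matrix_(i, j) (d 0 i * U i j)) = d 0 i *: u i.
    by apply/rowP => j; rewrite !mxE.
  rewrite /oneJC mxE.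
  case: (split_ordP i) => j ->.
    by rewrite (Jop_Vp Vp_gt0 (uV j)) scalerDl scale1r.
  by rewrite (Jop_hperp Vp_gt0 (uW j)) scalerDl scale1r.
have : \det U * \det Mm = 8 * \det U.
  rewrite -det_mulmx UM det_mulmx det_diag; congr (_ * _).
  rewrite !big_ord_recl big_ord0 !mxE /=.
  have i2 : 'i ^+ 2 = -1 :> C := sqrCi _.
  rewrite /bump /=; ring: i2.
by rewrite mulrC => /(mulIf U0).
Qed.

Local Notation pb := (@pullback R V 3 (@oneJ R X)).

Lemma cA_pb f : cA (pb f) = fun x y z => cA f (x *m Mm) (y *m Mm) (z *m Mm).
Proof.
do 3 apply/funext => ?; rewrite /cA !MmE.
have E x y z : ternC (pb f) x y z = ternC f (oneJC x) (oneJC y) (oneJC z).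
  by rewrite /ternC /tern /pullback tri_comp.
rewrite !E; congr (kk * (ternC f _ _ _ - _)).
exact: oneJC_Z.
Qed.
Lemma cB_pb f : cB (pb f) = fun x y z => cB f (x *m Mm) (y *m Mm) (z *m Mm).
Proof.
do 3 apply/funext => ?; rewrite /cB !MmE.
have E x y z : ternC (pb f) x y z = ternC f (oneJC x) (oneJC y) (oneJC z).
  by rewrite /ternC /tern /pullback tri_comp.
rewrite !E; congr (kk * (_ - ternC f _ _ _)).
exact: oneJC_Z.
Qed.

Lemma WC_pb f : WC f -> WC (pb f).
Proof.
move=> [af hf]; split; first by apply: altform_pb => //; apply: tJ_linear.
rewrite -[in RHS]hf; apply/funext => v; rewrite /pullback; congr f.
apply/funext => i /=; have := JopZ Vp w (v i) => h.
transitivity (w *: (v i : C6) + Jop Vp (w *: (v i : C6))) => //.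
by rewrite h -scalerDr.
Qed.

Lemma star_pb f : WC f -> star (pb f) = pb (star f).
Proof.
move=> Wf; apply: WC_ext; rewrite ?cA_pb ?cB_pb ?cA_star ?cB_star ?cA_pb ?cB_pb.
  do 3 apply/funext => ?; apply/esym/tauB_equiv; first exact: Mm_hform.
    exact: det_Mm.
  exact: cB_alt.
do 3 apply/funext => ?; apply/esym/tau_equiv; first exact: Mm_hform.
  exact: det_Mm.
exact: cA_alt.
Qed.

(* Multiplication by 2 w + 1, a square root of -3. *)
Definition phi f : Form := unt (fun x y z : V => 2 * tern f (Theta x) y z + tern f x y z).

Lemma cA_phi f : WC f -> cA (phi f) = fun x y z => (w - wb) * cA f x y z.
Proof.
move=> Wf; do 3 apply/funext => ?; rewrite /cA /ternC /tern /phi /unt /=.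
rewrite -!/(tern f _ _ _) -!/(ternC f _ _ _) /Theta (ternC_ww Wf) /wb; ring: w2.
Qed.
Lemma cB_phi f : WC f -> cB (phi f) = fun x y z => - (w - wb) * cB f x y z.
Proof.
move=> Wf; do 3 apply/funext => ?; rewrite /cB /ternC /tern /phi /unt /=.
rewrite -!/(tern f _ _ _) -!/(ternC f _ _ _) /Theta (ternC_ww Wf) /wb; ring: w2.
Qed.

Lemma phi_lin a f g : phi (a *: f + g) = a *: phi f + phi g.
Proof.
apply/funext => v; transitivity (a * phi f v + phi g v); last by [].
have E x y z : tern (a *: f + g) x y z = a * tern f x y z + tern g x y z by [].
rewrite /phi /unt !E; ring.
Qed.

Lemma phi_WC f : WC f -> WC (phi f).
Proof.
move=> Wf; rewrite -[phi f]ABK (cA_phi Wf) (cB_phi Wf); apply: AB_WC.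
  have [l s1 s2] := cA_alt Wf; split=> [y z r x x'|x y z|x y z].
  - rewrite l; ring.
  - rewrite s1; ring.
  - rewrite s2; ring.
have [l s1 s2] := cB_alt Wf; split=> [y z r x x'|x y z|x y z].
- rewrite l; ring.
- rewrite s1; ring.
- rewrite s2; ring.
Qed.

Lemma phi_phi f : WC f -> phi (phi f) = (-3) *: f.
Proof.
move=> Wf; apply: WC_ext.
  rewrite (cA_phi (phi_WC Wf)) (cA_phi Wf); do 3 apply/funext => ?.
  by rewrite -[(-3) *: f]addr0 cA_lin {3}/cA /ternC /tern /wb /=; ring: w2.
rewrite (cB_phi (phi_WC Wf)) (cB_phi Wf); do 3 apply/funext => ?.
by rewrite -[(-3) *: f]addr0 cB_lin {3}/cB /ternC /tern /wb /=; ring: w2.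
Qed.

Lemma phi_pb f : WC f -> phi (pb f) = pb (phi f).
Proof.
move=> Wf; apply: WC_ext.
  by rewrite (cA_phi (WC_pb Wf)) !cA_pb (cA_phi Wf).
by rewrite (cB_phi (WC_pb Wf)) !cB_pb (cB_phi Wf).
Qed.

(** A square root of -3 in Q(w) acts on the trilinear and the antitrilinear part by opposite
    scalars, and the star operator exchanges these parts. *)
Lemma phi_star f : WC f -> star (phi f) = - phi (star f).
Proof.
move=> Wf; have Ws := star_WC f.
rewrite -scaleN1r -[_ *: _]addr0; apply: WC_ext; do 3 apply/funext => ?.
  rewrite cA_star cA_lin (cA_phi Ws) cA_star (cB_phi Wf) cA0 addr0 mulN1r -mulNr.
  by rewrite /tauB mulr_sumr; apply: eq_bigr => t _; rewrite /std [RHS]mulrA.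
rewrite cB_star cB_lin (cB_phi Ws) cB_star (cA_phi Wf) cB0 addr0 mulN1r mulNr opprK.
by rewrite /tau mulr_sumr; apply: eq_bigr => t _; rewrite /std [RHS]mulrA.
Qed.

End ThetaInvariants.

(** * Dimensions and Hodge numbers *)

Section TripleCount.

(* The number p such that the wedge of adapted coordinates y_t has type (p, 3 - p). *)
Definition ptype (t : triple 6) : nat := small (tr0 t) + small (tr1 t) + small (tr2 t).

Lemma ptype_le3 t : (ptype t <= 3)%N.
Proof. by rewrite /ptype; case: small; case: small; case: small. Qed.

Lemma card_triple (P : nat -> nat -> nat -> bool) :
  #|[pred t : triple 6 | P (tr0 t) (tr1 t) (tr2 t)]| =
  (\sum_(0 <= i < 6) \sum_(0 <= j < 6) \sum_(0 <= k < 6 | i < j < k) P i j k)%N.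
Proof.
rewrite -sum1_card big_mkcond /=.
rewrite (eq_bigr (fun t : triple 6 => nat_of_bool (P (tr0 t) (tr1 t) (tr2 t)))); last first.
  by move=> t _; rewrite inE; case: (P _ _ _).
rewrite (big_triple _ (fun i j k : 'I_6 => nat_of_bool (P i j k))).
transitivity (\sum_(i < 6) \sum_(j < 6) \sum_(k < 6 | i < j < k) P i j k)%N; first by [].
rewrite big_mkord.
by apply: eq_bigr => i _; rewrite big_mkord; apply: eq_bigr => j _; rewrite big_mkord.
Qed.

Lemma card_ptype p : #|[pred t : triple 6 | ptype t == p]| = nth 0%N [:: 1; 9; 9; 1]%N p.
Proof.
rewrite (card_triple (fun i j k => small i + small j + small k == p)%N) unlock.
by case: p => [|[|[|[|p]]]] //; rewrite nth_default //=.
Qed.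

Lemma card_triple6 : #|{: triple 6}| = 20%N.
Proof. by rewrite (card_triple (fun _ _ _ => true)) unlock. Qed.

End TripleCount.

Section HasDimPred.
Variables (F K : pzRingType) (e : {rmorphism F -> K}) (M : lmodType K).

(** The bases of Hodge components are indexed by the triples of a given [ptype], a subset of a
    finite type. *)
Lemma has_dim_pred (U : set M) (I : finType) (P : pred I) (b : I -> M) :
  is_subspace e U -> (forall i, P i -> U (b i)) ->
  (forall u, U u -> exists c : I -> F, u = \sum_(i | P i) e (c i) *: b i) ->
  (forall c : I -> F, \sum_(i | P i) e (c i) *: b i = 0 -> forall i, P i -> c i = 0) ->
  has_dim e U #|P|.
Proof.
move=> hU Ub sp ind; rewrite -card_sig.
have E (G : I -> M) : \sum_(i | P i) G i = \sum_(x : {x | P x}) G (val x).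
  rewrite (reindex_omap (val : {x | P x} -> I) insub); last by move=> i h; rewrite insubT.
  by apply: eq_bigl => x; rewrite valK eqxx (valP x).
apply: (has_dim_fin (b := fun x : {x | P x} => b (val x))) => //.
- by move=> x; apply/Ub/(valP x).
- by move=> u /sp [c ->]; exists (fun x => c (val x)); rewrite E.
- move=> c h x.
  pose c' i := if insub i is Some y then c y else 0 : F.
  have := ind c'; rewrite E => h'; have /= := h' _ (val x) (valP x).
  rewrite /c' valK; apply; rewrite -[RHS]h; apply: eq_bigr => y _; by rewrite valK.
Qed.

End HasDimPred.

(** * The rational structure of W *)

Section HodgeOfW.
Variables (R : realType) (w : R[i]).
Local Notation C := R[i].
Local Notation C6 := 'rV[R[i]]_6.
Local Notation conjc := (Num.conj : {rmorphism C -> C}).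
Hypothesis w_prim : 3.-primitive_root w.
Variables (Vp : {vspace C6}) (dim_Vp : \dim Vp = 3%N).
Hypothesis Vp_gt0 : forall v, v \in Vp -> v != 0 -> 0 < hform v v.
Local Notation X := (weil_torus w Vp).
Local Notation V := (tV X).
Local Notation Form := (('I_3 -> V) -> C).
Local Notation H3 := (cohomology X 3).
Local Notation pb := (@pullback R V 3 (@oneJ R X)).
Local Notation WC := (@WC R w Vp).
Local Notation cA := (@cA R w Vp).
Local Notation cB := (@cB R w Vp).
Local Notation wb := (wb w).
Local Notation kk := (kk w).
Local Notation starW := (@star R w Vp).
Local Notation phiW := (@phi R w Vp).
Implicit Types (f g : Form).

Let J_lin := @tJ_linear R w Vp.
Let JJ := @tJJ R w Vp dim_Vp Vp_gt0.
Let bc := @lb_lc R w w_prim Vp.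
Let cl := @lc_elin R w Vp.
Let cb := lc_lb w_prim Vp.
Let Lb := tL_lb w_prim Vp.
Let Li := fun v => (@latticeP R w w_prim Vp v).1.

Let hpq p q f : (p + q = 3)%N -> hcomp H3 p q f <-> is_altform f /\ pb f = lam R p *: f.
Proof. exact: (HpqP J_lin JJ bc cl cb). Qed.

Definition W : set Form := [set f | ratsp H3 f /\ pullback (@Theta R w Vp) f - f = 0].

Lemma W_WC f : W f <-> ratsp H3 f /\ WC f.
Proof.
split=> [[rf /eqP]|[rf [_ hf]]]; first by rewrite subr_eq0 => /eqP hf; split => //; split =>
  //; case: rf.
by split => //; rewrite hf subrr.
Qed.

Lemma ratsp_Q : is_subspace (QtoC R) (ratsp H3).
Proof. exact: ratsp_subspace. Qed.

Lemma cA_sum (I : Type) (s : seq I) (P : pred I) (k : I -> C) (g : I -> Form) x y z :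
  cA (\sum_(i <- s | P i) k i *: g i) x y z = \sum_(i <- s | P i) k i * cA (g i) x y z.
Proof. by elim/big_rec2: _ => [|i a b _ <-]; rewrite ?cA0 ?cA_lin. Qed.
Lemma cB_sum (I : Type) (s : seq I) (P : pred I) (k : I -> C) (g : I -> Form) x y z :
  cB (\sum_(i <- s | P i) k i *: g i) x y z = \sum_(i <- s | P i) k i * cB (g i) x y z.
Proof. by elim/big_rec2: _ => [|i a b _ <-]; rewrite ?cB0 ?cB_lin. Qed.

Section ComplexBasis.
Variables (b : 'I_6 -> C6) (c : 'I_6 -> C6 -> C).
Hypothesis bc6 : forall x, x = \sum_i c i x *: b i.
Hypothesis c_lin6 : forall i a x x', c i (a *: x + x') = a * c i x + c i x'.
Hypothesis cb6 : forall i j, c i (b j) = (i == j)%:R.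

(** The basis is left arbitrary: the standard one, defined over Z[w], exhibits rationality, and an
    adapted one exhibits Hodge types. *)
Definition XA (t : triple 6) : Form := unt (cowedge (idR C) c t).
Definition XB (t : triple 6) : Form := unt (cowedge conjc c t).
Definition at3 (F : C6 -> C6 -> C6 -> C) (t : triple 6) : C :=
  F (b (tr0 t)) (b (tr1 t)) (b (tr2 t)).

Lemma c_elin (e : {rmorphism C -> C}) i : elin e (e \o c i).
Proof. by move=> r x y; rewrite /= c_lin6 rmorphD rmorphM. Qed.

Lemma alt3_cow (e : {rmorphism C -> C}) t : alt3 e (cowedge e c t).
Proof. exact: (alt3_cowedge (c_elin e)). Qed.

Let zA : alt3 (idR C) (fun _ _ _ : C6 => 0 : C) := alt3_0 _ _.
Let zB : alt3 conjc (fun _ _ _ : C6 => 0 : C) := alt3_0 _ _.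

Lemma XA_AB t : XA t = @AB R w Vp (cowedge (idR C) c t) (fun _ _ _ => 0).
Proof. by apply/funext => v; rewrite /XA /AB /unt addr0. Qed.
Lemma XB_AB t : XB t = @AB R w Vp (fun _ _ _ => 0) (cowedge conjc c t).
Proof. by apply/funext => v; rewrite /XB /AB /unt add0r. Qed.

Lemma XA_WC t : WC (XA t).
Proof. by rewrite XA_AB; apply: (AB_WC w_prim Vp (alt3_cow _ t) zB). Qed.
Lemma XB_WC t : WC (XB t).
Proof. by rewrite XB_AB; apply: (AB_WC w_prim Vp zA (alt3_cow _ t)). Qed.

Lemma cA_XA t : cA (XA t) = cowedge (idR C) c t.
Proof. by rewrite XA_AB (cA_AB w_prim Vp (alt3_cow _ t) zB). Qed.
Lemma cB_XA t : cB (XA t) = fun _ _ _ => 0.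
Proof. by rewrite XA_AB (cB_AB w_prim Vp (alt3_cow _ t) zB). Qed.
Lemma cA_XB t : cA (XB t) = fun _ _ _ => 0.
Proof. by rewrite XB_AB (cA_AB w_prim Vp zA (alt3_cow _ t)). Qed.
Lemma cB_XB t : cB (XB t) = cowedge conjc c t.
Proof. by rewrite XB_AB (cB_AB w_prim Vp zA (alt3_cow _ t)). Qed.

Lemma at3_cow (e : {rmorphism C -> C}) t s : at3 (cowedge e c t) s = (t == s)%:R.
Proof. exact: (cowedge_basis e cb6 s t). Qed.

Lemma WC_basis f : WC f ->
  f = \sum_(t : triple 6) at3 (cA f) t *: XA t + \sum_(t : triple 6) at3 (cB f) t *: XB t.
Proof.
move=> Wf; rewrite {1}[f](cABf w_prim); apply/funext => v; rewrite addrfctE !fct_sumE /unt.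
rewrite (alt3_basis bc6 (c_elin (idR C)) cb6 (cA_alt w_prim Wf)).
by rewrite (alt3_basis bc6 (c_elin conjc) cb6 (cB_alt w_prim Wf)).
Qed.

End ComplexBasis.

Local Notation SA := (XA (@coord6 R)).
Local Notation SB := (XB (@coord6 R)).
Local Notation ee j := (delta_mx 0 j : C6).

Let sl i a (x x' : C6) : coord6 i (a *: x + x') = a * coord6 i x + coord6 i x'.
Proof. by rewrite /coord6 !mxE. Qed.
Let sdec := @coord6_dec R.
Let see := @coord6_ee R.

Lemma eis_ee i j : eis w (ee i 0 j).
Proof. by rewrite mxE; case: (_ && _); [exact: (eis_int w 1)|exact: (eis_int w 0)]. Qed.
Lemma eis_wee i j : eis w ((w *: ee i) 0 j).
Proof. by rewrite mxE; apply: (eisM w_prim); [exact: eisw|exact: eis_ee]. Qed.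

Lemma is_rat_trace z : eis w z -> is_rat (z + z^*).
Proof.
move=> [x [y ->]]; exists (2 * x%:~R - y%:~R).
rewrite rmorphD rmorphM /= !rmorph_int (w_conj w_prim) rmorphB rmorphM /= !ratr_int ratr_nat.
ring.
Qed.

Lemma eis_cow t (x y z : C6) : (forall j, eis w (x 0 j)) -> (forall j, eis w (y 0 j)) ->
  (forall j, eis w (z 0 j)) -> eis w (cowedge (idR C) (@coord6 R) t x y z).
Proof.
move=> hx hy hz; rewrite /cowedge /wedge3 /= /coord6.
by do ?[apply: eisD | apply: (eisN w_prim) | apply: (eisM w_prim)].
Qed.

(** The trace from Q(w) to Q of [a] times a basis trilinear form. On lattice vectors that form takes
    values in Z[w], so for [a] in Z[w] the trace is rational there. *)
Definition gen (a : C) (t : triple 6) : Form := a *: SA t + a^* *: SB t.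

Lemma gen_W a t : eis w a -> W (gen a t).
Proof.
move=> ha; have gW : WC (gen a t).
  have hW := WC_subspace w Vp; apply: hW.2; first by apply: XA_WC.
  by apply: (subspaceZ (e := idR C) _ hW); apply: XB_WC.
apply/W_WC; split => //; split; first by case: gW.
move=> v Lv; have E : cowedge conjc (@coord6 R) t (v 0) (v 1) (v 2) =
    (cowedge (idR C) (@coord6 R) t (v 0) (v 1) (v 2))^*.
  by rewrite /cowedge /wedge3 /= !(rmorphD, rmorphN, rmorphM).
have -> : gen a t v = a * cowedge (idR C) (@coord6 R) t (v 0) (v 1) (v 2) +
   (a * cowedge (idR C) (@coord6 R) t (v 0) (v 1) (v 2))^*.
  by rewrite rmorphM /= -E.
apply: is_rat_trace; apply: (eisM w_prim) => //; apply: eis_cow; exact: Lv.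
Qed.

Let WCs := WC_subspace w Vp.

Lemma cspan_W : cspan W = WC.
Proof.
apply/seteqP; split=> f.
  by apply: cspan_min f => // f /W_WC [].
move=> Wf; rewrite /= (WC_basis sdec sl see Wf).
have cW := cspan_subspace W.
have g1 t : cspan W (gen 1 t) by apply/sub_cspan/gen_W; exact: (eis_int w 1).
have gw t : cspan W (gen w t) by apply/sub_cspan/gen_W; exact: eisw.
have E1 t : gen 1 t = SA t + SB t by rewrite /gen rmorph1 !scale1r.
have kE := kkE w_prim.
apply: (subspaceD cW); apply: csubspace_sum => // t _.
  (* This inverts the system gen 1 = SA + SB, gen w = w SA + wb SB, whose determinant is wb - w. *)
  have -> : SA t = kk *: ((- wb) *: gen 1 t + gen w t).
    apply/funext => v; rewrite /gen rmorph1 (wb_conj w_prim).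
    transitivity (kk * (- wb * (1 * SA t v + 1 * SB t v) + (w * SA t v + wb * SB t v))); last
      by [].
    by transitivity (kk * (w - wb) * SA t v); [rewrite kE mul1r|ring].
  by apply: (subspaceZ (e := idR C) _ cW); apply: cW.2.
have -> : SB t = kk *: (w *: gen 1 t + (-1) *: gen w t).
  apply/funext => v; rewrite /gen rmorph1 (wb_conj w_prim).
  transitivity (kk * (w * (1 * SA t v + 1 * SB t v) + (-1) * (w * SA t v + wb * SB t v))); last
    by [].
  by transitivity (kk * (w - wb) * SB t v); [rewrite kE mul1r|ring].
apply: (subspaceZ (e := idR C) _ cW); apply: cW.2 => //.
by apply: (subspaceZ (e := idR C) _ cW).
Qed.

Lemma W_subspace : is_subspace (QtoC R) W.
Proof.
have h := ratsp_Q; split; first by apply/W_WC; split; [case: h|case: WCs].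
move=> a f g /W_WC [rf Wf] /W_WC [rg Wg]; apply/W_WC; split; first exact: h.2.
exact: WCs.2.
Qed.

(** The forms [gen 1 t] and [gen w t], for the 20 triples [t], are a basis over Q. *)
Lemma dim_W : has_dim (QtoC R) W 40.
Proof.
have -> : 40%N = #|[pred x : bool * triple 6 | true]|.
  by rewrite cardT -cardE card_prod card_bool card_triple6.
pose g (x : bool * triple 6) := gen (if x.1 then 1 else w) x.2.
have sumE (c : bool * triple 6 -> rat) :
    \sum_x QtoC R (c x) *: g x = \sum_t (ratr (c (true, t)) + ratr (c (false, t)) * w) *: SA t
      + \sum_t (ratr (c (true, t)) + ratr (c (false, t)) * wb) *: SB t.
  pose G b t := QtoC R (c (b, t)) *: g (b, t).
  transitivity (\sum_(x : bool * triple 6) G x.1 x.2); first by apply: eq_bigr => -[].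
  rewrite -(pair_bigA _ G) /= big_bool /= -!big_split.
  apply: eq_bigr => t _; rewrite /G /g /gen /= rmorph1 (wb_conj w_prim).
  apply/funext => v; move: (ratr (c (true, t)) : C) (ratr (c (false, t)) : C) => q1 q2.
  transitivity (q1 * (1 * SA t v + 1 * SB t v) + q2 * (w * SA t v + wb * SB t v)); first by [].
  transitivity ((q1 + q2 * w) * SA t v + (q1 + q2 * wb) * SB t v); last by [].
  ring.
apply: (has_dim_pred (b := g)).
- exact: W_subspace.
- by move=> [[] t] _; apply: gen_W; [exact: (eis_int w 1)|exact: eisw].
- move=> f /W_WC [[af rf] Wf].
  have ex (a : 'I_6 -> C6) : (forall i j, eis w (a i 0 j)) -> forall t : triple 6,
      exists r : rat, ternC f (a (tr0 t)) (ee (tr1 t)) (ee (tr2 t)) = ratr r.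
    move=> ha t; apply: rf => i; have [->|->|->] := ord3P i => j;
      [exact: ha|exact: eis_ee|exact: eis_ee].
  have [r0 h0] := choice (ex _ eis_ee); have [r1 h1] := choice (ex _ eis_wee).
  (* The rational p and q with cA f = p + q w at the triple, solved from the values r0 of [f] at (e,
     e', e'') and r1 at (w e, e', e''). *)
  exists (fun x => if x.1 then (r0 x.2 - r1 x.2) / 3 else - (r0 x.2 + 2 * r1 x.2) / 3).
  rewrite sumE {1}(WC_basis sdec sl see Wf).
  have kE := kkE w_prim; have w2 := w_sq w_prim.
  have n3 : 3%:R != 0 :> C by rewrite pnatr_eq0.
  have kw : kk * (2 * w + 1) = 1 by rewrite -[RHS]kE /wb; ring.
  have k0 : kk = - (2 * w + 1) / 3.
    have -> : - (2 * w + 1) / 3 = (kk * (2 * w + 1)) * (- (2 * w + 1) / 3) by rewrite kw mul1r.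
    by field: w2.
  have Er (p q : rat) : ratr ((p - q) / 3) = (ratr p - ratr q) / 3 :> C.
    by rewrite fmorph_div rmorphB /= ratr_nat.
  have Es (p q : rat) : ratr (- (p + 2 * q) / 3) = - (ratr p + 2 * ratr q) / 3 :> C.
    by rewrite fmorph_div rmorphN rmorphD rmorphM /= !ratr_nat.
  congr (_ + _); apply: eq_bigr => t _; congr (_ *: _).
    rewrite /at3 /cA h1 h0 k0 /wb /= Er Es; by field: w2.
  rewrite /at3 /cB h1 h0 k0 /wb /= Er Es; by field: w2.
- move=> c; rewrite sumE => h.
  (* The trilinear part suffices, as 1 and w are independent over Q. *)
  have hA s : ratr (c (true, s)) + ratr (c (false, s)) * w = 0 :> C.
    have := congr1 (fun f : Form => at3 (fun j => ee j) (cA f) s) h.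
    rewrite /at3 -[\sum_t _ in X in cA X]scale1r cA_lin !cA_sum mul1r.
    rewrite (bigD1 s) //= cA_XA // -/(at3 (fun j => ee j) _ s) (at3_cow see) eqxx mulr1.
    rewrite big1 ?addr0 => [|t /negPf ts]; last first.
      by rewrite cA_XA // -/(at3 (fun j => ee j) _ s) (at3_cow see) ts mulr0.
    rewrite big1 ?addr0 => [|t _]; last by rewrite cA_XB // mulr0.
    by move=> ->; rewrite cA0.
  move=> [[] t] _; have [h1 h2] := ratw_free w_prim (hA t); done.
Qed.

Lemma WC_stable f : cspan W f -> cspan W (pb f).
Proof. by rewrite cspan_W; apply: WC_pb. Qed.

Lemma hodge_H3 : is_hodge H3.
Proof. exact: (cohomology_hodge J_lin JJ bc cl cb Lb Li). Qed.

Lemma substructure (U : set Form) : is_subspace (QtoC R) U -> U `<=` ratsp H3 ->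
  (forall f, cspan U f -> cspan U (pb f)) -> is_substructure H3 U.
Proof.
move=> hU sU pU; split => //; first exact: hodge_H3.
exact: (sub_hodgeP J_lin JJ bc cl cb Lb Li hU sU pU).
Qed.

Lemma substructure_W : is_substructure H3 W.
Proof. by apply: substructure; [exact: W_subspace|move=> f /W_WC []|exact: WC_stable]. Qed.

End HodgeOfW.

(** * The splitting of W by the star operator *)

Section HodgeNumbers.
Variables (R : realType) (w : R[i]).
Local Notation C := R[i].
Local Notation C6 := 'rV[R[i]]_6.
Hypothesis w_prim : 3.-primitive_root w.
Variables (Vp : {vspace C6}) (dim_Vp : \dim Vp = 3%N).
Hypothesis Vp_gt0 : forall v, v \in Vp -> v != 0 -> 0 < hform v v.
Local Notation X := (weil_torus w Vp).
Local Notation V := (tV X).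
Local Notation Form := (('I_3 -> V) -> C).
Local Notation H3 := (cohomology X 3).
Local Notation pb := (@pullback R V 3 (@oneJ R X)).
Local Notation WC := (@WC R w Vp).
Local Notation cA := (@cA R w Vp).
Local Notation cB := (@cB R w Vp).
Local Notation W := (@W R w Vp).
Local Notation starW := (@star R w Vp).
Local Notation phiW := (@phi R w Vp).
Implicit Types (f g : Form).

Let WCs := WC_subspace w Vp.

Definition sgb (s : bool) : C := if s then 1 else -1.
Definition WE (s : bool) : set Form := [set f | WC f /\ starW f = sgb s *: f].
Definition Wpm (s : bool) : set Form := [set f | W f /\ starW f = sgb s *: f].

Lemma sgbM s : sgb s * sgb s = 1.
Proof. by case: s; rewrite /sgb ?mulrNN mul1r. Qed.
Lemma sgb_rat s : exists r : rat, sgb s = ratr r.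
Proof. by case: s; [exists 1|exists (-1)]; rewrite ?rmorphN rmorph1. Qed.

Lemma star0 : starW 0 = 0.
Proof. by apply: (addrI (1 *: starW 0)); rewrite -star_lin scaler0 !addr0 scale1r. Qed.
Lemma starZ a f : starW (a *: f) = a *: starW f.
Proof. by rewrite -[a *: f]addr0 star_lin star0 addr0. Qed.
Lemma starD f g : starW (f + g) = starW f + starW g.
Proof. by rewrite -[f in LHS]scale1r star_lin scale1r. Qed.

Lemma WE_subspace s : is_subspace (idR C) (WE s).
Proof.
split; first by split; [case: WCs|rewrite star0 scaler0].
move=> a f g [Wf sf] [Wg sg]; split; first exact: WCs.2.
rewrite star_lin sf sg; apply/funext => v.
transitivity (a * (sgb s * f v) + sgb s * g v); first by [].
transitivity (sgb s * (a * f v + g v)); last by []. 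
ring.
Qed.

Lemma Wpm_subspace s : is_subspace (QtoC R) (Wpm s).
Proof.
have hW := W_subspace w Vp.
split; first by split; [case: hW|rewrite star0 scaler0].
move=> a f g [Wf sf] [Wg sg]; split; first exact: hW.2.
rewrite -[QtoC R a]/(ratr a : C) star_lin sf sg; apply/funext => v.
transitivity (ratr a * (sgb s * f v) + sgb s * g v); first by [].
transitivity (sgb s * (ratr a * f v + g v)); last by [].
ring.
Qed.

Lemma eis_det n (A : 'M[C]_n) : (forall i j, eis w (A i j)) -> eis w (\det A).
Proof.
move=> hA; apply: eis_sum => s _; apply: (eisM w_prim).
  elim: (nat_of_bool s) => [|k IH]; first exact: (eis_int w 1).
  rewrite exprS; apply: (eisM w_prim) => //; exact: (eis_int w (-1)).
by elim/big_rec: _ => [|i x _ hx]; [exact: (eis_int w 1)|apply: (eisM w_prim)].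
Qed.

Lemma eis_Dt t (x y z : C6) : (forall j, eis w (x 0 j)) -> (forall j, eis w (y 0 j)) ->
  (forall j, eis w (z 0 j)) -> eis w (Dt t x y z).
Proof.
have hr (u : C6) : (forall j, eis w (u 0 j)) -> forall j, eis w (hrow u 0 j).
  by move=> hu j; rewrite mxE; apply: (eis_hform w_prim) => // k; apply: eis_ee.
move=> hx hy hz; apply: eis_det => i j; rewrite mxE.
case: i => [[|[|[|[|[|[|//]]]]]] hi] /=; try exact: eis_ee; exact: hr.
Qed.

(* If D = x + y w and f has rational values F0, F1 on (e, e', e'') and (w e, e', e''),
   then the corresponding term of star f is F1 y + F0 x. *)
Lemma star_W f : W f -> W (starW f).
Proof.
move=> /W_WC [[af rf] Wf]; have Ws := star_WC w_prim f; apply/W_WC; split => //.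
split; first by case: Ws.
move=> v Lv; have -> : starW f v = \sum_(t : triple 6)
   (std (cB f) t * (Dt t (v 0) (v 1) (v 2))^* + std (cA f) t * Dt t (v 0) (v 1) (v 2)).
  by rewrite big_split.
rewrite -/(is_rat _); apply: is_rat_sum => t _.
have [x [y hD]] : eis w (Dt t (v 0) (v 1) (v 2)) by apply: eis_Dt; exact: Lv.
have ex (a : 'I_6 -> C6) : (forall i j, eis w (a i 0 j)) -> 
    is_rat (ternC f (a (tr0 t)) (delta_mx 0 (tr1 t)) (delta_mx 0 (tr2 t))).
  move=> ha; apply: rf => i; have [->|->|->] := ord3P i => j;
    [exact: ha|exact: eis_ee|exact: eis_ee].
have r0 := ex _ (@eis_ee R w); have r1 := ex _ (eis_wee w_prim).
have -> : std (cB f) t * (Dt t (v 0) (v 1) (v 2))^* + std (cA f) t * Dt t (v 0) (v 1) (v 2) =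
   ternC f (w *: delta_mx 0 (tr0 t)) (delta_mx 0 (tr1 t)) (delta_mx 0 (tr2 t)) * y%:~R +
   ternC f (delta_mx 0 (tr0 t)) (delta_mx 0 (tr1 t)) (delta_mx 0 (tr2 t)) * x%:~R.
  rewrite hD rmorphD rmorphM /= !rmorph_int (wb_conj w_prim) /std /cA /cB.
  set F1 := ternC f (w *: _) _ _; set F0 := ternC f _ _ _.
  transitivity (kk w * (w - wb w) * (F1 * y%:~R + F0 * x%:~R)); first by ring.
  by rewrite (kkE w_prim) mul1r.
by apply: is_ratD; apply: is_ratM => //; apply: is_rat_int.
Qed.

Lemma phi_W f : W f -> W (phiW f).
Proof.
move=> /W_WC [[af rf] Wf]; have Wp := phi_WC w_prim Wf; apply/W_WC; split => //.
split; first by case: Wp.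
move=> v Lv; rewrite /phi /unt -/(is_rat _); apply: is_ratD.
  apply: is_ratM; first by exists 2; rewrite ratr_nat.
  apply: rf => i; have [->|->|->] := ord3P i; rewrite /tri /=; try exact: Lv.
  by apply: (eis_Theta w_prim); [exact: eisw|exact: Lv].
by apply: rf => i; have [->|->|->] := ord3P i; exact: Lv.
Qed.

(** The projector (1 + s star) / 2 preserves [W], so applied to an expansion of [f] in [W] it yields
    an expansion in the rational eigenspace. *)
Lemma cspan_Wpm s : cspan (Wpm s) = WE s.
Proof.
apply/seteqP; split=> f.
  apply: cspan_min f; first exact: WE_subspace.
  by move=> f [/W_WC [_ Wf] sf].
move=> [Wf sf]; have : cspan W f by rewrite (cspan_W w_prim).
move=> [n [c [u [Wu fE]]]].
exists n, (fun i => 2^-1 * c i), (fun i => u i + sgb s *: starW (u i)); split.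
  move=> i; have Wui := Wu i; have [r hr] := sgb_rat s.
  have WCi : WC (u i) by have /W_WC [] := Wui.
  split.
    rewrite addrC hr; apply: (W_subspace w Vp).2 => //; exact: star_W.
  rewrite starD starZ (starK w_prim WCi) scalerDr scalerA sgbM scale1r addrC //.
have half : f = 2^-1 *: f + (2^-1 * sgb s) *: starW f.
  rewrite sf scalerA -mulrA sgbM mulr1 -scalerDl.
  have -> : 2^-1 + 2^-1 = 1 :> C by field.
  by rewrite scale1r.
have sum0 : starW f = \sum_i c i *: starW (u i).
  rewrite fE; elim/big_rec2: _ => [|i a b _ <-]; first exact: star0.
  by rewrite star_lin.
rewrite {1}half sum0 fE !scaler_sumr -big_split; apply: eq_bigr => i _ /=.
apply/funext => v; transitivity (2^-1 * (c i * u i v) + 2^-1 * sgb s * (c i * starW (u i) v));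
  first by [].
transitivity (2^-1 * c i * (u i v + sgb s * starW (u i) v)); last by [].
ring.
Qed.

Lemma WE_pb s f : WE s f -> WE s (pb f).
Proof.
move=> [Wf sf]; split; first exact: WC_pb.
by rewrite (star_pb w_prim dim_Vp Vp_gt0 Wf) sf.
Qed.

Lemma substructure_Wpm s : is_substructure H3 (Wpm s).
Proof.
apply: (substructure w_prim dim_Vp Vp_gt0); first exact: Wpm_subspace.
- by move=> f [/W_WC [] ].
- by move=> f; rewrite cspan_Wpm; apply: WE_pb.
Qed.

Lemma Wpm_direct : direct_sum (fun s : bool => if s then Wpm true else Wpm false) W.
Proof.
have hW := W_subspace w Vp.
have selE s : (if s then Wpm true else Wpm false) = Wpm s by case: s.
split.
- move=> u hu; rewrite big_bool; apply: (subspaceD hW).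
    by have [] := hu true.
  by have [] := hu false.
- move=> f Wf; have Ws := star_W Wf; have /W_WC [_ WCf] := Wf.
  have q2 : (2^-1 : C) = ratr 2^-1 by rewrite -[2 in LHS](ratr_nat C 2) -fmorphV.
  exists (fun s => 2^-1 *: (sgb s *: starW f + f)).
    move=> s; rewrite selE; have [r hr] := sgb_rat s; split.
      by rewrite q2; apply: (subspaceZ _ hW); rewrite hr; apply: hW.2.
    rewrite starZ star_lin (starK w_prim WCf); apply/funext => v.
    transitivity (2^-1 * (sgb s * f v + starW f v)); first by [].
    transitivity (sgb s * (2^-1 * (sgb s * starW f v + f v))); last by [].
    transitivity (2^-1 * (sgb s * f v + (sgb s * sgb s) * starW f v)); last by ring.
    by rewrite sgbM mul1r.
  rewrite big_bool; apply/funext => v.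
  transitivity (2^-1 * (1 * starW f v + f v) + 2^-1 * (-1 * starW f v + f v)); last by [].
  by field.
- move=> u hu; rewrite big_bool /= => h.
  have [_ h1] := hu true; have [_ h2] := hu false; rewrite /= in h1 h2.
  have e : u true = - u false by apply/eqP; rewrite -addr_eq0 h.
  have e2 : u true = u false.
    move: h1; rewrite e -scaleN1r starZ h2 /sgb scale1r scalerA mulrNN mul1r scale1r.
    by move=> <-; rewrite ?scaleN1r.
  have z : u false = 0.
    apply/funext => v; have := congr1 (fun f : Form => f v) e; rewrite e2 => h'.
    by apply: oppr_id0; exact: h'.
  by case; rewrite ?e2.
Qed.

End HodgeNumbers.

(** * Hodge numbers, isomorphism and polarization *)

Section HodgeNumbersCount.
Variables (R : realType) (w : R[i]).
Local Notation C := R[i].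
Local Notation C6 := 'rV[R[i]]_6.
Local Notation conjc := (Num.conj : {rmorphism C -> C}).
Hypothesis w_prim : 3.-primitive_root w.
Variables (Vp : {vspace C6}) (dim_Vp : \dim Vp = 3%N).
Hypothesis Vp_gt0 : forall v, v \in Vp -> v != 0 -> 0 < hform v v.
Local Notation X := (weil_torus w Vp).
Local Notation V := (tV X).
Local Notation Form := (('I_3 -> V) -> C).
Local Notation H3 := (cohomology X 3).
Local Notation pb := (@pullback R V 3 (@oneJ R X)).
Local Notation WC := (@WC R w Vp).
Local Notation cA := (@cA R w Vp).
Local Notation cB := (@cB R w Vp).
Local Notation W := (@W R w Vp).
Local Notation starW := (@star R w Vp).
Local Notation phiW := (@phi R w Vp).
Implicit Types (f g : Form).

Let hpq p q f : (p + q = 3)%N -> hcomp H3 p q f <-> is_altform f /\ pb f = lam R p *: f.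
Proof.
exact: (HpqP (@tJ_linear R w Vp) (tJJ dim_Vp Vp_gt0) (@lb_lc R w w_prim Vp) (@lc_elin R w Vp)
  (lc_lb w_prim Vp)).
Qed.

Lemma star_sum (I : Type) (s : seq I) (P : pred I) (k : I -> C) (g : I -> Form) :
  starW (\sum_(i <- s | P i) k i *: g i) = \sum_(i <- s | P i) k i *: starW (g i).
Proof. by elim/big_rec2: _ => [|i a b _ <-]; [exact: star0|rewrite star_lin]. Qed.

(** The antitrilinear part of an eigenform is, up to the sign, the star of its trilinear part: an
    eigenspace is a graph over the trilinear forms. *)
Lemma WE_graph s f : WE s f -> let h := AB (cA f) (fun _ _ _ => 0) in
  f = sgb R s *: starW h + h.
Proof.
move=> [Wf sf] h; have aA := cA_alt w_prim Wf.
have zB : alt3 conjc (fun _ _ _ : C6 => 0 : C) := alt3_0 _ _.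
have hA : cA h = cA f := cA_AB w_prim Vp aA zB.
have hB : cB h = fun _ _ _ => 0 := cB_AB w_prim Vp aA zB.
have t0 x y z : tauB (fun _ _ _ : C6 => 0 : C) x y z = 0.
  by rewrite /tauB big1 // => t _; rewrite /std mul0r.
have cBf x y z : cB f x y z = sgb R s * tau (cA f) x y z.
  have <- : cB (starW f) = tau (cA f) := cB_star w_prim f.
  by rewrite sf -[_ *: f]addr0 cB_lin cB0 addr0 mulrA sgbM mul1r.
apply: (WC_ext w_prim); do 3 apply/funext => ?.
  by rewrite cA_lin (cA_star w_prim) hB hA t0 mulr0 add0r.
by rewrite cB_lin (cB_star w_prim) hB hA addr0.
Qed.

Section Adapted.
Variables (u : 'I_6 -> C6) (y : 'I_6 -> C6 -> C).
Hypothesis uy : forall x, x = \sum_i y i x *: u i.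
Hypothesis ylin : forall i a x x', y i (a *: x + x') = a * y i x + y i x'.
Hypothesis yu : forall i j, y i (u j) = (i == j)%:R.
Hypothesis uJ : forall i : 'I_6, Jop Vp (u i) = (if small i then 'i else - 'i) *: u i.
Local Notation YA := (@XA R w Vp y).
Local Notation YB := (@XB R w Vp y).

Lemma yJ (i : 'I_6) v : y i (Jop Vp v) = (if small i then 'i else - 'i) * y i v.
Proof.
have y0 j : y j 0 = 0 by apply: (addrI (1 * y j 0)); rewrite -ylin scaler0 !addr0 mul1r.
have ysum (r : 'I_6 -> C) : y i (\sum_j r j *: u j) = r i.
  have -> : y i (\sum_j r j *: u j) = \sum_j r j * y i (u j).
    by elim/big_rec2: _ => [|j a b _ <-].
  by rewrite (bigD1 i) //= yu eqxx mulr1 big1 ?addr0 // => j /negPf ji; rewrite yu eq_sym ji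
    mulr0.
have -> : Jop Vp v = \sum_(j : 'I_6) ((if small j then 'i else - 'i) * y j v) *: u j.
  rewrite {1}(uy v); elim/big_rec2: _ => [|j a b _ <-].
    by have := JopZ Vp 0 0; rewrite !scale0r.
  by rewrite Jop_linear uJ scalerA mulrC.
by rewrite ysum.
Qed.

Lemma y_real_linear (i : 'I_6) : @real_linear R V (y i).
Proof. by move=> r a b; have := ylin i r%:C%C a b. Qed.

Lemma y_H1 (i : 'I_6) : if small i then @H10 R X (y i) else @H01 R X (y i).
Proof.
have h v := yJ i v; have hr := y_real_linear i.
by case: (small i) h => h; split.
Qed.

Lemma yc_H1 (i : 'I_6) : if ~~ small i then @H10 R X (fun v => (y i v)^*) else @H01 R X (fun v
  => (y i v)^*).
Proof.
have h v := yJ i v.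
have hr : @real_linear R V (fun v => (y i v)^*).
  move=> r a b; rewrite y_real_linear rmorphD rmorphM /=; congr (_ * _ + _).
  exact: conjc_real.
case: (small i) h => h; split => // v; rewrite /= h rmorphM /= ?rmorphN /= conjCi //.
by rewrite opprK.
Qed.

Lemma YA_Hpq t : hcomp H3 (ptype t) (3 - ptype t) (YA t).
Proof. exact: (wedge_Hpq (y_H1 (tr0 t)) (y_H1 (tr1 t)) (y_H1 (tr2 t))). Qed.

(** Conjugation exchanges H^{1,0} and H^{0,1}, so the antitrilinear copy carries the reversed
    type. *)
Lemma YB_Hpq t : hcomp H3 (3 - ptype t) (ptype t) (YB t).
Proof.
have := wedge_Hpq (yc_H1 (tr0 t)) (yc_H1 (tr1 t)) (yc_H1 (tr2 t)).
rewrite /ptype; by case: (small (tr0 t)); case: (small (tr1 t)); case: (small (tr2 t)).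
Qed.

Lemma u_Mm (i : 'I_6) : u i *m Mm Vp = (1 + (if small i then 'i else - 'i)) *: u i.
Proof. by rewrite MmE /oneJC uJ scalerDl scale1r. Qed.

(** Evaluated on the eigenvectors [u] of [J], the operator multiplies the coefficient at [t] by lam
    (ptype t), which differs from lam p. *)
Lemma at3_cA f p : WC f -> pb f = lam R p *: f -> (p <= 3)%N -> forall t,
  ptype t != p -> at3 u (cA f) t = 0.
Proof.
move=> Wf hf p3 t tp; have := congr1 (fun g => at3 u (cA g) t) hf; rewrite cA_pb.
rewrite /at3 -[_ *: f]addr0 cA_lin cA0 addr0 -/(at3 u (cA f) t) !u_Mm.
have a := cA_alt w_prim Wf; have [l _ _] := a.
rewrite (elinZ _ _ (l _ _)) (elinZ _ _ (alt3_lin2 _ _ a)) (elinZ _ _ (alt3_lin3 _ _ a)) /=.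
rewrite -/(at3 u (cA f) t) => h.
have : (lam R (ptype t) - lam R p) * at3 u (cA f) t = 0.
  rewrite mulrBl -h /ptype; case: (small _); case: (small _); case: (small _) => /=;
  rewrite /lam /=; ring.
move/eqP; rewrite mulf_eq0 subr_eq0 => /orP[/eqP|/eqP //].
by move/(lam_inj (ptype_le3 t) p3) => e; rewrite e eqxx in tp.
Qed.

Lemma at3_cB f p : WC f -> pb f = lam R p *: f -> (p <= 3)%N -> forall t,
  ptype t != (3 - p)%N -> at3 u (cB f) t = 0.
Proof.
move=> Wf hf p3 t tp; have := congr1 (fun g => at3 u (cB g) t) hf; rewrite cB_pb.
rewrite /at3 -[_ *: f]addr0 cB_lin cB0 addr0 -/(at3 u (cB f) t) !u_Mm.
have a := cB_alt w_prim Wf; have [l _ _] := a.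
rewrite (elinZ _ _ (l _ _)) (elinZ _ _ (alt3_lin2 _ _ a)) (elinZ _ _ (alt3_lin3 _ _ a)) /=.
rewrite -/(at3 u (cB f) t) => h.
have iN : (- 'i : C)^* = 'i by rewrite rmorphN /= conjCi opprK.
have : (lam R (3 - ptype t) - lam R p) * at3 u (cB f) t = 0.
  rewrite mulrBl -h /ptype !rmorphD !rmorph1 /=.
  case: (small _); case: (small _); case: (small _) => /=;
  rewrite ?iN ?conjCi ?subnn ?subSS ?subn0 /lam /=; ring.
move/eqP; rewrite mulf_eq0 subr_eq0 => /orP[/eqP|/eqP //].
move/(lam_inj (leq_subr _ _) p3) => e; case/eqP: tp; rewrite -e.
by have := ptype_le3 t; lia.
Qed.

(** The trilinear forms contribute the triples with [ptype] p, the antitrilinear ones, by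
    conjugation, those with [ptype] q. *)
Lemma W_hodge_dim p q : (p + q = 3)%N ->
  has_dim (idR C) (hcomp (sub_hodge H3 W) p q)
    (#|[pred t : triple 6 | ptype t == p]| + #|[pred t : triple 6 | ptype t == q]|).
Proof.
move=> pq; have p3 : (p <= 3)%N by lia.
have qE : (3 - p = q)%N by lia.
pose P := [pred x : bool * triple 6 | if x.1 then ptype x.2 == p else ptype x.2 == q].
pose g (x : bool * triple 6) : Form := if x.1 then YA x.2 else YB x.2.
have sumE (A : Type) (x0 : A) (op : Monoid.com_law x0) (G : bool * triple 6 -> A) :
  \big[op/x0]_(x | P x) G x = op (\big[op/x0]_(t | ptype t == p) G (true, t))
    (\big[op/x0]_(t | ptype t == q) G (false, t)).
  pose G' b t := if P (b, t) then G (b, t) else x0.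
  rewrite big_mkcond; transitivity (\big[op/x0]_(x : bool * triple 6) G' x.1 x.2).
    by apply: eq_bigr => -[].
  by rewrite -(pair_bigA _ G') /= big_bool /= -!big_mkcond.
have -> : (#|[pred t : triple 6 | ptype t == p]| + #|[pred t : triple 6 | ptype t == q]|)%N =
  #|P|.
  by rewrite -!sum1_card (sumE nat 0%N _ (fun=> 1%N)).
have cW := cspan_W w_prim Vp.
apply: (has_dim_pred (b := g)).
- by apply: subspaceI; [exact: cspan_subspace|exact: Hpq_subspace].
- move=> [[] t] /= /eqP h; split; rewrite /g ?cW /=.
  + by apply: XA_WC.
  + by rewrite -h; have -> : q = (3 - ptype t)%N by [lia]; apply: YA_Hpq.
  + by apply: XB_WC.
  + by rewrite -h; have -> : p = (3 - ptype t)%N by [lia]; apply: YB_Hpq.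
- move=> f [Wf /(hpq _ pq) [af hf]]; rewrite cW in Wf.
  exists (fun x => if x.1 then at3 u (cA f) x.2 else at3 u (cB f) x.2).
  rewrite (sumE Form 0) /= {1}(WC_basis w_prim uy ylin yu Wf).
  congr (_ + _); rewrite [RHS]big_mkcond; apply: eq_bigr => t _; case: ifP => // /negbT tp.
    by rewrite (at3_cA Wf hf p3 tp) scale0r.
  by rewrite (at3_cB Wf hf p3) ?scale0r // qE.
- move=> c h [b s] Ps; pose k := if b then at3 u (cA (\sum_(x | P x) idR C (c x) *: g x)) s
     else at3 u (cB (\sum_(x | P x) idR C (c x) *: g x)) s.
  have k0 : k = 0 by rewrite /k h /at3 cA0 cB0; case: b {k Ps}.
  rewrite -k0 /k /at3 cA_sum cB_sum; case: b Ps {k k0} => Ps.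
    rewrite (sumE C 0) /= [X in _ + X]big1 ?addr0; last by move=> t _; rewrite cA_XB // mulr0.
    rewrite (bigD1 s) //= cA_XA // -/(at3 u _ s) (at3_cow yu) eqxx mulr1 big1 ?addr0 //.
    by move=> t /andP[_ /negPf ts]; rewrite cA_XA // -/(at3 u _ s) (at3_cow yu) ts mulr0.
  rewrite (sumE C 0) /= [X in X + _]big1 ?add0r; last by move=> t _; rewrite cB_XA // mulr0.
  rewrite (bigD1 s) //= cB_XB // -/(at3 u _ s) (at3_cow yu) eqxx mulr1 big1 ?addr0 //.
  by move=> t /andP[_ /negPf ts]; rewrite cB_XB // -/(at3 u _ s) (at3_cow yu) ts mulr0.
Qed.

(** The basis consists of YA t plus s times its star. The star commutes with 1 + J and so keeps the
    type, and the trilinear part of a combination reads off its coefficients. *)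
Lemma Wpm_hodge_dim s p q : (p + q = 3)%N ->
  has_dim (idR C) (hcomp (sub_hodge H3 (@Wpm R w Vp s)) p q)
    #|[pred t : triple 6 | ptype t == p]|.
Proof.
move=> pq; have p3 : (p <= 3)%N by lia.
pose g t : Form := sgb R s *: starW (YA t) + YA t.
have cW := cspan_Wpm w_prim Vp s.
have WA t : WC (YA t) by apply: XA_WC.
have sA t : cA (starW (YA t)) = fun _ _ _ => 0.
  rewrite (cA_star w_prim) cB_XA //; do 3 apply/funext => ?.
  by rewrite /tauB big1 // => i _; rewrite /std mul0r.
apply: (has_dim_pred (b := g)).
- by apply: subspaceI; [exact: cspan_subspace|exact: Hpq_subspace].
- move=> t /= /eqP tp; split; rewrite ?cW.
    split; first by apply: (WC_subspace w Vp).2 => //; apply: star_WC.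
    rewrite /g star_lin (starK w_prim (WA t)); apply/funext => v.
    transitivity (sgb R s * YA t v + starW (YA t) v); first by [].
    transitivity (sgb R s * (sgb R s * starW (YA t) v + YA t v)); last by [].
    transitivity (sgb R s * YA t v + (sgb R s * sgb R s) * starW (YA t) v); last by ring.
    by rewrite sgbM mul1r.
  have hA : hcomp H3 p q (YA t).
    by rewrite -tp; have -> : q = (3 - ptype t)%N by [lia]; apply: YA_Hpq.
  apply: (Hpq_subspace X p q).2 => //; apply/(hpq _ pq); split.
    by case: (star_WC w_prim (YA t)).
  have /(hpq _ pq) [_ h] := hA.
  by rewrite -(star_pb w_prim dim_Vp Vp_gt0 (WA t)) h starZ.
- move=> f [Wf /(hpq _ pq) [af hf]]; rewrite cW in Wf; have [WCf sf] := Wf.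
  exists (fun t => at3 u (cA f) t).
  have hE : AB (cA f) (fun _ _ _ => 0) = \sum_(t | ptype t == p) at3 u (cA f) t *: YA t.
    apply/funext => v; rewrite fct_sumE /AB /unt addr0 [RHS]big_mkcond.
    rewrite (alt3_basis uy (c_elin ylin (idR C)) yu (cA_alt w_prim WCf)).
    apply: eq_bigr => t _; case: ifP => // /negbT tp.
    by rewrite -/(at3 u (cA f) t) (at3_cA WCf hf p3 tp) mul0r.
  rewrite {1}(WE_graph Wf) hE star_sum scaler_sumr -big_split; apply: eq_bigr => t _ /=.
  apply/funext => v; set k := at3 _ _ _.
  transitivity (sgb R s * (k * starW (YA t) v) + k * YA t v); first by [].
  transitivity (k * (sgb R s * starW (YA t) v + YA t v)); last by [].
  ring.
- move=> c h r rp.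
  have : at3 u (cA (\sum_(t | ptype t == p) idR C (c t) *: g t)) r = 0.
    by rewrite h /at3 cA0.
  rewrite /at3 cA_sum (bigD1 r) //= cA_lin sA cA_XA // -/(at3 u _ r) (at3_cow yu) eqxx.
  rewrite mulr0 add0r mulr1 big1 ?addr0 //.
  move=> t /andP[_ /negPf ts]; rewrite cA_lin sA cA_XA // -/(at3 u _ r) (at3_cow yu) ts.
  by rewrite mulr0 addr0 mulr0.
Qed.

End Adapted.

Lemma adapted_J : exists (u : 'I_6 -> C6) (y : 'I_6 -> C6 -> C),
  [/\ forall x, x = \sum_i y i x *: u i,
      forall i a x x', y i (a *: x + x') = a * y i x + y i x',
      forall i j, y i (u j) = (i == j)%:R
    & forall i : 'I_6, Jop Vp (u i) = (if small i then 'i else - 'i) *: u i].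
Proof.
have [u [y [uy ylin yu uV uW]]] := adapted_basis dim_Vp Vp_gt0.
exists u, y; split => // i; case: (@split_ordP 3 3 i) => j ->.
  by rewrite (Jop_Vp Vp_gt0 (uV j)) /small /= ltn_ord.
by rewrite (Jop_hperp Vp_gt0 (uW j)).
Qed.

Lemma W_hodge_numbers : has_hodge_numbers (sub_hodge H3 W) [:: 2; 18; 18; 2]%N.
Proof.
have [u [y [uy ylin yu uJ]]] := adapted_J.
split => // q q3; have pq : (3 - q + q = 3)%N by rewrite /= in q3; lia.
have := W_hodge_dim uy ylin yu uJ pq; rewrite !card_ptype.
by move: q q3 {pq} => [|[|[|[|q]]]].
Qed.

Lemma Wpm_hodge_numbers s :
  has_hodge_numbers (sub_hodge H3 (@Wpm R w Vp s)) [:: 1; 9; 9; 1]%N.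
Proof.
have [u [y [uy ylin yu uJ]]] := adapted_J.
split => // q q3; have pq : (3 - q + q = 3)%N by rewrite /= in q3; lia.
have := Wpm_hodge_dim uy ylin yu uJ s pq; rewrite !card_ptype.
by move: q q3 {pq} => [|[|[|[|q]]]].
Qed.

Lemma Wpm_calabi_yau s : calabi_yau_type (sub_hodge H3 (@Wpm R w Vp s)).
Proof.
split; first by have [] := substructure_Wpm w_prim dim_Vp Vp_gt0 s.
by have [_ h] := Wpm_hodge_numbers s; have := h 0%N isT.
Qed.

Lemma phi_WE s f : WE s f -> WE (~~ s) (phiW f).
Proof.
move=> [Wf sf]; split; first exact: phi_WC.
rewrite (phi_star w_prim Wf) sf.
have -> : phiW (sgb R s *: f) = sgb R s *: phiW f.
  have p0 : phiW 0 = 0 by apply: (addrI (1 *: phiW 0)); rewrite -phi_lin scaler0 !addr0 scale1r.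
  by rewrite -[sgb R s *: f]addr0 phi_lin p0 addr0.
by rewrite -scaleNr; case: s {sf} => /=; rewrite ?opprK.
Qed.

Lemma phi_Hpq p q f : (p + q = 3)%N -> WC f -> hcomp H3 p q f -> hcomp H3 p q (phiW f).
Proof.
move=> pq Wf /(hpq _ pq) [af hf]; apply/(hpq _ pq); split.
  by case: (phi_WC w_prim Wf).
have p0 : phiW 0 = 0 by apply: (addrI (1 *: phiW 0)); rewrite -phi_lin scaler0 !addr0 scale1r.
by rewrite -(phi_pb w_prim Wf) hf -[lam R p *: f]addr0 phi_lin p0 addr0.
Qed.

Lemma phi_morphism s : hodge_morphism (sub_hodge H3 (@Wpm R w Vp s))
  (sub_hodge H3 (@Wpm R w Vp (~~ s))) phiW.
Proof.
split => //=.
- by move=> a u v _ _; apply: phi_lin.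
- move=> u [Wu su]; have /W_WC [_ WCu] := Wu; split; first exact: (phi_W w_prim).
  by have [] := phi_WE (conj WCu su : WE s u).
- move=> p q u pq [+ hu]; rewrite !(cspan_Wpm w_prim) => Eu; split; first exact: phi_WE.
  by apply: phi_Hpq => //; case: Eu.
Qed.

Lemma Wpm_isomorphic : hodge_isomorphic (sub_hodge H3 (@Wpm R w Vp true))
  (sub_hodge H3 (@Wpm R w Vp false)).
Proof.
have [e1 lin1 rat1 hp1] := phi_morphism true; have [e2 lin2 rat2 hp2] := phi_morphism false.
have q3 : (-3)^-1 = ratr (-3)^-1 :> C.
  by rewrite -[in LHS](ratr_nat C 3) -rmorphN -fmorphV.
have n3 : (-3 : C) != 0 by rewrite oppr_eq0 pnatr_eq0.
have WCm s u : (@Wpm R w Vp s) u -> WC u by move=> [/W_WC [] ].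
have p0 : phiW 0 = 0 by apply: (addrI (1 *: phiW 0)); rewrite -phi_lin scaler0 !addr0 scale1r.
have phiZ a u : phiW (a *: u) = a *: phiW u by rewrite -[a *: u]addr0 phi_lin p0 addr0.
(* [phi] squares to -3 on Theta-invariant forms, which fixes the scalar of the inverse. *)
exists phiW, (fun u => (-3)^-1 *: phiW u); split.
- exact: phi_morphism true.
- split; first by [].
  + move=> a u v _ _; rewrite phi_lin scalerDr !scalerA; congr (_ *: _ + _); exact: mulrC.
  + move=> u hu; rewrite q3; apply: (subspaceZ _ (Wpm_subspace w Vp true)); exact: rat2.
  + move=> p q u pq hu; have [h1 h2] := hp2 p q u pq hu.
    have sI := subspaceI (cspan_subspace (@Wpm R w Vp true)) (Hpq_subspace X p q).
    exact: (subspaceZ (e := idR C) (-3)^-1 sI (conj h1 h2)).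
- move=> u hu; rewrite (phi_phi w_prim (WCm _ _ hu)); exact: (scalerK n3 u).
- move=> u hu; rewrite phiZ (phi_phi w_prim (WCm _ _ hu)); exact: (scalerK n3 u).
Qed.

Lemma Wpm_polarized s : polarized_substructure H3 (@Wpm R w Vp s).
Proof.
have sub := substructure_Wpm w_prim dim_Vp Vp_gt0 s; split => //.
exists (Qform (@lb R w Vp) (@lbs R w Vp)).
have pol := H3_polarization w_prim dim_Vp Vp_gt0; split => //.
by case: sub => _ sU hU; apply: polarization_sub.
Qed.

End HodgeNumbersCount.

Theorem mainTheorem6 (R : realType) (w : R[i])
  (w_prim : 3.-primitive_root w)
  (Vp : {vspace 'rV[R[i]]_6}) (dim_Vp : \dim Vp = 3%N)
  (Vp_gt0 : forall v, v \in Vp -> v != 0 -> 0 < hform v v) :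
  let X := weil_torus w Vp in
  let Theta : tV X -> tV X := fun v => w *: (v : 'rV[R[i]]_6) in
  let H3 := cohomology X 3 in
  let W := [set f | ratsp H3 f /\ pullback Theta f - f = 0] in
  [/\ @is_ppav R X (@formE R) 6,
      @is_weil_type R X 3 (Qadjoin w) (fun k v => k *: (v : 'rV[R[i]]_6)),
      is_automorphism Theta /\ has_order Theta 3,
      [/\ is_substructure H3 W, has_dim (QtoC R) W 40
        & has_hodge_numbers (sub_hodge H3 W) [:: 2; 18; 18; 2]%N] &
      exists Wp Wm : set (('I_3 -> tV X) -> R[i]),
        [/\ is_substructure H3 Wp /\ is_substructure H3 Wm,
            direct_sum (fun s : bool => if s then Wp else Wm) W,
            hodge_isomorphic (sub_hodge H3 Wp) (sub_hodge H3 Wm),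
            (calabi_yau_type (sub_hodge H3 Wp) /\
             has_hodge_numbers (sub_hodge H3 Wp) [:: 1; 9; 9; 1]%N) /\
            (calabi_yau_type (sub_hodge H3 Wm) /\
             has_hodge_numbers (sub_hodge H3 Wm) [:: 1; 9; 9; 1]%N) &
            polarized_substructure H3 Wp]].
Proof.
split.
- exact: weil_torus_ppav.
- exact: weil_type.
- by split; [exact: Theta_automorphism|exact: Theta_order].
- split; [exact: (substructure_W w_prim dim_Vp Vp_gt0)|exact: (dim_W w_prim Vp)|].
  exact: (W_hodge_numbers w_prim dim_Vp Vp_gt0).
- exists (@Wpm R w Vp true), (@Wpm R w Vp false); split.
  + by split; apply: substructure_Wpm.
  + exact: (Wpm_direct w_prim).
  + exact: (Wpm_isomorphic w_prim dim_Vp Vp_gt0).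
  + by split; split; [exact: Wpm_calabi_yau|exact: Wpm_hodge_numbers
                     |exact: Wpm_calabi_yau|exact: Wpm_hodge_numbers].
  + exact: (Wpm_polarized w_prim dim_Vp Vp_gt0).
Qed.
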